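(* Let $n\geq 1$ be an integer and let $K_n$ denote the complete graph on $n$ vertices. Then $\theta(4,K_n)=\left\lceil \frac{n+2}{4}\right\rceil$ for $n\neq 6$, and $\theta(4,K_6)=3$.
   Context: All graphs are finite and simple. The girth of a graph is the length of its shortest cycle, or $\infty$ if the graph is acyclic. A graph is planar if it can be drawn in the plane without edge crossings. For an integer $g\geq 3$ and a graph $G$, the $g$-girth-thickness $\theta(g,G)$ is the minimum number of planar subgraphs of $G$, each of girth at least $g$, whose union is $G$. In particular, $\theta(4,G)$ is the minimum number of planar triangle-free subgraphs whose union is $G$. *)

(* Defs.v *)
From HB Require Import structures.
From mathcomp Require Import all_boot all_order all_algebra.
From mathcomp Require Import all_classical all_reals all_analysis.

Set Implicit Arguments.
Unset Strict Implicit.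
Unset Printing Implicit Defensive.

Import Order.TTheory GRing.Theory Num.Theory.
Import numFieldNormedType.Exports.

Local Open Scope classical_set_scope.
Local Open Scope ring_scope.

(** Finite simple graphs with vertices drawn from [T].  The vertex set is part
    of the graph, so that a subgraph need not be spanning. *)
Record graph (T : finType) := Graph {
  vertices : {set T};
  edges : {set {set T}};
  edgesP : forall e, e \in edges -> (e \subset vertices) && (#|e| == 2%N) }.

Definition adj (T : finType) (G : graph T) : rel T :=
  fun x y => [set x; y]%SET \in edges G.

Definition subgraph (T : finType) (H G : graph T) : Prop :=
  (vertices H \subset vertices G) /\ (edges H \subset edges G).

Lemma complete_edgesP (n : nat) (e : {set 'I_n}) :
  e \in [set e : {set 'I_n} | #|e| == 2%N]%SET ->
  (e \subset [set: 'I_n]%SET) && (#|e| == 2%N).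
Proof. by rewrite inE finset.subsetT. Qed.

Definition complete (n : nat) : graph 'I_n := Graph (@complete_edgesP n).

Definition is_cycle (T : finType) (G : graph T) (c : seq T) : Prop :=
  ucycle (adj G) c /\ (2 < size c)%N.

(** The infimum of the empty set is [+oo], the girth of an acyclic graph. *)
Definition girth (R : realType) (T : finType) (G : graph T) : \bar R :=
  ereal_inf [set (size c)%:R%:E | c in [set c | is_cycle G c]].

(** A drawing of [G] in the plane: vertices are distinct points, and every edge
    is a simple arc joining its two ends, whose interior meets neither a vertex
    nor the interior of another edge.  Only the values of [pos] on vertices,
    of [arc] on edges, and of each [arc e] on [[0, 1]] matter. *)
Record is_drawing (R : realType) (T : finType) (G : graph T)
    (pos : T -> R * R) (arc : {set T} -> R -> R * R) : Prop := IsDrawing {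
  pos_inj : {in vertices G &, injective pos};
  arc_continuous : forall e, e \in edges G ->
    {within `[0, 1], continuous (arc e)};
  arc_inj : forall e, e \in edges G ->
    {in `[0, 1]%R &, injective (arc e)};
  arc_ends : forall e, e \in edges G ->
    [set arc e 0; arc e 1] = [set pos v | v in [set` e]];
  arc_vertex : forall e v t, e \in edges G -> v \in vertices G ->
    t \in `]0, 1[%R -> arc e t <> pos v;
  arc_arc : forall e e' s t, e \in edges G -> e' \in edges G -> e != e' ->
    s \in `]0, 1[%R -> t \in `]0, 1[%R -> arc e s <> arc e' t }.

Definition planar (R : realType) (T : finType) (G : graph T) : Prop :=
  exists pos arc, @is_drawing R T G pos arc.

(** [G] is the union of [k] planar subgraphs of girth at least [g].  The vertex
    sets must cover as well, which matters when [G] has isolated vertices. *)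
Definition girth_decomposable (R : realType) (g : nat) (T : finType)
    (G : graph T) (k : nat) : Prop :=
  exists H : 'I_k -> graph T,
    [/\ forall i, [/\ subgraph (H i) G, planar R (H i)
                    & (g%:R%:E <= girth R (H i))%E],
        (\bigcup_(i < k) vertices (H i))%SET = vertices G
      & (\bigcup_(i < k) edges (H i))%SET = edges G].

Section Existence.
Variables (R : realType) (T : finType).
Implicit Types G : graph T.

Lemma small_girth G : (#|vertices G| <= 2)%N -> girth R G = +oo%E.
Proof.
move=> G2; rewrite /girth; suff -> : [set c | is_cycle G c] = set0.
  by rewrite image_set0 ereal_inf0.
apply/seteqP; split => // c [/andP[cyc uc] c3]; exfalso.
suff sub : {subset c <= vertices G}.
  have := leq_trans c3 (uniq_leq_size uc (s2 := enum (vertices G)) _).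
  rewrite -cardE ltnNge => H; apply/negP: G2.
  by rewrite H // => x /sub; rewrite mem_enum.
move=> x xc; have /edgesP/andP[/fintype.subsetP sub _] := next_cycle cyc xc.
by apply: sub; rewrite !inE eqxx.
Qed.

Lemma small_planar G : (#|vertices G| <= 2)%N -> planar R G.
Proof.
move=> G2; have [G0|[x0 x0G]] := set_0Vmem (vertices G).
  have E0 e : e \in edges G -> False.
    by move=> /edgesP; rewrite G0 finset.subset0 => /andP[/eqP->]; rewrite cards0.
  exists (fun=> (0, 0)), (fun _ _ => (0, 0)).
  by split=> [x y|e /E0|e /E0|e /E0|e v t /E0|e e' s t /E0] //; rewrite G0 inE.
have oth v w : v \in vertices G -> w \in vertices G ->
    v != x0 -> w != x0 -> v = w.
  move=> vG wG vx wx; apply/eqP/negPn/negP => vw.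
  have : (#|[set x0; v; w]%SET| <= 2)%N.
    apply: leq_trans G2; apply: subset_leq_card; apply/fintype.subsetP => z.
    by rewrite !inE => /orP[/orP[]|] /eqP->.
  rewrite -finset.setUA cardsU1 cards2 vw !inE negb_or.
  by rewrite (eq_sym x0 v) (eq_sym x0 w) vx wx.
have eE e : e \in edges G -> e = vertices G.
  move=> /edgesP/andP[sub /eqP e2]; apply/eqP.
  by rewrite eqEcard sub e2.
exists (fun v => ((v != x0)%:R, 0)), (fun _ t => (t, 0)); split.
- move=> v w vG wG /= [] /eqP; rewrite eqr_nat.
  have [->|vx] := eqVneq v x0; have [->|wx] //= := eqVneq w x0.
  by move=> _; apply: oth.
- move=> e eG; apply: continuous_subspaceT => t.
  exact: (cvg_pair (@cvg_id _ (nbhs t)) (cvg_cst (0 : R))).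
- by move=> e eG s t _ _ [].
- move=> e eG; have /andP[_ /cards2P[a [b [ab eab]]]] := edgesP eG.
  have := x0G; rewrite -(eE _ eG) => x0e.
  apply/seteqP; split => p /=.
    move=> [->|->]; first by exists x0; rewrite ?eqxx.
    move: x0e; rewrite eab !inE => /orP[]/eqP->.
      by exists b; rewrite ?[b == a]eq_sym ?ab //= !inE eqxx orbT.
    by exists a; rewrite ?ab //= !inE eqxx.
  by move=> [v _ <-]; case: (v == x0); [left|right].
- move=> e v t eG vG; rewrite in_itv /= => /andP[t0 t1] [] tv; move: t0 t1.
  by rewrite tv; case: (v == x0); rewrite /= ltxx.
- by move=> e e' s t /eE -> /eE ->; rewrite eqxx.
Qed.

Lemma pieceP G (A e : {set T}) :
  e \in (if A \in edges G then [set A]%SET else finset.set0) ->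
  (e \subset if (A \subset vertices G) && (#|A| <= 2)%N then A else finset.set0)
  && (#|e| == 2%N).
Proof.
case: ifP => [AG|]; last by rewrite inE.
rewrite inE => /eqP ->; have /andP[-> /eqP A2] := edgesP AG.
by rewrite A2 /= fintype.subxx.
Qed.

Lemma girth_decomposable_exists (g : nat) G :
  exists k, `[< girth_decomposable R g G k >].
Proof.
exists #|{: {set T}}|; apply/asboolP.
exists (fun i => Graph (@pieceP G (enum_val i))); split => [i||].
- set H := Graph _; have H2 : (#|vertices H| <= 2)%N.
    by rewrite /=; case: ifP => [/andP[]|]; rewrite ?cards0.
  split; [split => /=|exact: small_planar|by rewrite small_girth // leey].
    by case: ifP => [/andP[]|]; rewrite ?finset.sub0set.
  by case: ifP => [?|_]; rewrite ?finset.sub1set ?finset.sub0set.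
- apply/setP => x; apply/finset.bigcupP/idP => /= [[i _]|xG].
    by case: ifP => [/andP[/fintype.subsetP sub _] /sub|]; rewrite ?inE.
  exists (enum_rank [set x]%SET) => //.
  by rewrite enum_rankK finset.sub1set xG cards1 /= inE.
- apply/setP => e; apply/finset.bigcupP/idP => /= [[i _]|eG].
    by case: ifP => [iG|]; rewrite inE // => /eqP->.
  by exists (enum_rank e) => //; rewrite enum_rankK eG inE.
Qed.

End Existence.

Definition girth_thickness (R : realType) (g : nat) (T : finType)
    (G : graph T) : nat := ex_minn (girth_decomposable_exists R g G).

(* Main.v *)
(* Lower bound.  A planar triangle-free graph on n >= 3 vertices has at most 2n - 4
   edges, hence n(n-1)/2 <= k(2n-4), that is 4k >= n + 2; for K_6, two triangle-free
   graphs are excluded by R(3,3) = 6.  As the edges of a drawing are arbitrary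
   arcs, the edge bound is obtained without the Jordan curve theorem, from lifts of
   angles.  Once the arcs have been made radial near their ends, the parity of the
   winding number of a cycle c around a point next to an edge says on which side
   of c each side of each edge lies: the two sides of an edge e are separated by c
   exactly when e is in c (if e is in c, both ends of e must agree, and they are
   compared through a continuous angle of the chords of e), and the left side of
   an edge at a vertex agrees with the right side of the next edge around that
   vertex.  Let c run over the fundamental cycles of a spanning tree and call two
   sides equivalent when they are not separated.  The E - V + 1 cycles have
   independent boundaries, so there are at least E - V + 2 classes; the edges with
   exactly one side in a given class form an even subgraph, which contains at
   least 4 edges by triangle-freeness (unless the graph is a tree), so
   2E >= 4(E - V + 2).

   Upper bound.  A graph with a book embedding in two pages is drawn with its
   vertices on a line and its edges as arcs of the parabolas
   y = (x - a)(b - x) and y = -(x - a)(b - x).  It then suffices to decompose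
   K_(4p+2) into p + 1 triangle-free graphs with two pages, for p = 0 and p >= 2,
   and K_5 into two pentagons. *)
Require Import Defs.
From mathcomp Require Import all_boot all_order all_algebra.
From mathcomp Require Import all_classical all_reals all_analysis.
From mathcomp Require Import ring lra zify.

Set Implicit Arguments.
Unset Strict Implicit.
Unset Printing Implicit Defensive.

Import Order.TTheory GRing.Theory Num.Theory.
Import numFieldNormedType.Exports.

Local Open Scope classical_set_scope.
Local Open Scope ring_scope.

(** Seen from a point off a cycle, the angle swept by the cycle is a multiple of 2 pi, so the cosine
    of half of it is 1 or -1. This sign varies continuously with the point, hence is constant along
    every curve that avoids the cycle; it takes the place of inside and outside. The obstacle is an
    edge of the cycle itself. Left and right of it make sense only where it is straight, near its
    ends; in between, the arc may be too wild for a parallel curve to follow it. The comparison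
    therefore runs along the edge: seen from a point of the edge, the cycle without a short straight
    piece around that point sweeps an odd multiple of pi, and the sine of half of it is the sign
    that survives. Crossing the straight piece to either side turns this sine into plus or minus a
    cosine. Faces never appear. A class of sides is a vector of bits, one for each edge outside the
    tree, and the number of vectors is bounded below by linear algebra over the field with two
    elements. In the upper bound there is little slack: [p] of the [p + 1] graphs on [4 p + 2]
    vertices have the maximal number of edges. *)

(* A named predicate, so that the tactic [cts] below can match on it whatever
   canonical structures [continuous] unfolds to. *)
Definition cont (T U : topologicalType) (f : T -> U) : Prop := continuous f.

(** * Closure properties of continuity, and a tactic applying them *)

Section Continuity.
Variables (R : realType) (T : topologicalType).
Implicit Types f g : T -> R.

Lemma cont_cst (U : topologicalType) (c : U) : cont (fun _ : T => c).
Proof. exact: cst_continuous. Qed.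

Lemma cont_id : cont (fun x : T => x).
Proof. by move=> x; apply: cvg_id. Qed.

Lemma cont_add f g : cont f -> cont g -> cont (fun x => f x + g x).
Proof. by move=> cf cg x; apply: continuousD; [exact: cf|exact: cg]. Qed.

Lemma cont_opp f : cont f -> cont (fun x => - f x).
Proof. by move=> cf x; apply: continuousN; exact: cf. Qed.

Lemma cont_mul f g : cont f -> cont g -> cont (fun x => f x * g x).
Proof. by move=> cf cg x; apply: continuousM; [exact: cf|exact: cg]. Qed.

Lemma cont_inv f : (forall x, f x != 0) -> cont f -> cont (fun x => (f x)^-1).
Proof. by move=> f0 cf x; apply: continuousV => //; exact: cf. Qed.

Lemma cont_min f g : cont f -> cont g -> cont (fun x => Num.min (f x) (g x)).
Proof. by move=> cf cg x; apply: continuous_min; [exact: cf|exact: cg]. Qed.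

Lemma cont_max f g : cont f -> cont g -> cont (fun x => Num.max (f x) (g x)).
Proof. by move=> cf cg x; apply: continuous_max; [exact: cf|exact: cg]. Qed.

Lemma cont_comp (U V : topologicalType) (h : U -> V) (k : T -> U) :
  cont h -> cont k -> cont (fun x => h (k x)).
Proof. by move=> ch ck x; apply: continuous_comp; [exact: ck|exact: ch]. Qed.

Lemma cont_pair (U V : topologicalType) (h : T -> U) (k : T -> V) :
  cont h -> cont k -> cont (fun x => (h x, k x)).
Proof. by move=> ch ck x; apply: (cvg_pair (ch x) (ck x)). Qed.

Lemma cont_fst (U V : topologicalType) (h : T -> U * V) :
  cont h -> cont (fun x => (h x).1).
Proof. by move=> ch x; apply: continuous_comp; [exact: ch|exact: cvg_fst]. Qed.

Lemma cont_snd (U V : topologicalType) (h : T -> U * V) :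
  cont h -> cont (fun x => (h x).2).
Proof. by move=> ch x; apply: continuous_comp; [exact: ch|exact: cvg_snd]. Qed.

Lemma cont_sin f : cont f -> cont (fun x => sin (f x)).
Proof. by apply: cont_comp; exact: continuous_sin. Qed.

Lemma cont_cos f : cont f -> cont (fun x => cos (f x)).
Proof. by apply: cont_comp; exact: continuous_cos. Qed.

Lemma cont_atan f : cont f -> cont (fun x => atan (f x)).
Proof. by apply: cont_comp; exact: continuous_atan. Qed.

Lemma cont_sum (I : Type) (s : seq I) (F : I -> T -> R) : (forall i, cont (F i)) ->
  cont (fun x => \sum_(i <- s) F i x).
Proof.
move=> cF; elim: s => [|i s IHs].
  by under [X in cont X]eq_fun do rewrite big_nil; exact: cont_cst.
by under [X in cont X]eq_fun do rewrite big_cons; exact: cont_add.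
Qed.
End Continuity.

Ltac cts :=
  match goal with
  | |- forall _, _ => move=> ?; cts
  | |- cont (fun x => x) => apply: cont_id
  | |- cont (fun _ => ?c) => apply: cont_cst
  | H : cont ?f |- cont ?f => exact: H
  | H : forall _, cont _ |- cont _ => exact: H
  | H : forall _ _, cont _ |- cont _ => exact: H
  | |- cont (fun x => (@?f x, @?g x)) => apply: cont_pair; cts
  | |- cont (fun x => (@?f x).1) => apply: cont_fst; cts
  | |- cont (fun x => (@?f x).2) => apply: cont_snd; cts
  | |- cont (fun x => @?f x + @?g x) => apply: (@cont_add _ _ f g); cts
  | |- cont (fun x => - @?f x) => apply: (@cont_opp _ _ f); cts
  | |- cont (fun x => @?f x * @?g x) => apply: (@cont_mul _ _ f g); cts
  | |- cont (fun x => (@?f x)^-1) => apply: (@cont_inv _ _ f); [|cts]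
  | |- cont (fun x => Order.min (@?f x) (@?g x)) => apply: (@cont_min _ _ f g); cts
  | |- cont (fun x => Order.max (@?f x) (@?g x)) => apply: (@cont_max _ _ f g); cts
  | |- cont (fun x => sin (@?f x)) => apply: (@cont_sin _ _ f); cts
  | |- cont (fun x => cos (@?f x)) => apply: (@cont_cos _ _ f); cts
  | |- cont (fun x => atan (@?f x)) => apply: (@cont_atan _ _ f); cts
  | |- cont (fun x => bigop _ _ _) => apply: cont_sum => ?; cts
  | H : cont ?h |- cont (fun x => ?h (@?k x)) => apply: (@cont_comp _ _ _ h k H); cts
  | H : forall _, cont _ |- cont (fun x => ?h (@?k x)) => apply: (@cont_comp _ _ _ h k); [exact: H|cts]
  | H : forall _ _, cont _ |- cont (fun x => ?h (@?k x)) => apply: (@cont_comp _ _ _ h k); [exact: H|cts]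
  | |- _ => idtac
  end.

(** * Lifting angles *)

Section Angle.
Variable R : realType.
Implicit Types (z w : R * R) (a b t : R).

Definition dot z w := z.1 * w.1 + z.2 * w.2.
Definition cross z w := z.1 * w.2 - z.2 * w.1.

Definition isarg z t := exists2 r : R, 0 < r & z = (r * cos t, r * sin t).

Lemma isargP z t : isarg z t <-> z.1 * sin t = z.2 * cos t /\ 0 < z.1 * cos t + z.2 * sin t.
Proof.
have cs := cos2Dsin2 t; case: z => z1 z2; split => /= [[r r0 [-> ->]]|[e p]].
  split; first by ring.
  suff -> : r * cos t * cos t + r * sin t * sin t = r by [].
  by rewrite -!mulrA -mulrDr -!expr2 cs mulr1.
exists (z1 * cos t + z2 * sin t) => //; congr (_, _).
- have -> : (z1 * cos t + z2 * sin t) * cos t = z1 * cos t ^+ 2 + z2 * cos t * sin t by ring.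
  by rewrite -e -mulrA -expr2 -mulrDr cs mulr1.
- have -> : (z1 * cos t + z2 * sin t) * sin t = z1 * sin t * cos t + z2 * sin t ^+ 2 by ring.
  by rewrite e -mulrA -expr2 -mulrDr cs mulr1.
Qed.

(** In the open half-plane around [w], the signed angle from [w] to [z] is the [atan] of
    [cross w z / dot w z]. The formula is continuous in [w] and [z], so arguments of moving points
    can be continued by it. *)
Lemma isarg_rot w z t : isarg w t -> 0 < dot w z -> isarg z (t + atan (cross w z / dot w z)).
Proof.
move=> [r r0 ->] d0; apply/isargP; set d := dot _ _ in d0 *; set c := cross _ _.
have at0 : 0 < cos (atan (c / d)).
  by apply: cos_gt0_pihalf; rewrite atan_gtNpi2 atan_ltpi2.
have sE : sin (atan (c / d)) = c / d * cos (atan (c / d)).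
  by rewrite -{2}[c / d]atanK /tan divfK // gt_eqF.
rewrite sinD cosD sE; set k := cos (atan _) in at0 *.
have cs := cos2Dsin2 t; have dn : d != 0 by rewrite gt_eqF.
have e1 : sin t * d + cos t * c = r * z.2.
  rewrite -[RHS]mulr1 -cs /d /c /dot /cross /=; ring.
have e2 : cos t * d - sin t * c = r * z.1.
  rewrite -[RHS]mulr1 -cs /d /c /dot /cross /=; ring.
have n0 : 0 < z.1 ^+ 2 + z.2 ^+ 2.
  rewrite lt_neqAle addr_ge0 ?sqr_ge0 // andbT eq_sym paddr_eq0 ?sqr_ge0 //.
  apply/negP => /andP[]; rewrite !sqrf_eq0 => /eqP z1 /eqP z2.
  by move: d0; rewrite /d /dot z1 z2 !mulr0 addr0 ltxx.
have -> : sin t * k + cos t * (c / d * k) = (r * z.2) * (k / d) by rewrite -e1; field.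
have -> : cos t * k - sin t * (c / d * k) = (r * z.1) * (k / d) by rewrite -e2; field.
split; first by ring.
rewrite (_ : _ + _ = r * (k / d) * (z.1 ^+ 2 + z.2 ^+ 2)); last by ring.
by rewrite !mulr_gt0 // invr_gt0.
Qed.

(** The window has length [2 pi], so that the directions of the edges at a vertex can later be
    sorted as real numbers. *)
Lemma isarg_ex z : z != (0, 0) -> exists2 t, isarg z t & - (pi / 2) <= t < 3 * (pi / 2).
Proof.
have arg0 : isarg (1, 0) 0 by exists 1; rewrite ?sin0 ?cos0 ?mulr0 ?mulr1.
have argN : isarg (-1, 0) pi by exists 1; rewrite ?sinpi ?cospi ?mulr0 ?mul1r.
have argp : isarg (0, 1) (pi / 2) by exists 1; rewrite ?sin_pihalf ?cos_pihalf ?mulr0 ?mul1r.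
have argm : isarg (0, -1) (- (pi / 2)).
  by exists 1; rewrite ?sinN ?cosN ?sin_pihalf ?cos_pihalf ?mulr0 ?mul1r.
have p2 := pi_ge2 R.
have [aN ap] := (@atan_gtNpi2 R, @atan_ltpi2 R).
case: z => z1 z2 z0.
have [l|l|e1] := ltrgtP z1 0.
- exists (pi + atan (cross (-1, 0) (z1, z2) / dot (-1, 0) (z1, z2))).
    by apply: isarg_rot; rewrite // /dot /=; lra.
  have := aN (cross (-1, 0) (z1, z2) / dot (-1, 0) (z1, z2)).
  by have := ap (cross (-1, 0) (z1, z2) / dot (-1, 0) (z1, z2)); lra.
- exists (0 + atan (cross (1, 0) (z1, z2) / dot (1, 0) (z1, z2))).
    by apply: isarg_rot; rewrite // /dot /=; lra.
  have := aN (cross (1, 0) (z1, z2) / dot (1, 0) (z1, z2)).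
  by have := ap (cross (1, 0) (z1, z2) / dot (1, 0) (z1, z2)); lra.
have [l|l|e2] := ltrgtP z2 0.
- exists (- (pi / 2) + atan (cross (0, -1) (z1, z2) / dot (0, -1) (z1, z2))).
    by apply: isarg_rot; rewrite // /dot /=; lra.
  by rewrite /cross e1 /= !mul0r !mulr0 subrr mul0r atan0; lra.
- exists (pi / 2 + atan (cross (0, 1) (z1, z2) / dot (0, 1) (z1, z2))).
    by apply: isarg_rot; rewrite // /dot /=; lra.
  by rewrite /cross e1 /= !mul0r !mulr0 subrr mul0r atan0; lra.
by move: z0; rewrite e1 e2 eqxx.
Qed.

Lemma isarg_neq0 z t : isarg z t -> z != (0, 0).
Proof.
move=> [r r0 ->]; apply/eqP => -[c s]; have := cos2Dsin2 t.
move: c s; have rn : r != 0 by rewrite gt_eqF.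
move=> /eqP; rewrite mulf_eq0 (negPf rn) => /eqP -> /eqP; rewrite mulf_eq0 (negPf rn) => /eqP ->.
by rewrite expr0n addr0 => /esym/eqP; rewrite oner_eq0.
Qed.

Lemma isarg_cos z a b : isarg z a -> isarg z b -> cos (a - b) = 1.
Proof.
move=> [r r0 ->] [r' r'0 [c s]].
have ca := cos2Dsin2 a; have cb := cos2Dsin2 b.
have rr : r = r'.
  apply/eqP; rewrite -(@eqrXn2 _ 2) ?ltW //; apply/eqP.
  rewrite -[r ^+ 2]mulr1 -[r' ^+ 2]mulr1 -{1}ca -cb !mulrDr -!exprMn.
  by rewrite c s.
rewrite -rr in c s; have rn : r != 0 by rewrite gt_eqF.
by move: c s => /(mulfI rn) c /(mulfI rn) s; rewrite cosB c s -!expr2.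
Qed.

Lemma cos1_sin0 t : cos t = 1 -> sin t = 0.
Proof. by move=> c; apply: cos1sin0; rewrite c normr1. Qed.

(** Multiples of [2 pi] are expressed by [cos t = 1]; [cos (t / 2)] is then [1] or [-1], the parity
    of the multiple. *)
Lemma cos1_sin_half t : cos t = 1 -> sin (t / 2) = 0.
Proof.
have e : t = (t / 2) *+ 2 by rewrite mulr2n; field.
rewrite {1}e cos_mulr2n cos2sin2 => h; apply/eqP; rewrite -sqrf_eq0; apply/eqP.
move: h; rewrite mulr2n; lra.
Qed.

Lemma isarg_shift z a d : isarg z a -> cos d = 1 -> isarg z (a + d).
Proof.
move=> [r r0 ->] c; exists r => //.
by rewrite cosD sinD c (cos1_sin0 c) !mulr0 !mulr1 subr0 addr0.
Qed.

Lemma isarg_opp z a : isarg z a -> isarg (- z.1, - z.2) (a + pi).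
Proof.
by move=> [r r0 ->]; exists r; rewrite //= cosDpi sinDpi !mulrN.
Qed.

(* The equation [cos = 1] has isolated solutions. *)
Lemma cos1_rigid (f : R -> R) a b : cont f -> a <= b ->
  (forall t, a <= t <= b -> cos (f t) = 1) -> f a = f b.
Proof.
move=> cf ab c1.
wlog : f cf c1 / f a <= f b => [H|].
  have [/H|/ltW fba] := leP (f a) (f b); first exact.
  apply: oppr_inj; apply: (H (fun t => - f t)) => [||]; last by rewrite lerN2.
    by cts.
  by move=> t /c1; rewrite cosN.
rewrite le_eqVlt => /orP[/eqP //|lt]; exfalso.
pose m := Num.min (f a + 1) (f b).
have [||t tab ftm] := @IVT R f a b m ab.
- by apply: continuous_subspaceT.
- rewrite (min_idPl (ltW lt)) (max_idPr (ltW lt)) /m ge_min lexx orbT andbT le_min (ltW lt) andbT; lra.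
have tab' : a <= t <= b by move: tab; rewrite in_itv.
have ca : cos (f a) = 1 by apply: c1; rewrite lexx.
have ct := c1 t tab'; have : cos (m - f a) = 1.
  by rewrite cosB -ftm ct ca (cos1_sin0 ct) mul0r addr0 mulr1.
have m1 : 0 < m - f a <= 1.
  by rewrite /m; have [h|h] := leP (f a + 1) (f b); lra.
have pi2 := pi_ge2 R.
rewrite -[X in _ = X](@cos0 R) => /cos_inj; rewrite !in_itv /= => H.
have : m - f a = 0 by apply: H; lra.
lra.
Qed.

Lemma lift_unique (F : R -> R * R) (f g : R -> R) a b : cont f -> cont g -> a <= b ->
  (forall t, a <= t <= b -> isarg (F t) (f t)) ->
  (forall t, a <= t <= b -> isarg (F t) (g t)) -> f b - f a = g b - g a.
Proof.
move=> cf cg ab fF gF.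
have H : f a - g a = f b - g b.
  apply: (@cos1_rigid (fun t => f t - g t)) ab _; first by cts.
  by move=> t tab; apply: isarg_cos; [exact: fF|exact: gF].
by lra.
Qed.

(* The angle is lifted one radial step at a time: by uniform continuity,
   consecutive points [k p / N] and [k.+1 p / N] have values whose directions
   differ by less than a right angle. *)
Lemma angle_lift (F : R * R -> R * R) : cont F ->
  (forall p, 0 <= p.1 <= 1 -> 0 <= p.2 <= 1 -> F p != (0, 0)) ->
  exists2 th : R * R -> R, cont th &
    forall p, 0 <= p.1 <= 1 -> 0 <= p.2 <= 1 -> isarg (F p) (th p).
Proof.
move=> cF F0; pose K : set (R * R) := `[0, 1]%classic `*` `[0, 1]%classic.
have KP p : K p <-> 0 <= p.1 <= 1 /\ 0 <= p.2 <= 1 by rewrite /K /= !in_itv.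
have cK : compact K by apply: compact_setX; exact: segment_compact.
pose D (q : (R * R) * (R * R)) := dot (F q.1) (F q.2).
have cD : cont D by rewrite /D /dot; cts.
(* A Lebesgue number of the square: compactness gives one [e] below which all directions differ by
   less than a right angle. *)
have [e e0 eD] : exists2 e : R, 0 < e & forall p q, K p -> K q -> ball p e q -> 0 < D (p, q).
  have := (compact_near_coveringP K).1 cK R (0^'+)
     (fun e p => forall q, ball p e q -> 0 < D (p, q)).
  have H p : K p -> \forall p' \near p & e \near 0^'+, forall q, ball p' e q -> 0 < D (p', q).
    move=> /KP[p1 p2]; have : 0 < D (p, p).
      rewrite /D /dot lt_neqAle -!expr2 addr_ge0 ?sqr_ge0 // andbT eq_sym.
      rewrite paddr_eq0 ?sqr_ge0 // !sqrf_eq0.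
      by have := F0 _ p1 p2; case: (F p) => a b /=; rewrite xpair_eqE.
    move=> Dp; have := cD (p, p).
    move=> /(_ [set y | 0 < y] (lt_nbhsr Dp)) [[A B] /= [pA pB] AB].
    have [d d0 dA] : exists2 d : R, 0 < d & ball p d `<=` A `&` B.
      by have [d /= d0 dA] := (nbhs_ballP _ _).1 (filterI pA pB); exists d.
    exists (ball p (d / 2), [set e | 0 < e] `&` [set e | e < d / 2]) => /=.
      split; first by apply: nbhsx_ballx; lra.
      by apply: filterI; [exact: nbhs_right_gt|apply: nbhs_right_lt; lra].
    move=> [p' e] /= [pp' [e0 ed]] q p'q; apply: (AB (p', q)); split => /=.
      by apply: (dA p' _).1; apply: le_ball pp'; lra.
    apply: (dA q _).2; apply: (@le_ball _ _ p (d / 2 + e)); first lra.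
    exact: ball_triangle pp' p'q.
  move=> /(_ _ H) [e /= e0 He].
  exists (e / 2); first lra.
  move=> p q Kp Kq; apply: (He (e / 2) _ _ p Kp); rewrite /=; last lra.
  by rewrite sub0r normrN gtr0_norm; lra.
have [N N0 eN] : exists2 N : nat, (0 < N)%N & N%:R^-1 < e.
  exists (Num.trunc e^-1).+1 => //; rewrite invf_plt ?posrE ?ltr0n //.
  exact: truncnS_gt.
have Nn : N%:R != 0 :> R by rewrite pnatr_eq0 -lt0n.
(* Clamping both coordinates keeps every [P k p] in the square, so that the lift is continuous on
   the whole plane. *)
pose cl (x : R) := Num.max 0 (Num.min 1 x).
have cl01 x : 0 <= cl x <= 1.
  by rewrite /cl le_max lexx /= ge_max ler01 ge_min lexx.
have clE x : 0 <= x <= 1 -> cl x = x.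
  by move=> /andP[x0 x1]; rewrite /cl (min_idPr x1) (max_idPr x0).
pose P (k : nat) (p : R * R) : R * R := (cl p.1 * (k%:R / N%:R), cl p.2 * (k%:R / N%:R)).
have PK k p : (k <= N)%N -> K (P k p).
  move=> kN; have k01 : 0 <= (k%:R / N%:R : R) <= 1.
    by rewrite divr_ge0 ?ler0n //= ler_pdivrMr ?ltr0n // mul1r ler_nat.
  have {k01}[k0 k1] := andP k01.
  have H (c : R) : 0 <= c <= 1 -> 0 <= c * (k%:R / N%:R) <= 1.
    by move=> /andP[c0 c1]; rewrite mulr_ge0 //=; exact: mulr_ile1 c0 k0 c1 k1.
  by apply: (KP _).2; split; apply: H; exact: cl01.
have DP k p : (k < N)%N -> 0 < D (P k p, P k.+1 p).
  move=> kN; apply: eD; [exact/PK/ltnW|exact: PK|].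
  have H (c : R) : 0 <= c <= 1 -> `|c * (k%:R / N%:R) - c * (k.+1%:R / N%:R)| < e.
    move=> /andP[c0 c1].
    have -> : c * (k%:R / N%:R) - c * (k.+1%:R / N%:R) = - (c / N%:R).
      by rewrite -natr1; field.
    rewrite normrN ger0_norm ?divr_ge0 //; apply: le_lt_trans eN.
    by rewrite ler_piMl ?invr_ge0.
  by split; apply: H; exact: cl01.
have [t0 t0P _] : exists2 t0, isarg (F (0, 0)) t0 & - (pi / 2) <= t0 < 3 * (pi / 2).
  by apply/isarg_ex/F0; rewrite /= lexx ler01.
pose a (k : nat) p := atan (cross (F (P k p)) (F (P k.+1 p)) / D (P k p, P k.+1 p)).
have cP k : cont (P k) by rewrite /P /cl; cts.
exists (fun p => t0 + \sum_(k < N) a k p).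
  by rewrite /a /cross; cts => p; rewrite gt_eqF //; apply: DP; exact: ltn_ord.
move=> p p1 p2; have {1}<- : P N p = p.
  by rewrite /P !clE // divff // !mulr1; case: (p).
have : (N <= N)%N by []; elim: {-2}N => [_|m IHm mN].
  by rewrite big_ord0 addr0 /P mulr0n mul0r !mulr0.
rewrite big_ord_recr addrA; apply: isarg_rot; first exact/IHm/ltnW.
exact: DP.
Qed.
End Angle.

(** * The angle swept by a plane curve *)

Section Sweep.
Variable R : realType.
Implicit Types (a b c d t : R).

Definition vsub (z w : R * R) : R * R := (z.1 - w.1, z.2 - w.2).

Lemma vsub_neq0 z w : z <> w -> vsub z w != (0, 0).
Proof.
move=> zw; apply/eqP => -[/eqP]; rewrite subr_eq0 => /eqP e1 /eqP.
by rewrite subr_eq0 => /eqP e2; apply: zw; case: z w e1 e2 => ? ? [? ?] /= -> ->.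
Qed.

Lemma angle_lift_rect (F : R * R -> R * R) a b c d : cont F -> a < b -> c < d ->
  (forall p, a <= p.1 <= b -> c <= p.2 <= d -> F p != (0, 0)) ->
  exists2 th : R * R -> R, cont th &
    forall p, a <= p.1 <= b -> c <= p.2 <= d -> isarg (F p) (th p).
Proof.
move=> cF ab cd F0.
have ba0 : 0 < b - a by lra.
have dc0 : 0 < d - c by lra.
have [] := @angle_lift R (fun p => F (a + (b - a) * p.1, c + (d - c) * p.2)).
- by cts.
- by move=> p /= p1 p2; apply: F0 => /=; nra.
move=> th cth thP; exists (fun p => th ((p.1 - a) / (b - a), (p.2 - c) / (d - c))).
  by cts.
move=> p p1 p2; have := thP ((p.1 - a) / (b - a), (p.2 - c) / (d - c)).
have e (x y k : R) : 0 < k -> x + k * ((y - x) / k) = y.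
  by move=> k0; rewrite mulrC divfK ?gt_eqF // addrC subrK.
rewrite /= !e //.
case: p p1 p2 => p1 p2 /= P1 P2; apply.
  by rewrite divr_ge0 ?ler_pdivrMr //=; lra.
by rewrite divr_ge0 ?ler_pdivrMr //=; lra.
Qed.

Lemma angle_lift1 (F : R -> R * R) a b : cont F -> a < b ->
  (forall t, a <= t <= b -> F t != (0, 0)) ->
  exists2 th : R -> R, cont th & forall t, a <= t <= b -> isarg (F t) (th t).
Proof.
move=> cF ab F0; have [||p p1 p2|th cth thP] := @angle_lift_rect (fun p => F p.1) a b 0 1 _ ab.
- by cts.
- exact: ltr01.
- exact: F0.
exists (fun t => th (t, 0)); first by cts.
by move=> t tab; apply: (thP (t, 0)); rewrite //= lexx ler01.
Qed.

(** The variation of any continuous argument of [F], which does not depend on the lift by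
    [lift_unique]; it is [0] by default, when there is no lift. *)
Definition sweep (F : R -> R * R) a b : R :=
  xget 0 [set d | exists th : R -> R,
    [/\ cont th, forall t, a <= t <= b -> isarg (F t) (th t) & d = th b - th a]].

Lemma sweepE (F : R -> R * R) (th : R -> R) a b : a <= b -> cont th ->
  (forall t, a <= t <= b -> isarg (F t) (th t)) -> sweep F a b = th b - th a.
Proof.
move=> ab cth thF; rewrite /sweep.
case: xgetP => [d _ [th' [cth' th'F ->]]|/(_ (th b - th a)) []].
  exact: lift_unique thF.
by exists th.
Qed.

Lemma sweep_arg (F : R -> R * R) a b t : a < b -> cont F ->
  (forall t, a <= t <= b -> F t != (0, 0)) ->
  isarg (F a) t -> isarg (F b) (t + sweep F a b).
Proof.
move=> ab cF F0 Fa; have [th cth thP] := angle_lift1 cF ab F0.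
rewrite (sweepE (ltW ab) cth thP).
have aa : a <= a <= b by rewrite lexx ltW.
have bb : a <= b <= b by rewrite lexx ltW.
rewrite (_ : _ + _ = th b + (t - th a)); last by ring.
by apply: isarg_shift; [exact: thP|exact: isarg_cos (thP _ aa)].
Qed.

Lemma sweep_rev (F : R -> R * R) a b c d : a < b -> cont F ->
  (forall t, a <= t <= b -> F t != (0, 0)) -> c = 1 - b -> d = 1 - a ->
  sweep (fun t => F (1 - t)) c d = - sweep F a b.
Proof.
move=> ab cF F0 -> ->; have [th cth thP] := angle_lift1 cF ab F0.
rewrite (sweepE (ltW ab) cth thP).
rewrite (@sweepE _ (fun t => th (1 - t))).
- by rewrite !subKr opprB.
- by lra.
- by cts.
- by move=> t tt; apply: thP; lra.
Qed.

(** A single lift over the rectangle serves all values of [l], which gives continuity in [l]. *)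
Lemma sweep_family (F : R * R -> R * R) a b c d : cont F -> a < b -> c < d ->
  (forall p, a <= p.1 <= b -> c <= p.2 <= d -> F p != (0, 0)) ->
  exists2 g : R -> R, cont g &
    forall l, c <= l <= d -> g l = sweep (fun s => F (s, l)) a b.
Proof.
move=> cF ab cd F0; have [th cth thP] := angle_lift_rect cF ab cd F0.
exists (fun l => th (b, l) - th (a, l)); first by cts.
move=> l lcd; rewrite (@sweepE _ (fun s => th (s, l))) ?ltW //; first by cts.
by move=> t tab; exact: (thP (t, l)).
Qed.

Lemma cos_cos1 t d : cos d = 1 -> cos (t + d) = cos t.
Proof. by move=> c; rewrite cosD c (cos1_sin0 c) mulr1 mulr0 subr0. Qed.

Lemma cos_add1 t d : cos t = 1 -> cos d = 1 -> cos (t + d) = 1.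
Proof. by move=> ? ?; rewrite cos_cos1. Qed.

Lemma sgn_rigid (f : R -> R) a b : cont f -> a <= b ->
  (forall t, a <= t <= b -> f t ^+ 2 = 1) -> f a = f b.
Proof.
move=> cf ab f1.
have [//|ne] := eqVneq (f a) (f b); exfalso.
have [||t tab ft0] := @IVT R f a b 0 ab.
- by apply: continuous_subspaceT.
- have : f a ^+ 2 == 1 by rewrite f1 ?lexx.
  have : f b ^+ 2 == 1 by rewrite f1 ?lexx ?andbT.
  rewrite !sqrf_eq1.
  move=> /orP[]/eqP eb /orP[]/eqP ea; move: ne; rewrite ea eb ?eqxx // => _.
    by rewrite ge_min lerN10 le_max ler01 !orbT.
  by rewrite ge_min lerN10 le_max ler01 !orbT.
have : f t ^+ 2 = 1 by apply: f1; move: tab; rewrite in_itv.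
by rewrite ft0 expr0n => /esym/eqP; rewrite oner_eq0.
Qed.
End Sweep.

(** * An edge and a base point near it *)

Section Local.
Variable R : realType.
Implicit Types (a b c d t l s r u dl eps : R).

Lemma cos1_small t : cos t = 1 -> `|t| < 2 * pi -> t = 0.
Proof.
move=> /cos1_sin_half s lt; apply/eqP/negPn/negP => t0.
have : 0 < sin (`|t| / 2).
  by apply: sin_gt0_pi; rewrite ltr_pdivrMr // ltr_pdivlMr // mul0r normr_gt0 t0 mulrC.
by case: (ger0P t) => _; rewrite ?mulNr ?sinN s ?oppr0 ltxx.
Qed.

Lemma cosBpi t : cos (t - pi) = - cos t.
Proof. by rewrite cosB cospi sinpi mulr0 addr0 mulrN1. Qed.

Lemma sinBpi t : sin (t - pi) = - sin t.
Proof. by rewrite sinB cospi sinpi mulr0 subr0 mulrN1. Qed.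

Definition cpt (x : R * R) r t : R * R := (x.1 + r * cos t, x.2 + r * sin t).

(* Crossing a straight segment: the angle swept by the segment jumps from
   [- pi] to [pi] when the base point crosses it from right to left. *)
Lemma crossing (e : R -> R * R) (x0 : R * R) r (t0 : R) (S : R -> R) dl eps :
  cont e -> 0 < r -> (forall s, 0 <= s <= 1 / 3 -> e s = cpt x0 (3 * s * r) t0) ->
  0 < dl -> dl < pi / 2 -> eps = 1 \/ eps = -1 ->
  let p l := cpt x0 (r / 2) (t0 + eps * l) in
  (forall l s, 0 <= l <= dl -> 1 / 3 <= s <= 1 -> e s <> p l) -> cont S ->
  (forall l, 0 < l <= dl -> cos (S l + sweep (fun s => vsub (e s) (p l)) 0 1) = 1) ->
  cos ((S dl + sweep (fun s => vsub (e s) (p dl)) 0 1) / 2) =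
  - eps * sin ((S 0 + sweep (fun s => vsub (e s) (p 0)) (1 / 3) 1) / 2).
Proof.
move=> ce r0 eE dl0 dlpi epsE p pe cS Sc.
have pi2 := pi_ge2 R.
have eps1 : eps * eps = 1 by case: epsE => ->; ring.
have [|||[l s] /= sd ld|g cg gP] := @sweep_family R (fun q => vsub (e q.1) (p q.2)) (1 / 3) 1 0 dl.
- by rewrite /p /cpt /vsub; cts.
- lra.
- lra.
- by apply: vsub_neq0; exact: pe.
have sgt l : 0 < l <= dl -> 0 < sin l by move=> ?; apply: sin_gt0_pi; lra.
have zE l s : 0 <= s <= 1 / 3 -> vsub (e s) (p l) =
    (r * (3 * s * cos t0 - 2^-1 * cos (t0 + eps * l)),
     r * (3 * s * sin t0 - 2^-1 * sin (t0 + eps * l))).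
  by move=> s3; rewrite eE // /vsub /p /cpt /=; congr (_, _); field.
have cE l : cos (eps * l) = cos l by case: epsE => ->; rewrite ?mul1r // mulN1r cosN.
have sE l : sin (eps * l) = eps * sin l by case: epsE => ->; rewrite ?mul1r // !mulN1r sinN.
have cs := cos2Dsin2 t0.
(* From [p l], the straight third is seen inside the half-plane around its normal, of argument
   [t0 - eps * (pi / 2)]; [eps * A l s] is the tangent of the angle to this normal. *)
pose A (l s : R) := (3 * s - 2^-1 * cos l) / (2^-1 * sin l).
have lift l s : 0 < l <= dl -> 0 <= s <= 1 / 3 ->
    isarg (vsub (e s) (p l)) (t0 - eps * (pi / 2) + atan (eps * A l s)).
  move=> ld s3; rewrite zE //; set z := (_, _).
  pose w : R * R := (eps * sin t0, - eps * cos t0).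
  have dE : dot w z = r * (2^-1 * sin l) * (eps * eps).
    transitivity (r * (2^-1 * sin l) * (eps * eps) * (cos t0 ^+ 2 + sin t0 ^+ 2)).
      by rewrite /dot /z /w /= cosD sinD cE sE; ring.
    by rewrite cs mulr1.
  have kE : cross w z = r * eps * (3 * s - 2^-1 * cos l).
    transitivity (r * eps * (3 * s - 2^-1 * cos l) * (cos t0 ^+ 2 + sin t0 ^+ 2)).
      by rewrite /cross /z /w /= cosD sinD cE sE; ring.
    by rewrite cs mulr1.
  have -> : eps * A l s = cross w z / dot w z.
    rewrite dE kE eps1 /A; field; rewrite gt_eqF //=; last exact: sgt.
    by rewrite gt_eqF.
  apply: isarg_rot; last by rewrite dE eps1 mulr1 !mulr_gt0 ?invr_gt0 ?sgt.
  exists 1 => //; rewrite /w; case: epsE => ->.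
    by rewrite !mul1r cosBpihalf sinBpihalf mulN1r.
  by rewrite !mulN1r !opprK cosDpihalf sinDpihalf !mul1r.
pose psi (l : R) := atan (- (2^-1 * (eps * sin l)) / (1 - 2^-1 * cos l)).
have c1 l : 0 < 1 - 2^-1 * cos l by have := @cos_le1 R l; lra.
(* At both ends of the straight third the argument is known in a second form, [b0] and [b1]. This
   gives the sweep up to a multiple of [2 pi], and the bounds on [atan] exclude all but one
   value. *)
have NE l : 0 < l <= dl ->
    sweep (fun s => vsub (e s) (p l)) 0 (1 / 3) = eps * pi + psi l - eps * l.
  move=> ld.
  have s00 : 0 <= (0 : R) <= 1 / 3 by lra.
  have s33 : 0 <= (1 / 3 : R) <= 1 / 3 by lra.
  rewrite (@sweepE _ _ (fun s => t0 - eps * (pi / 2) + atan (eps * A l s))); first last.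
  - by move=> s s3; exact: lift.
  - rewrite /A; cts.
  - lra.
  have a0 := lift _ _ ld s00; have a1 := lift _ _ ld s33.
  have b0 : isarg (vsub (e 0) (p l)) (t0 + eps * l - eps * pi).
    rewrite zE //; exists (r / 2); first lra.
    by congr (_, _); case: epsE => ->; rewrite ?mul1r ?mulN1r ?opprK ?cosDpi ?sinDpi
      ?cosBpi ?sinBpi; field.
  have b1 : isarg (vsub (e (1 / 3)) (p l)) (t0 + psi l).
    rewrite zE //; set z := (_, _); pose w : R * R := (cos t0, sin t0).
    have dE : dot w z = r * (1 - 2^-1 * cos l).
      transitivity (r * (1 - 2^-1 * cos l) * (cos t0 ^+ 2 + sin t0 ^+ 2)).
        by rewrite /dot /z /w /= cosD sinD cE sE; field.
      by rewrite cs mulr1.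
    have kE : cross w z = r * - (2^-1 * (eps * sin l)).
      transitivity (r * - (2^-1 * (eps * sin l)) * (cos t0 ^+ 2 + sin t0 ^+ 2)).
        by rewrite /cross /z /w /= cosD sinD cE sE; field.
      by rewrite cs mulr1.
    have -> : psi l = atan (cross w z / dot w z).
      rewrite dE kE /psi; congr atan; field; rewrite gt_eqF //=.
      by have := c1 l; lra.
    apply: isarg_rot; last by rewrite dE mulr_gt0.
    by exists 1; rewrite // !mul1r.
  have [aN ap] := (@atan_gtNpi2 R, @atan_ltpi2 R).
  have AA : atan (A l 0) < atan (A l (1 / 3)).
    apply: lt_atan; rewrite /A ltr_pM2r ?invr_gt0 ?mulr_gt0 ?sgt ?invr_gt0 //; lra.
  have atE u : atan (eps * u) = eps * atan u.
    by case: epsE => ->; rewrite ?mul1r // !mulN1r atanN.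
  rewrite !atE in a0 a1 *.
  have psiE : psi l = eps * atan (- (2^-1 * sin l) / (1 - 2^-1 * cos l)).
    by rewrite -atE /psi; congr atan; ring.
  rewrite psiE in b1 *; set Q := atan _ in b1 *.
  have Q0 : Q < 0.
    rewrite -[0](@atan0 R); apply: lt_atan.
    by rewrite ltr_pdivrMr // mul0r oppr_lt0 mulr_gt0 ?sgt ?invr_gt0.
  have QN : - (pi / 2) < Q by exact: aN.
  have cc := isarg_cos a1 b1; have cc' := isarg_cos b0 a0.
  have := cos_add1 cc cc'.
  set a3 := atan (A l (1 / 3)) in AA *; set a4 := atan (A l 0) in AA *.
  have := aN (A l 0); have := ap (A l (1 / 3)); rewrite -/a3 -/a4 => h1 h2 h.
  suff : a3 - a4 - (pi + Q - l) = 0 by case: epsE => ->; lra.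
  apply: cos1_small; last by rewrite ltr_norml; lra.
  rewrite -h; case: epsE => ->; first by congr cos; ring.
  by rewrite -cosN; congr cos; ring.
have sg l : 0 <= l <= dl -> 0 <= l by case/andP.
(* For [l > 0] this is the parity seen from [p l]. The closed form of the sweep of the straight
   third makes it continuous at [l = 0] too, where [p l] is on the edge and that sweep is
   undefined. *)
pose f l := cos ((S l + g l + (eps * pi + psi l - eps * l)) / 2).
have cf : cont f.
  rewrite /f /psi; cts => l; by rewrite gt_eqF.
have fE l : 0 < l <= dl ->
    f l = cos ((S l + sweep (fun s => vsub (e s) (p l)) 0 1) / 2).
  move=> ld; rewrite /f -NE // gP; last lra.
  have ee : cont (fun s => vsub (e s) (p l)) by rewrite /vsub; cts.
  have [|s s01|th cth thP] := @angle_lift1 R (fun s => vsub (e s) (p l)) 0 1 ee; first lra.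
    apply: vsub_neq0; have [s3|s3] := leP s (1 / 3).
      have s3' : 0 <= s <= 1 / 3 by lra.
      by move=> h; have := isarg_neq0 (lift l s ld s3'); rewrite h /vsub !subrr eqxx.
    by apply: pe; lra.
  have hE (a b : R) : 0 <= a -> a <= b -> b <= 1 ->
      sweep (fun s => vsub (e s) (p l)) a b = th b - th a.
    by move=> a0 ab b1; apply: sweepE => // s /andP[sa sb]; apply: thP; lra.
  by rewrite /= !hE; try lra; congr cos; lra.
have f1 l : 0 < l <= dl -> f l ^+ 2 = 1.
  by move=> ld; rewrite fE // cos2sin2 cos1_sin_half ?Sc // expr0n subr0.
have f0 : f 0 ^+ 2 = 1.
  apply/eqP/negPn/negP => ne.
  have c2 : cont (fun l => f l * f l) by cts.
  have [|l l0] := @IVT R _ 0 dl ((f 0 ^+ 2 + 1) / 2) (ltW dl0) (continuous_subspaceT c2).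
    by rewrite -!expr2 (f1 dl) ?lexx ?dl0 //; have [h|h] := leP (f 0 ^+ 2) 1; lra.
  rewrite -expr2 => fl.
  have [l00|l0'] := eqVneq l 0; first by move: fl ne; rewrite l00 => fl /eqP; apply; lra.
  have ld : 0 < l <= dl by move: l0; rewrite in_itv /= lt_neqAle eq_sym l0'.
  by move: fl ne; rewrite (f1 l ld) => fl /eqP; apply; lra.
rewrite -fE ?lexx ?dl0 // -(@sgn_rigid _ f 0 dl) // ?ltW //; last first.
  move=> l /andP[]; rewrite le_eqVlt => /orP[/eqP <- //|l0 ld]; apply: f1.
  by rewrite l0.
rewrite /f gP ?lexx ?ltW // /psi sin0 !mulr0 oppr0 mul0r atan0 !addr0.
set Q := sweep _ _ _.
rewrite (_ : (S 0 + Q + eps * pi) / 2 = (S 0 + Q) / 2 + eps * (pi / 2)); last by field.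
case: epsE => ->; rewrite ?mul1r ?mulN1r ?opprK ?mul1r; first exact: cosDpihalf.
exact: cosBpihalf.
Qed.
End Local.

(** * Comparing the two ends of a wild arc *)

Section Turning.
Variable R : realType.
Implicit Types (a b c d t l s r u : R).

(* The directions of the chords [e t - e s], [s < t], have a continuous angle
   on a triangle, which compares the two ends of a wild arc. *)
Lemma turning (e : R -> R * R) (x0 y0 : R * R) r (tx ty : R) (S : R -> R) :
  cont e -> 0 < r ->
  (forall s t, 0 <= s <= 1 -> 0 <= t <= 1 -> e s = e t -> s = t) ->
  (forall s, 0 <= s <= 1 / 3 -> e s = cpt x0 (3 * s * r) tx) ->
  (forall s, 0 <= s <= 1 / 3 -> e (1 - s) = cpt y0 (3 * s * r) ty) ->
  cont S ->
  (forall t a, 1 / 6 <= t <= 5 / 6 -> isarg (vsub y0 (e t)) a -> isarg (vsub x0 (e t)) (a + S t)) ->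
  sin ((S (1 / 6) + sweep (fun s => vsub (e s) (e (1 / 6))) (1 / 3) 1) / 2) =
  sin ((S (5 / 6) + sweep (fun s => vsub (e s) (e (5 / 6))) 0 (2 / 3)) / 2).
Proof.
move=> ce r0 ei ex ey cS SP.
(* The parameters are projected to [0 <= s], [s + 1 / 6 <= t <= 1]: the triangle is cut off along
   its diagonal, where the chords degenerate. *)
pose ct (t : R) : R := Num.max (1 / 6) (Num.min 1 t).
pose cs (s t : R) : R := Num.max 0 (Num.min s (ct t - 1 / 6)).
have ct1 t : 1 / 6 <= ct t <= 1.
  by rewrite /ct; case: (leP 1 t) => h1; rewrite ?le_max ?ge_max; lra.
have ctE t : 1 / 6 <= t <= 1 -> ct t = t.
  by move=> /andP[t0 t1]; rewrite /ct (min_idPr t1) (max_idPr t0).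
have cs1 s t : 0 <= cs s t <= ct t - 1 / 6.
  have := ct1 t; rewrite /cs; set w := ct t - _ => h.
  have w0 : 0 <= w by rewrite /w; lra.
  by rewrite le_max lexx ge_max w0 ge_min lexx orbT.
have csE s t : 1 / 6 <= t <= 1 -> 0 <= s -> s + 1 / 6 <= t -> cs s t = s.
  move=> t1 s0 st; rewrite /cs ctE //.
  have h : s <= t - 1 / 6 by lra.
  by rewrite (min_idPl h) (max_idPr s0).
have [|p _ _|th cth thP] := @angle_lift R (fun p => vsub (e (ct p.2)) (e (cs p.1 p.2))).
- by rewrite /vsub /cs /ct; cts.
- apply: vsub_neq0 => h; have := ct1 p.2; have := cs1 p.1 p.2 => h1 h2.
  have : ct p.2 = cs p.1 p.2 by apply: ei h; lra.
  lra.
have {}thP s t : 0 <= s -> s + 1 / 6 <= t -> t <= 1 ->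
    isarg (vsub (e t) (e s)) (th (s, t)).
  move=> s0 st t1; have := thP (s, t); rewrite /= csE ?ctE //; try lra.
  by apply; lra.
have e0 : e 0 = x0 by rewrite ex /cpt ?mulr0 ?mul0r ?addr0; [case: (x0)|lra].
have e1 : e 1 = y0.
  by rewrite -[1]subr0 ey /cpt ?mulr0 ?mul0r ?addr0; [case: (y0)|lra].
(* [th (t, 1)] is an argument of [y0] seen from [e t], [S t] leads from it to [x0], and
   [th (0, t) + pi] is an argument of [x0]. So [Psi t] is an odd multiple of [pi], and its half has
   a sine of constant sign. *)
pose Psi (t : R) := S t + th (t, 1) - th (0, t).
have cPsi : cont (fun t => sin (Psi t / 2)) by rewrite /Psi; cts.
have Psi1 t : 1 / 6 <= t <= 5 / 6 -> sin (Psi t / 2) ^+ 2 = 1.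
  move=> t6; have h1 : isarg (vsub (e 1) (e t)) (th (t, 1)) by apply: thP; lra.
  have h0 : isarg (vsub (e t) (e 0)) (th (0, t)) by apply: thP; lra.
  rewrite e1 in h1; rewrite e0 in h0; have := isarg_opp h0.
  rewrite /vsub /= !opprB -/(vsub x0 (e t)) => h0'.
  have := isarg_cos (SP t _ t6 h1) h0' => /cos1_sin_half.
  have -> : (th (t, 1) + S t - (th (0, t) + pi)) / 2 = Psi t / 2 - pi / 2 by rewrite /Psi; field.
  rewrite sinBpihalf => /eqP; rewrite oppr_eq0 => /eqP c0.
  by rewrite sin2cos2 c0 expr0n subr0.
have L : sweep (fun s => vsub (e s) (e (5 / 6))) 0 (2 / 3) = th (2 / 3, 5 / 6) - th (0, 5 / 6).
  rewrite (@sweepE _ _ (fun s => th (s, 5 / 6) + pi)); first by ring.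
  - lra.
  - by cts.
  move=> t t1; have h : isarg (vsub (e (5 / 6)) (e t)) (th (t, 5 / 6)) by apply: thP; lra.
  by have := isarg_opp h; rewrite /vsub /= !opprB.
have R' : sweep (fun s => vsub (e s) (e (1 / 6))) (1 / 3) 1 = th (1 / 6, 1) - th (1 / 6, 1 / 3).
  rewrite (@sweepE _ _ (fun s => th (1 / 6, s))) //; first lra.
  - by cts.
  by move=> t t1; apply: thP; lra.
(* A chord of parameter length [1 / 6] that slides inside a straight third keeps its direction; this
   identifies the values of [Psi] at [1 / 6] and [5 / 6] with the two sweeps. *)
have dx : th (1 / 6, 1 / 3) = th (0, 1 / 6).
  have := @lift_unique R (fun s => vsub (e (s + 1 / 6)) (e s)) (fun s => th (s, s + 1 / 6))
    (fun _ => tx) 0 (1 / 6).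
  rewrite /= !add0r subrr (_ : 1 / 6 + 1 / 6 = 1 / 3); last by field.
  move=> H; apply/eqP; rewrite -subr_eq0 H //; first by cts.
  - by cts.
  - by move=> t t1; apply: thP; lra.
  move=> t t1; rewrite !ex; try lra; rewrite /vsub /cpt /=; exists (r / 2); first lra.
  by congr (_, _); field.
have dy : th (5 / 6, 1) = th (2 / 3, 5 / 6).
  have := @lift_unique R (fun s => vsub (e (s + 1 / 6)) (e s)) (fun s => th (s, s + 1 / 6))
    (fun _ => ty + pi) (2 / 3) (5 / 6).
  rewrite /= subrr (_ : 5 / 6 + 1 / 6 = 1); last by field.
  rewrite (_ : 2 / 3 + 1 / 6 = 5 / 6); last by field.
  move=> H; apply/eqP; rewrite -subr_eq0 H //; first by cts.
  - by cts.
  - lra.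
  - by move=> t t1; apply: thP; lra.
  move=> t t1; have -> : e t = e (1 - (1 - t)) by congr e; ring.
  have -> : e (t + 1 / 6) = e (1 - (5 / 6 - t)) by congr e; field.
  rewrite !ey; try lra; rewrite /vsub /cpt /=; exists (r / 2); first lra.
  by rewrite cosDpi sinDpi; congr (_, _); field.
have := sgn_rigid cPsi _ Psi1; rewrite /Psi L R' dx -dy => H.
by rewrite !addrA; apply: H; lra.
Qed.
End Turning.

(** * Winding angles of the cycles of a drawing *)

Section Winding.
Variables (R : realType) (T : finType) (G : graph T).
Implicit Types (a b c d t l s r u : R).

Lemma adj_sym : symmetric (adj G).
Proof. by move=> x y; rewrite /adj finset.setUC. Qed.

Lemma adj_neq x y : adj G x y -> x != y.
Proof.
by move=> /edgesP/andP[_]; apply: contraTneq => ->; rewrite finset.setUid cards1.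
Qed.

Lemma adj_vertex x y : adj G x y -> x \in vertices G.
Proof. by move=> /edgesP/andP[/fintype.subsetP + _]; apply; rewrite !inE eqxx. Qed.

(* [g x y] runs along the edge [xy] from [x] to [y]; its first third is a radius,
   in the direction [th x y], of the disc of radius [r] around [x], which meets
   nothing else of the edge and no edge that is not incident with [x]. *)
Record tame (pos : T -> R * R) (g : T -> T -> R -> R * R) (r : R) (th : T -> T -> R) : Prop :=
  Tame {
  tame_r : 0 < r;
  tame_cont : forall x y, cont (g x y);
  tame_rev : forall x y t, adj G x y -> g y x t = g x y (1 - t);
  tame_init : forall x y t, adj G x y -> 0 <= t <= 1 / 3 ->
    g x y t = cpt (pos x) (3 * t * r) (th x y);
  tame_far : forall x y t, adj G x y -> 1 / 3 < t <= 1 ->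
    r ^+ 2 < dot (vsub (g x y t) (pos x)) (vsub (g x y t) (pos x));
  tame_other : forall x y v t, adj G x y -> v \in vertices G -> v != x -> v != y ->
    0 <= t <= 1 -> r ^+ 2 < dot (vsub (g x y t) (pos v)) (vsub (g x y t) (pos v));
  tame_disj : forall x y z w s t, adj G x y -> adj G z w -> [set x; y]%SET != [set z; w]%SET ->
    0 < s < 1 -> 0 < t < 1 -> g x y s <> g z w t;
  tame_inj : forall x y s t, adj G x y -> 0 <= s <= 1 -> 0 <= t <= 1 ->
    g x y s = g x y t -> s = t;
  tame_angle : forall x y, - (pi / 2) <= th x y < 3 * (pi / 2) }.

Variables (pos : T -> R * R) (g : T -> T -> R -> R * R) (r : R) (th : T -> T -> R).
Hypothesis tG : tame pos g r th.
Let r0 : 0 < r. Proof. exact: tame_r tG. Qed.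
Let cg : forall x y, cont (g x y). Proof. exact: tame_cont tG. Qed.

Lemma dot_vsubxx (z : R * R) : dot (vsub z z) (vsub z z) = 0.
Proof. by rewrite /dot /vsub !subrr mulr0 addr0. Qed.

Lemma g0 x y : adj G x y -> g x y 0 = pos x.
Proof.
move=> xy; rewrite (tame_init tG) //; last by rewrite lexx; lra.
by rewrite /cpt mulr0 !mul0r !addr0; case: (pos x).
Qed.

Lemma g1 x y : adj G x y -> g x y 1 = pos y.
Proof.
move=> xy; have yx : adj G y x by rewrite adj_sym.
by rewrite -(g0 yx) (tame_rev tG _ xy) subr0.
Qed.

Definition circ x (f : R) := cpt (pos x) (r / 2) f.

Lemma pt_norm x f : dot (vsub (circ x f) (pos x)) (vsub (circ x f) (pos x)) = (r / 2) ^+ 2.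
Proof.
transitivity ((r / 2) ^+ 2 * (cos f ^+ 2 + sin f ^+ 2)); last by rewrite cos2Dsin2 mulr1.
by rewrite /dot /vsub /circ /cpt /=; ring.
Qed.

(** Beyond the parameter [1 / 3] the edge is farther than [r] from [x], and before it the distance
    is [3 * s * r]; so it meets the circle of radius [r / 2] only at [s = 1 / 6]. *)
Lemma near_start x w s f : adj G x w -> 0 <= s <= 1 -> g x w s = circ x f ->
  s = 1 / 6 /\ cos (f - th x w) = 1.
Proof.
move=> xw s01 e; have rp : 0 < r := r0; have r2 : (r / 2) ^+ 2 < r ^+ 2 by have := exprn_gt0 2 r0; lra.
have s3 : s <= 1 / 3.
  rewrite leNgt; apply/negP => s3; have := @tame_far _ _ _ _ tG x w s xw.
  by rewrite e pt_norm => H; have : r ^+ 2 < (r / 2) ^+ 2 by [apply: H; lra]; lra.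
have s6 : s = 1 / 6.
  move: e (pt_norm x f) => <-; rewrite (tame_init tG) //; last lra.
  have -> : dot (vsub (cpt (pos x) (3 * s * r) (th x w)) (pos x))
      (vsub (cpt (pos x) (3 * s * r) (th x w)) (pos x)) = (3 * s * r) ^+ 2.
    transitivity ((3 * s * r) ^+ 2 * (cos (th x w) ^+ 2 + sin (th x w) ^+ 2)).
      by rewrite /dot /vsub /cpt /=; ring.
    by rewrite cos2Dsin2 mulr1.
  move=> /eqP; rewrite eqrXn2 //; [move=> /eqP h| |lra].
    by apply: (@mulIf _ r); [rewrite gt_eqF|lra].
  by rewrite !mulr_ge0 //; lra.
split=> //; move: e; rewrite s6 (tame_init tG) //; last lra.
move=> e; apply: (@isarg_cos _ (vsub (circ x f) (pos x))).
  by exists (r / 2); [lra|rewrite /vsub /circ /cpt /=; congr (_, _); ring].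
by rewrite -e; exists (r / 2); [lra|rewrite /vsub /cpt /=; congr (_, _); field].
Qed.

Lemma near_pt x z w s f : x \in vertices G -> adj G z w -> 0 <= s <= 1 -> g z w s = circ x f ->
  (z = x /\ cos (f - th x w) = 1) \/ (w = x /\ cos (f - th x z) = 1).
Proof.
move=> xV zw s01 e; have rp : 0 < r := r0; have r2 : (r / 2) ^+ 2 < r ^+ 2 by have := exprn_gt0 2 r0; lra.
have [zx|zx] := eqVneq z x; first by left; subst z; have [] := near_start zw s01 e.
have [wx|wx] := eqVneq w x; last first.
  have := @tame_other _ _ _ _ tG z w x s zw xV; rewrite ![x == _]eq_sym => /(_ zx wx s01).
  by rewrite e pt_norm ltNge ltW.
right; subst w; split => //; rewrite adj_sym in zw.
have e' : g x z (1 - s) = circ x f by rewrite -(tame_rev tG).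
have s01' : 0 <= 1 - s <= 1 by lra.
by have [] := near_start zw s01' e'.
Qed.

Lemma edge_off x y z w s t : adj G x y -> adj G z w -> [set x; y]%SET != [set z; w]%SET ->
  0 < t < 1 -> 0 <= s <= 1 -> g z w s <> g x y t.
Proof.
move=> xy zw ne t01 s01.
have end0 z' w' : adj G z' w' -> [set x; y]%SET != [set z'; w']%SET -> g z' w' 0 <> g x y t.
  move=> zw' ne'; rewrite g0 // => e.
  have [ex|zx] := eqVneq z' x.
    by have := @tame_inj _ _ _ _ tG x y 0 t xy; rewrite -e g0 // ex => H; have := H _ _ erefl; lra.
  have [ey|zy] := eqVneq z' y.
    by have := @tame_inj _ _ _ _ tG x y 1 t xy; rewrite -e g1 // ey => H; have := H _ _ erefl; lra.
  have := @tame_other _ _ _ _ tG x y z' t xy (adj_vertex zw') zx zy.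
  by rewrite -e dot_vsubxx => H; have : r ^+ 2 < 0 by [apply: H; lra]; have := exprn_gt0 2 r0; lra.
have [->|s0] := eqVneq s 0; first exact: end0.
have [->|s1] := eqVneq s 1.
  rewrite -[1]subr0 -(tame_rev tG) //; apply: end0; first by rewrite adj_sym.
  by rewrite [X in _ != X]finset.setUC.
move=> /esym; apply: (tame_disj tG) => //.
by move: s01; rewrite !le_eqVlt ![s == _]eq_sym eq_sym (negPf s0) eq_sym (negPf s1).
Qed.

Lemma th_inj x y z : adj G x y -> adj G x z -> th x y = th x z -> y = z.
Proof.
move=> xy xz e; apply/eqP/negPn/negP => yz.
have ne : [set x; y]%SET != [set x; z]%SET.
  apply/eqP => /setP/(_ y); rewrite !inE eqxx orbT (negPf yz) orbF => /esym/eqP yx.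
  by have := adj_neq xy; rewrite yx eqxx.
apply: (@tame_disj _ _ _ _ tG x y x z (1 / 3) (1 / 3) xy xz ne); [lra|lra|].
by rewrite !(tame_init tG) ?e //; lra.
Qed.

Section Cycle.
Variable c : seq T.
Hypotheses (cyc : cycle (adj G) c) (uc : uniq c) (c3 : (2 < size c)%N).

(** The predicate selects edges by their first end. Apart from the full cycle, it is used to drop
    one edge, so that [p] may lie on that edge. *)
Definition wind (P : pred T) (p : R * R) : R :=
  \sum_(x <- c | P x) sweep (fun s => vsub (g x (next c x) s) p) 0 1.

Definition off (P : pred T) (p : R * R) := forall x s, x \in c -> P x -> 0 <= s <= 1 ->
  g x (next c x) s <> p.

Lemma adj_next x : x \in c -> adj G x (next c x).
Proof. by move=> xc; exact: next_cycle. Qed.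

Lemma next_next x : x \in c -> next c (next c x) != x.
Proof.
move=> /rot_to[i c' e]; have E y : next c y = next (x :: c') y by rewrite -e next_rot.
rewrite !E {E}.
have : uniq (rot i c) by rewrite rot_uniq.
have : (2 < size (rot i c))%N by rewrite size_rot.
rewrite e {e}; case: c' => [|y [|z c']] //= _ /and3P[]; rewrite !inE !negb_or.
move=> /and3P[xy xz _] _ _; rewrite eqxx [y == x]eq_sym (negPf xy) eqxx.
by rewrite eq_sym.
Qed.

(** With one argument [al x] chosen at each vertex, every sweep is a difference of two of them up to
    a multiple of [2 pi]. These differences telescope, for the cycle as well as for the cycle minus
    an edge. *)
Lemma wind_angle (P : pred T) p : off P p ->
  exists al : T -> R, (forall x, x \in c -> P x -> isarg (vsub (pos x) p) (al x) /\
     isarg (vsub (pos (next c x)) p) (al (next c x))) /\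
  exists2 d, cos d = 1 & wind P p = \sum_(x <- c | P x) (al (next c x) - al x) + d.
Proof.
move=> oP; pose al x := xget 0 [set t | isarg (vsub (pos x) p) t].
have alP x : pos x <> p -> isarg (vsub (pos x) p) (al x).
  move=> xp; have [t tP _] := isarg_ex (vsub_neq0 xp).
  by rewrite /al; case: xgetP => [_ _ //|/(_ t) []].
have xP x : x \in c -> P x -> pos x <> p.
  by move=> xc Px; rewrite -(g0 (adj_next xc)); apply: (oP x 0 xc Px); lra.
have nP x : x \in c -> P x -> pos (next c x) <> p.
  by move=> xc Px; rewrite -(g1 (adj_next xc)); apply: (oP x 1 xc Px); lra.
exists al; split; first by move=> x xc Px; split; apply: alP; [exact: xP|exact: nP].
exists (\sum_(x <- c | P x) (sweep (fun s => vsub (g x (next c x) s) p) 0 1 - (al (next c x) - al x))).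
  rewrite big_seq_cond; apply: (big_ind (fun v : R => cos v = 1)) => [|t s|x /andP[xc Px]]; first exact: cos0.
    exact: cos_add1.
  have cgp : cont (fun s => vsub (g x (next c x) s) p) by rewrite /vsub; cts.
  have F0 t : 0 <= t <= 1 -> vsub (g x (next c x) t) p != (0, 0).
    by move=> t01; apply: vsub_neq0; exact: (oP x t xc Px).
  have := sweep_arg (t := al x) ltr01 cgp F0.
  rewrite g0 ?g1 ?adj_next // => /(_ (alP _ (xP _ xc Px))) h.
  have {h} := isarg_cos h (alP _ (nP _ xc Px)).
  set w := sweep _ _ _ => h; rewrite -[RHS]h; congr cos; ring.
by rewrite /wind -big_split /=; apply: eq_bigr => x _; rewrite addrC subrK.
Qed.

Lemma sum_next (al : T -> R) : \sum_(x <- c) (al (next c x) - al x) = 0.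
Proof.
rewrite sumrB; apply/eqP; rewrite subr_eq0; apply/eqP.
rewrite !(big_uniq _ uc) /= [RHS](reindex_inj (can_inj (prev_next uc))) /=.
by apply: eq_bigl => x; rewrite mem_next.
Qed.

Lemma wind_cos p : off predT p -> cos (wind predT p) = 1.
Proof.
by move=> /wind_angle[al [_ [d cd ->]]]; rewrite sum_next add0r.
Qed.

Lemma wind_path x p a : x \in c -> off (predC1 x) p -> isarg (vsub (pos (next c x)) p) a ->
  isarg (vsub (pos x) p) (a + wind (predC1 x) p).
Proof.
move=> xc o ya; have [al [alP [d cd ->]]] := wind_angle o.
have -> : \sum_(z <- c | predC1 x z) (al (next c z) - al z) = al x - al (next c x).
  have := sum_next al; rewrite (bigD1_seq x) //= => /eqP.
  by rewrite addrC addr_eq0 opprB => /eqP.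
have nx : next c x != x by rewrite eq_sym; exact/adj_neq/adj_next.
have pc : prev c x \in c by rewrite mem_prev.
have nc : next c x \in c by rewrite mem_next.
have px : predC1 x (prev c x).
  by apply: contraNneq nx => h; rewrite -{1}h next_prev.
have [_] := alP _ pc px; rewrite next_prev // => xa.
have [ya' _] := alP _ nc nx.
have ca : cos (a - al (next c x) + d) = 1 by apply: cos_add1 => //; exact: isarg_cos ya ya'.
rewrite (_ : a + _ = al x + (a - al (next c x) + d)); last by ring.
exact: isarg_shift.
Qed.

Lemma wind_family (P : pred T) (p : R -> R * R) a b : cont p -> a < b ->
  (forall t, a <= t <= b -> off P (p t)) ->
  exists2 f : R -> R, cont f & forall t, a <= t <= b -> f t = wind P (p t).
Proof.
move=> cp ab o; rewrite /wind; have : {subset c <= c} by [].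
elim: {1 3}c => [|x l IHl] lc.
  by exists (fun _ => 0) => [|t _]; [cts|rewrite big_nil].
have [f cf fP] := IHl (fun y ly => lc y (@mem_behead _ (x :: l) y ly)).
have [Px|Px] := boolP (P x); last first.
  by exists f => // t t1; rewrite big_cons (negPf Px) fP.
have xc : x \in c by apply: lc; rewrite inE eqxx.
have cF : cont (fun q : R * R => vsub (g x (next c x) q.1) (p q.2)) by rewrite /vsub; cts.
have [|h ch hP] := sweep_family cF ltr01 ab.
  by move=> q q1 q2; apply: vsub_neq0; exact: (o _ q2).
exists (fun t => h t + f t); first by cts.
by move=> t t1; rewrite big_cons Px fP // hP.
Qed.

Lemma wind_sq p : off predT p -> cos (wind predT p / 2) ^+ 2 = 1.
Proof. by move=> o; rewrite cos2sin2 cos1_sin_half ?wind_cos // expr0n subr0. Qed.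

Lemma wind_const (p : R -> R * R) a b : cont p -> a <= b ->
  (forall t, a <= t <= b -> off predT (p t)) ->
  cos (wind predT (p a) / 2) = cos (wind predT (p b) / 2).
Proof.
move=> cp; rewrite le_eqVlt => /predU1P[->//|ab] o.
have [f cf fP] := wind_family cp ab o.
rewrite -!fP ?lexx ?ltW //.
apply: (@sgn_rigid _ (fun t => cos (f t / 2)) a b); [by cts|exact: ltW|].
by move=> t t1; rewrite fP //; apply: wind_sq; exact: o.
Qed.
End Cycle.
End Winding.

(** * The two sides of an edge relative to a cycle *)

Section Sides.
Variables (R : realType) (T : finType) (G : graph T).
Implicit Types (a b d t l s r u f : R).

Lemma finite_lower_bound (I : finType) (P : pred I) (F : I -> R) : (forall i, P i -> 0 < F i) ->
  exists2 d : R, 0 < d & forall i, P i -> d <= F i.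
Proof.
move=> F0; suff [d d0 dP] : exists2 d : R, 0 < d & forall i, i \in enum I -> P i -> d <= F i.
  by exists d => // i; apply: dP; rewrite mem_enum.
elim: (enum I) => [|i e [d d0 dP]]; first by exists 1.
have [Pi|Pi] := boolP (P i); last first.
  by exists d => // j; rewrite inE => /predU1P[-> Pj|/dP//]; rewrite Pj in Pi.
exists (Num.min d (F i)); first by rewrite lt_min d0 F0.
move=> j; rewrite inE => /predU1P[-> _|je Pj]; first by rewrite ge_min lexx orbT.
by rewrite ge_min dP.
Qed.

Variables (pos : T -> R * R) (g : T -> T -> R -> R * R) (r : R) (th : T -> T -> R).
Hypothesis tG : tame G pos g r th.

Notation pt := (circ pos r).

(** The sectors of half-width [d] around the directions of the edges at a vertex are disjoint modulo
    [2 pi]; the second bound is the gap around the back. *)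
Lemma gap : exists2 d : R, 0 < d < pi / 2 & forall x y z, adj G x y -> adj G x z -> y != z ->
  th x y < th x z -> 2 * d < th x z - th x y < 2 * pi - 2 * d.
Proof.
pose P (q : T * (T * T)) := [&& adj G q.1 q.2.1, adj G q.1 q.2.2 & th q.1 q.2.1 < th q.1 q.2.2].
pose D (q : T * (T * T)) := th q.1 q.2.2 - th q.1 q.2.1.
have [q /and3P[_ _]|d1 d10 h1] := @finite_lower_bound _ P D; first by rewrite /D subr_gt0.
have [q /and3P[_ _]|d2 d20 h2] := @finite_lower_bound _ P (fun q => 2 * pi - D q).
  by have := tame_angle tG q.1 q.2.2; have := tame_angle tG q.1 q.2.1; rewrite /D; lra.
have p2 := pi_ge2 R.
exists (Num.min (1 / 2) (Num.min d1 d2 / 4)).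
  apply/andP; split; last by rewrite gt_min; apply/orP; left; lra.
  by rewrite lt_min; apply/andP; split; [lra|rewrite divr_gt0 // lt_min d10].
move=> x y z xy xz yz lt; have Pq : P (x, (y, z)) by rewrite /P /= xy xz lt.
have := h1 _ Pq; have := h2 _ Pq; rewrite /D /=.
have m1 : Num.min d1 d2 <= d1 by rewrite ge_min lexx.
have m2 : Num.min d1 d2 <= d2 by rewrite ge_min lexx orbT.
have m3 : 0 < Num.min d1 d2 by rewrite lt_min d10.
set m := Num.min d1 d2 in m1 m2 m3 *.
have : Num.min (1 / 2) (m / 4) <= m / 4 by rewrite ge_min lexx orbT.
by set k := Num.min _ _; lra.
Qed.

Variable dl : R.
Hypothesis dl0 : 0 < dl < pi / 2.
Hypothesis gapP : forall x y z, adj G x y -> adj G x z -> y != z ->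
  th x y < th x z -> 2 * dl < th x z - th x y < 2 * pi - 2 * dl.

Lemma sector x y z l : adj G x y -> adj G x z -> - dl <= l <= dl ->
  cos (th x y + l - th x z) = 1 -> y = z /\ l = 0.
Proof.
move=> xy xz ll c1; have p2 := pi_ge2 R; have dl0' := dl0.
have a1 := tame_angle tG x y; have a2 := tame_angle tG x z.
have [yz|yz] := eqVneq y z.
  split => //; move: c1; rewrite yz addrAC subrr add0r => /cos1_small; apply.
  by rewrite ltr_norml; lra.
exfalso; have [lt|lt|eq] := ltgtP (th x y) (th x z).
- have h := gapP xy xz yz lt; have := cos1_small c1; rewrite ltr_norml => H.
  by have : th x y + l - th x z = 0 by [apply: H; lra]; lra.
- rewrite eq_sym in yz; have h := gapP xz xy yz lt; have := cos1_small c1; rewrite ltr_norml => H.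
  by have : th x y + l - th x z = 0 by [apply: H; lra]; lra.
by move/eqP: yz; apply; exact: (th_inj tG xy xz).
Qed.

Variable c : seq T.
Hypotheses (cyc : cycle (adj G) c) (uc : uniq c) (c3 : (2 < size c)%N).

(* The side of [c] on which the points to the left, respectively to the right, of
   the dart [(x, y)] near [x] lie: [1] or [-1] according to the parity of the
   winding number of [c]. *)
Definition HL x y := cos (wind g c predT (pt x (th x y + dl)) / 2).
Definition HR x y := cos (wind g c predT (pt x (th x y - dl)) / 2).
Definition cedge x y := (x \in c) && (next c x == y) || (y \in c) && (next c y == x).

Lemma cedge_sym x y : cedge x y = cedge y x.
Proof. by rewrite /cedge orbC. Qed.

Lemma off_pt x f : x \in vertices G ->
  (forall w, adj G x w -> cedge x w -> cos (f - th x w) <> 1) -> off g c predT (pt x f).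
Proof.
move=> xV H z s zc _ s01 e.
have zw : adj G z (next c z) by exact: next_cycle.
have [[zx]|[wx]] := near_pt tG xV zw s01 e.
  by subst z; apply: H => //; rewrite /cedge zc eqxx.
apply: H; first by rewrite -wx adj_sym.
by rewrite /cedge zc wx eqxx orbT.
Qed.

Lemma off_side x y e : adj G x y -> e = dl \/ e = - dl -> off g c predT (pt x (th x y + e)).
Proof.
move=> xy eE; apply: off_pt; first exact: adj_vertex xy.
move=> w xw _ c1; have dl0' := dl0.
have l1 : - dl <= e <= dl by case: eE => ->; lra.
by have [_] := sector xy xw l1 c1; case: eE => ->; lra.
Qed.

Lemma HL_sq x y : adj G x y -> HL x y ^+ 2 = 1.
Proof. by move=> xy; apply: (wind_sq tG cyc uc); apply: off_side => //; left. Qed.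

Lemma sector_const x a b : x \in vertices G -> a <= b ->
  (forall f w, a <= f <= b -> adj G x w -> cedge x w -> cos (f - th x w) <> 1) ->
  cos (wind g c predT (pt x a) / 2) = cos (wind g c predT (pt x b) / 2).
Proof.
move=> xV ab H; apply: (@wind_const _ _ _ _ _ _ _ tG c cyc uc (fun f => pt x f)) => //.
  by rewrite /circ /cpt; cts.
by move=> f fab; apply: off_pt => // w; exact: H.
Qed.

Lemma edge_mid x y : adj G x y -> g x y (1 / 6) = pt x (th x y).
Proof.
move=> xy; rewrite (tame_init tG) //; last lra.
by rewrite /circ /cpt; congr (_, _); field.
Qed.

Lemma edge_mid' x y : adj G x y -> g x y (5 / 6) = pt y (th y x).
Proof.
move=> xy; rewrite -edge_mid; last by rewrite adj_sym.
rewrite [RHS](tame_rev tG _ xy); congr (g x y _); lra.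
Qed.

(** As the cycle avoids the interior of the edge, the sign is constant when the edge is crossed near
    either end and when it is followed from one end to the other. *)
Lemma side_off x y : adj G x y -> ~~ cedge x y ->
  HL x y = HR x y /\ HR x y = HL y x.
Proof.
move=> xy nxy.
have key x' y' : adj G x' y' -> ~~ cedge x' y' -> HL x' y' = HR x' y' /\
    HL x' y' = cos (wind g c predT (pt x' (th x' y')) / 2).
  move=> xy' nxy'; have dl0' := dl0.
  have H f w : th x' y' - dl <= f <= th x' y' + dl -> adj G x' w -> cedge x' w ->
      cos (f - th x' w) <> 1.
    move=> ff xw cw c1; have := @sector x' y' w (f - th x' y') xy' xw.
    rewrite (_ : th x' y' + (f - th x' y') = f); last by ring.
    by case/(_ _ c1) => [|yw _]; [lra|move: nxy'; rewrite yw cw].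
  have xV := adj_vertex xy'.
  rewrite /HL /HR; split.
    by symmetry; apply: sector_const => //; lra.
  by symmetry; apply: sector_const => //; [lra|move=> f w ff; apply: H; lra].
have yx : adj G y x by rewrite adj_sym.
have nyx : ~~ cedge y x by rewrite cedge_sym.
have [e1 e2] := key _ _ xy nxy; have [e3 e4] := key _ _ yx nyx.
split => //; rewrite -e1 e2 e4 -(edge_mid xy) -(edge_mid' xy).
apply: (@wind_const _ _ _ _ _ _ _ tG c cyc uc (g x y)); [exact: tame_cont tG x y|lra|].
move=> t t6 z s zc _ s01; have zw : adj G z (next c z) by exact: next_cycle.
apply: (edge_off tG xy zw _ _ s01); last lra.
apply: contra nxy => /eqP e; rewrite /cedge.
have : x \in [set z; next c z]%SET by rewrite -e !inE eqxx.
have : y \in [set z; next c z]%SET by rewrite -e !inE eqxx orbT.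
have := adj_neq xy; rewrite !inE => /negPf ne /orP[]/eqP ey /orP[]/eqP ex.
- by rewrite ex ey eqxx in ne.
- by rewrite ey zc ex eqxx orbT.
- by rewrite ex zc ey eqxx.
- by rewrite ex ey eqxx in ne.
Qed.

(** At each end, [crossing] expresses both sides by one sine, with opposite signs; [turning] relates
    the sines at the two ends. Seen from [y], left and right are exchanged. *)
Lemma side_on x : x \in c -> let y := next c x in
  [/\ HR x y = HL y x, HL y x = - HL x y & HR y x = HL x y].
Proof.
move=> xc y; have xy : adj G x y by exact: next_cycle.
have yx : adj G y x by rewrite adj_sym.
have dl0' := dl0; have rp := tame_r tG.
pose S p := wind g c (predC1 x) p.
have windE p : wind g c predT p = sweep (fun s => vsub (g x y s) p) 0 1 + S p.
  by rewrite /wind (bigD1_seq x).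
have ne z : z \in c -> z != x -> [set x; y]%SET != [set z; next c z]%SET.
  move=> zc zx; apply/eqP => /setP e.
  have := e x; rewrite !inE eqxx [x == z]eq_sym (negPf zx) /= => /esym/eqP xz.
  have := e z; rewrite !inE eqxx (negPf zx) /= => /eqP zy.
  by have := next_next uc c3 xc; rewrite -/y -zy -xz eqxx.
have offS t : 0 < t < 1 -> off g c (predC1 x) (g x y t).
  move=> t01 z s zc zx s01; have zw : adj G z (next c z) by exact: next_cycle.
  exact: (edge_off tG xy zw (ne _ zc zx) t01 s01).
have offx eps l : eps = 1 \/ eps = -1 -> 0 <= l <= dl ->
    off g c (predC1 x) (pt x (th x y + eps * l)) /\ off g c (predC1 x) (pt y (th y x + eps * l)).
  move=> epsE ll; have l1 : - dl <= eps * l <= dl by case: epsE => ->; lra.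
  split=> z s zc zx s01 e; have zw : adj G z (next c z) by exact: next_cycle.
    have [[zx' _]|[wx c1]] := near_pt tG (adj_vertex xy) zw s01 e.
      by move: zx; rewrite /= zx' eqxx.
    have xz : adj G x z by rewrite -wx adj_sym.
    have [yz _] := sector xy xz l1 c1.
    by have /eqP := ne _ zc zx; apply; rewrite wx -yz finset.setUC.
  have [[zy c1]|[wy c1]] := near_pt tG (adj_vertex yx) zw s01 e.
    have yw : adj G y (next c z) by rewrite -zy.
    have [xw _] := sector yx yw l1 c1.
    by have := next_next uc c3 xc; rewrite -/y -zy -xw eqxx.
  have yz : adj G y z by rewrite -wy adj_sym.
  have [xz _] := sector yx yz l1 c1.
  by move: zx; rewrite /= xz eqxx.
(* [crossing] applied at [x' = x] with the sign [sg = 1], and at [x' = y] with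
   the reversed edge, for which all the angles change sign. *)
have cross_x (x' y' : T) sg : adj G x' y' ->
    (forall eps l, eps = 1 \/ eps = -1 -> 0 <= l <= dl ->
       off g c (predC1 x) (pt x' (th x' y' + eps * l))) ->
    (forall p, off g c predT p ->
       sweep (fun s => vsub (g x' y' s) p) 0 1 = sg * sweep (fun s => vsub (g x y s) p) 0 1) ->
    sg = 1 \/ sg = -1 ->
    let K := sin ((sg * S (g x' y' (1 / 6)) +
               sweep (fun s => vsub (g x' y' s) (g x' y' (1 / 6))) (1 / 3) 1) / 2) in
    HL x' y' = - K /\ HR x' y' = K.
  move=> xy' offx' sgP sgE K.
  have side eps : eps = 1 \/ eps = -1 ->
      cos (wind g c predT (pt x' (th x' y' + eps * dl)) / 2) = - eps * K.
    move=> epsE.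
    have [|||f cf fP] := @wind_family R T G pos g r th tG c (predC1 x)
      (fun l => pt x' (th x' y' + eps * l)) 0 dl.
    - by rewrite /circ /cpt; cts.
    - lra.
    - by move=> l ll; exact: offx'.
    have offl l : 0 < l <= dl -> off g c predT (pt x' (th x' y' + eps * l)).
      move=> ll; apply: off_pt; first exact: adj_vertex xy'.
      move=> w xw _ c1; have l1 : - dl <= eps * l <= dl by case: epsE => ->; lra.
      by have [_] := sector xy' xw l1 c1; case: epsE => ->; lra.
    have wE l : 0 < l <= dl ->
        cos ((sg * f l + sweep (fun s => vsub (g x' y' s) (pt x' (th x' y' + eps * l))) 0 1) / 2) =
        cos (wind g c predT (pt x' (th x' y' + eps * l)) / 2).
      move=> ll; rewrite sgP; last exact: offl.
      rewrite fP; last lra.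
      rewrite windE /S; case: sgE => ->; first by congr cos; rewrite !mul1r addrC.
      by rewrite -[RHS]cosN; congr cos; rewrite !mulN1r; lra.
    have wE1 l : 0 < l <= dl ->
        cos (sg * f l + sweep (fun s => vsub (g x' y' s) (pt x' (th x' y' + eps * l))) 0 1) = 1.
      move=> ll; rewrite -[RHS](wind_cos tG cyc uc (offl l ll)) sgP; last exact: offl.
      rewrite fP; last lra.
      rewrite windE /S; case: sgE => ->; first by congr cos; rewrite !mul1r addrC.
      by rewrite -[RHS]cosN; congr cos; rewrite !mulN1r; lra.
    rewrite -wE; last lra.
    have := @crossing R (g x' y') (pos x') r (th x' y') (fun l => sg * f l) dl eps
      (@tame_cont _ _ _ _ _ _ _ tG x' y') rp.
    have h00 : 0 <= (0 : R) <= dl by lra.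
    have hdl : 0 < dl by lra.
    have hpi : dl < pi / 2 by lra.
    rewrite /= => -> //.
    - by rewrite /K fP // mulr0 addr0 -/(pt x' (th x' y')) edge_mid.
    - by move=> s s3; rewrite (tame_init tG).
    - move=> l s ll s3 e; have s01 : 0 <= s <= 1 by lra.
      by have [] := near_start tG xy' s01 e; lra.
    - by cts.
  rewrite /HL /HR; split.
    by have := side 1; rewrite mul1r => ->; [rewrite mulN1r|left].
  by have := side (-1); rewrite mulN1r => ->; [rewrite opprK mul1r|right].
have one : (1 : R) = 1 \/ (1 : R) = -1 by left.
have mone : (-1 : R) = 1 \/ (-1 : R) = -1 by right.
have gE t : g y x t = g x y (1 - t) by exact: (tame_rev tG _ xy).
have [] := cross_x x y 1 xy _ _ one.
- by move=> eps l epsE ll; have [] := offx eps l epsE ll.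
- by move=> p _; rewrite mul1r.
rewrite mul1r => HLx HRx.
have [] := cross_x y x (-1) yx _ _ mone.
- by move=> eps l epsE ll; have [] := offx eps l epsE ll.
- move=> p o; rewrite mulN1r.
  have cp : cont (fun s => vsub (g x y s) p) by have := @tame_cont _ _ _ _ _ _ _ tG x y; rewrite /vsub => ?; cts.
  rewrite -(@sweep_rev _ _ 0 1 0 1 ltr01 cp) ?subrr ?subr0 //.
    by congr (sweep _ 0 1); apply/funext => t; rewrite gE.
  by move=> t t01; apply: vsub_neq0; exact: (o x t xc isT).
rewrite mulN1r => HLy HRy.
have [|||f cf fP] := @wind_family R T G pos g r th tG c (predC1 x) (g x y) (1 / 6) (5 / 6).
- exact: (@tame_cont _ _ _ _ _ _ _ tG x y).
- lra.
- by move=> t t6; apply: offS; lra.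
(* The sign is carried from the parameter [1 / 6] to [5 / 6], which is the parameter [1 / 6] of the
   reversed edge; the reversal changes the sign of the angle and hence of the sine. *)
have tur := @turning R (g x y) (pos x) (pos y) r (th x y) (th y x) f
   (@tame_cont _ _ _ _ _ _ _ tG x y) rp.
have {tur} := tur _ _ _ cf _; rewrite !fP; try lra.
move=> tur; suff E : HL y x = HR x y.
  by split; rewrite ?E ?HLx ?HRx ?opprK // HRy -[LHS]opprK -HLy E HRx.
rewrite HLy HRx {HLy HRy HLx HRx} tur; last first.
- move=> t a t6; rewrite fP // => ta; have t01 : 0 < t < 1 by lra.
  exact: (wind_path tG cyc uc xc (offS t t01) ta).
- by move=> s s3; rewrite -gE (tame_init tG).
- by move=> s s3; rewrite (tame_init tG).
- by move=> s t; exact: (tame_inj tG xy).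
rewrite -sinN; congr sin; rewrite -mulNr; congr (_ / 2).
rewrite opprD opprK gE (_ : 1 - 1 / 6 = 5 / 6); last by lra.
congr (_ + _); have cp : cont (fun s => vsub (g x y s) (g x y (5 / 6))).
  by have := @tame_cont _ _ _ _ _ _ _ tG x y; rewrite /vsub => ?; cts.
rewrite -[RHS]opprK -(@sweep_rev _ _ 0 (2 / 3) (1 / 3) 1 _ cp) //; try lra.
  by congr (- sweep _ _ _); apply/funext => t; rewrite gE.
move=> t t3; apply: vsub_neq0 => e; have t01 : 0 <= t <= 1 by lra.
have t56 : 0 <= (5 / 6 : R) <= 1 by lra.
by have := tame_inj tG xy t01 t56 e; lra.
Qed.
End Sides.

(** * The cyclic order of the edges at a vertex *)

Section Rotation.
Variables (R : realType) (T : finType) (G : graph T).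

(* The combinatorial content of a drawing: [nb x] lists the neighbours of [x]
   counterclockwise, and for a cycle [c] the bit [h x y] is the side of [c] on
   which the left border of the dart [(x, y)] lies. *)
Definition has_sides := exists nb : T -> seq T,
  [/\ forall x, uniq (nb x), forall x y, (y \in nb x) = adj G x y &
   forall c, cycle (adj G) c -> uniq c -> (2 < size c)%N -> exists h : T -> T -> bool,
     (forall x y, adj G x y -> h x y (+) h y x = cedge c x y) /\
     (forall x y, adj G x y -> h x y = h (next (nb x) y) x)].

Variables (pos : T -> R * R) (g : T -> T -> R -> R * R) (r : R) (th : T -> T -> R).
Hypothesis tG : tame G pos g r th.

(** Neighbours are sorted by direction. Between two consecutive directions no edge enters the small
    disc, so the sign is constant on an arc from the left of one edge to the right of the next. *)
Lemma tame_has_sides : has_sides.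
Proof.
have [dl dl0 gapP] := gap tG; have p2 := pi_ge2 R.
pose le x : rel T := fun y z => th x y <= th x z.
pose nb x := sort (le x) (enum [pred y | adj G x y]).
have nbE x y : (y \in nb x) = adj G x y by rewrite mem_sort mem_enum.
have nbu x : uniq (nb x) by rewrite sort_uniq enum_uniq.
have nb_sorted x i j y0 : (i < size (nb x))%N -> (j < size (nb x))%N -> (i <= j)%N ->
    th x (nth y0 (nb x) i) <= th x (nth y0 (nb x) j).
  move=> si sj ij; have st : sorted (le x) (nb x).
    by apply: sort_sorted => u v; exact: le_total.
  apply: (sorted_leq_nth _ _ y0 st) => //.
    by move=> u v w; exact: le_trans.
  by move=> u; exact: lexx.
exists nb; split => // c cyc uc c3.
pose h x y := 0 < HL pos g r th dl c x y.
have HLR x y : adj G x y -> HR pos g r th dl c x y = HL pos g r th dl c y x /\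
    HL pos g r th dl c y x = (if cedge c x y then - HL pos g r th dl c x y else HL pos g r th dl c x y).
  move=> xy; case: ifP => [|/negbT nc].
    move=> /orP[]/andP[xc /eqP e]; have := side_on tG dl0 gapP cyc uc c3 xc; rewrite /= e.
      by case.
    by case=> _ -> ->; rewrite opprK.
  have [e1 e2] := side_off tG dl0 gapP cyc uc xy nc.
  by split => //; rewrite e1.
exists h; split=> x y xy.
  have [_ e] := HLR x y xy; rewrite /h e.
  have : HL pos g r th dl c x y ^+ 2 == 1 by rewrite (HL_sq tG dl0 gapP cyc uc xy).
  rewrite sqrf_eq1; case: ifP => _; last by rewrite addbb.
  by case/orP => /eqP ->; rewrite ?opprK ltr01 ltr0N1.
have yn : y \in nb x by rewrite nbE.
set z := next (nb x) y.
have xz : adj G x z by rewrite -nbE mem_next.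
rewrite /h; have [<- _] := HLR x z xz; congr (0 < _).
have xV := adj_vertex xy.
have ax w := tame_angle tG x w.
have nth_w w : adj G x w -> exists2 k, (k < size (nb x))%N & nth y (nb x) k = w.
  by move=> xw; exists (index w (nb x)); rewrite ?index_mem ?nth_index ?nbE.
have [i [si iy iz]] : exists i, [/\ (i < size (nb x))%N, nth y (nb x) i = y &
    if i.+1 == size (nb x) then nth y (nb x) 0 = z else (i.+1 < size (nb x))%N /\ nth y (nb x) i.+1 = z].
  exists (index y (nb x)); rewrite index_mem nth_index //; split => //.
  move: yn; rewrite /z next_nth => ->; move: (index_mem y (nb x)); rewrite nbE xy.
  case: (nb x) => [|w s]; first by [].
  set k := index y (w :: s); rewrite [size _]/= !ltnS eqSS => ks.
  case: eqP => [e|ne]; first by rewrite [RHS]nth_default ?e.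
  have ks' : (k < size s)%N by rewrite ltn_neqAle ks andbT; exact/eqP.
  by split => //; exact: set_nth_default.
(* If [y] has the last direction, the arc wraps around and [2 pi] is added to the direction of [z].
   With a single neighbour [z = y], and the arc is nearly a whole turn. *)
rewrite /HL /HR; case: eqP iz => [iE|_] iz.
  have zmin w : adj G x w -> th x z <= th x w.
    by move=> /nth_w[k sk <-]; rewrite -iz; apply: nb_sorted => //; case: (nb x) sk.
  have ymax w : adj G x w -> th x w <= th x y.
    by move=> /nth_w[k sk <-]; rewrite -{2}iy; apply: nb_sorted => //; rewrite -ltnS iE.
  transitivity (cos (wind g c predT (circ pos r x (th x z + pi *+ 2 - dl)) / 2)); last first.
    by rewrite /circ /cpt (addrAC _ (pi *+ 2)) cosD2pi sinD2pi.
  rewrite (mulr2n pi); apply: (sector_const tG cyc uc) => //.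
    have [<-|yz] := eqVneq z y; first lra.
    have lt : th x z < th x y.
      by rewrite lt_neqAle ymax // andbT; apply: contra yz => /eqP /(th_inj tG xz xy) ->.
    by have := gapP _ _ _ xz xy yz lt; lra.
  move=> f w ff xw _ c1; have := zmin w xw; have := ymax w xw => h1 h2.
  have := cos1_small c1; rewrite ltr_norml => H.
  by have : f - th x w = 0 by [apply: H; have := ax w; lra]; lra.
case: iz => si1 iz.
have between w : adj G x w -> th x w <= th x y \/ th x z <= th x w.
  move=> /nth_w[k sk <-]; have [ki|ki] := leqP k i.
    by left; rewrite -{2}iy; exact: nb_sorted.
  by right; rewrite -iz; exact: nb_sorted.
have yz : y != z.
  by apply/eqP => e; have := nth_uniq y si si1 (nbu x); rewrite iy iz e eqxx => /esym/eqP/n_Sn.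
have lt : th x y < th x z.
  rewrite lt_neqAle -{2}iy -{2}iz nb_sorted // andbT.
  by apply: contra yz => /eqP /(th_inj tG xy xz) ->.
have gp := gapP _ _ _ xy xz yz lt.
apply: (sector_const tG cyc uc) => //; first lra.
move=> f w ff xw _ c1; have bw := between w xw.
have := cos1_small c1; rewrite ltr_norml => H.
have aw := ax w; have ay := ax y; have az := ax z.
by have : f - th x w = 0 by [apply: H; lra]; case: bw; lra.
Qed.
End Rotation.

(** * Clamped parameters and distances in the plane *)

Section Taming.
Variable R : realType.
Implicit Types (a b d t l s r u f : R).

Definition clamp t : R := Num.max 0 (Num.min 1 t).

Lemma clamp_ge0 t : t <= 0 -> clamp t = 0.
Proof.
by move=> t0; rewrite /clamp (min_idPr (le_trans t0 ler01)) (max_idPl t0).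
Qed.

Lemma clamp_le1 t : 1 <= t -> clamp t = 1.
Proof. by move=> t1; rewrite /clamp (min_idPl t1) (max_idPr ler01). Qed.

Lemma clampE t : 0 <= t <= 1 -> clamp t = t.
Proof. by move=> /andP[t0 t1]; rewrite /clamp (min_idPr t1) (max_idPr t0). Qed.

Lemma clamp01 t : 0 <= clamp t <= 1.
Proof. by rewrite /clamp le_max lexx /= ge_max ler01 ge_min lexx. Qed.

Lemma clampB t : clamp (1 - t) = 1 - clamp t.
Proof.
have [t0|t0] := leP t 0; first by rewrite clamp_le1 ?clamp_ge0 ?subr0 //; lra.
have [t1|t1] := leP 1 t; first by rewrite clamp_ge0 ?clamp_le1 ?subrr //; lra.
by rewrite !clampE //; lra.
Qed.

Lemma cont_clamp (T : topologicalType) (f : T -> R) : cont f -> cont (fun x => clamp (f x)).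
Proof. by move=> cf; rewrite /clamp; cts. Qed.

Lemma within_clamp (U : topologicalType) (f : R -> U) :
  {within `[0, 1], continuous f} -> cont (fun t => f (clamp t)).
Proof.
move=> /subspace_continuousP cf t.
have cl x : `[0, 1]%classic (clamp x) by rewrite /= in_itv /= clamp01.
apply: (@cvg_comp _ _ _ clamp f (nbhs t) (within `[0, 1]%classic (nbhs (clamp t)))); last exact: cf.
move=> A; rewrite /= /within /= => nA.
have cc : cont clamp by apply: cont_clamp; cts.
change (nbhs t (clamp @^-1` A)).
apply: (@filterS _ (nbhs t)) (cc t _ nA) => x; apply; exact: cl.
Qed.

Definition nrm2 (z : R * R) : R := dot z z.

Lemma nrm2_ge0 z : 0 <= nrm2 z.
Proof. by rewrite /nrm2 /dot -!expr2 addr_ge0 ?sqr_ge0. Qed.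

Lemma nrm2_eq0 z w : (nrm2 (vsub z w) == 0) = (z == w).
Proof.
rewrite /nrm2 /dot -!expr2 paddr_eq0 ?sqr_ge0 // !sqrf_eq0 /= !subr_eq0.
by case: z w => ? ? [? ?]; rewrite xpair_eqE.
Qed.

Lemma nrm2_cpt x k t : nrm2 (vsub (cpt x k t) x) = k ^+ 2.
Proof.
transitivity (k ^+ 2 * (cos t ^+ 2 + sin t ^+ 2)); last by rewrite cos2Dsin2 mulr1.
by rewrite /nrm2 /dot /vsub /cpt /=; ring.
Qed.

(** Two points more than [2 r] apart have disjoint discs of radius [r]; on squares of norms this is
    the parallelogram law. *)
Lemma nrm2_sep p x y r : nrm2 (vsub p y) <= r ^+ 2 -> 4 * r ^+ 2 < nrm2 (vsub y x) ->
  r ^+ 2 < nrm2 (vsub p x).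
Proof.
move=> py yx; suff : nrm2 (vsub y x) <= 2 * nrm2 (vsub p x) + 2 * nrm2 (vsub p y) by lra.
rewrite -subr_ge0 (_ : _ - _ = (2 * p.1 - x.1 - y.1) ^+ 2 + (2 * p.2 - x.2 - y.2) ^+ 2).
  by rewrite addr_ge0 ?sqr_ge0.
by rewrite /nrm2 /dot /vsub /=; ring.
Qed.

Lemma cont_nrm2 (T : topologicalType) (F : T -> R * R) (p : R * R) : cont F ->
  cont (fun x => nrm2 (vsub (F x) p)).
Proof. by move=> cF; rewrite /nrm2 /dot /vsub; cts. Qed.

Lemma path_dist (F : R -> R * R) p a b : cont F -> a <= b ->
  (forall t, a <= t <= b -> F t <> p) ->
  exists2 d, 0 < d & forall t, a <= t <= b -> d <= nrm2 (vsub (F t) p).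
Proof.
move=> cF ab Fp; have [m mab mP] := EVT_min ab (continuous_subspaceT (@cont_nrm2 _ F p cF)).
exists (nrm2 (vsub (F m) p)); last by move=> t tab; apply: mP; rewrite in_itv.
rewrite lt_neqAle nrm2_ge0 andbT eq_sym nrm2_eq0; apply/eqP/Fp.
by move: mab; rewrite in_itv.
Qed.

(** The last time on the circle rather than the first: the arc may return to the disc many times,
    and only what follows the last exit stays outside. *)
Lemma last_exit (F : R -> R * R) r b : cont F -> 0 < r -> 0 <= b <= 1 ->
  (forall t, b <= t <= 1 -> r ^+ 2 < nrm2 (vsub (F t) (F 0))) ->
  exists u, [/\ 0 < u < b, nrm2 (vsub (F u) (F 0)) = r ^+ 2 &
    forall t, u < t <= 1 -> r ^+ 2 < nrm2 (vsub (F t) (F 0))].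
Proof.
move=> cF r0 b01 Fb; pose N t := nrm2 (vsub (F t) (F 0)).
have cN : cont N by exact: cont_nrm2.
have N0 : N 0 = 0 by apply/eqP; rewrite nrm2_eq0.
have r2 : 0 < r ^+ 2 by rewrite exprn_gt0.
pose A := N @^-1` [set x | x <= r ^+ 2] `&` `[0, 1]%classic.
have cA : compact A.
  apply: (@subclosed_compact _ A `[0, 1]%classic); last by move=> x [].
    apply: closedI; last exact: itv_closed.
    by apply: closed_comp => [x _|]; [exact: cN|exact: closed_le].
  exact: segment_compact.
have A0 : A !=set0 by exists 0; split; rewrite /= ?N0 ?ltW // in_itv /= lexx ler01.
have [u] := compact_EVT_max A0 cA (continuous_subspaceT (@cont_id R : continuous (fun x : R => x))).
rewrite inE => -[/= Nu]; rewrite in_itv /= => u01 umax.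
have far t : u < t <= 1 -> r ^+ 2 < N t.
  move=> tu; rewrite ltNge; apply/negP => Nt.
  by have : t <= u; [apply: umax; rewrite inE; split => //=; rewrite in_itv /=; lra|lra].
have ub : u < b by rewrite ltNge; apply/negP => bu; have := Fb u; rewrite -/(N u); lra.
have Nur : N u = r ^+ 2.
  have Nb : r ^+ 2 < N b by apply: Fb; lra.
  have [||t tub Nt] := @IVT R N u b (r ^+ 2) (ltW ub).
  - exact: continuous_subspaceT.
  - by rewrite ge_min Nu le_max (ltW Nb) orbT.
  move: tub; rewrite in_itv /= => tub.
  have tu : t <= u by apply: umax; rewrite inE; split; [rewrite /= Nt|rewrite /= in_itv /=; lra].
  by have -> : u = t by lra.
exists u; split => //; rewrite ub andbT lt_neqAle (andP u01).1 andbT.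
by apply/eqP => u0; move: Nur; rewrite -u0 N0; lra.
Qed.
End Taming.

(** * Making the ends of the edges straight *)

Section DrawingTame.
Variables (R : realType) (T : finType) (G : graph T).
Implicit Types (b d t l s r u f : R).

(** An edge is a set, so its arc has no preferred direction; here [a x y] starts at [x], and each
    curve is continuous on all of [R], being frozen outside of the unit interval. *)
Record oriented (pos : T -> R * R) (a : T -> T -> R -> R * R) : Prop := Oriented {
  or_cont : forall x y, cont (a x y);
  or_rev : forall x y t, adj G x y -> a y x t = a x y (1 - t);
  or_start : forall x y, adj G x y -> a x y 0 = pos x;
  or_inj : forall x y s t, adj G x y -> 0 <= s <= 1 -> 0 <= t <= 1 ->
    a x y s = a x y t -> s = t;
  or_vertex : forall x y v t, adj G x y -> v \in vertices G -> 0 < t < 1 ->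
    a x y t <> pos v;
  or_disj : forall x y z w s t, adj G x y -> adj G z w ->
    [set x; y]%SET != [set z; w]%SET -> 0 < s < 1 -> 0 < t < 1 -> a x y s <> a z w t }.

Lemma drawing_oriented pos arc : is_drawing G pos arc -> exists a, oriented pos a.
Proof.
move=> [pinj acont ainj aends avert aarc].
pose a x y t : R * R := if adj G x y then
   (if arc [set x; y]%SET 0 == pos x then arc [set x; y]%SET (clamp t)
    else arc [set x; y]%SET (clamp (1 - t))) else (0, 0).
have ends x y : adj G x y -> (arc [set x; y]%SET 0 = pos x /\ arc [set x; y]%SET 1 = pos y) \/
    (arc [set x; y]%SET 0 = pos y /\ arc [set x; y]%SET 1 = pos x).
  move=> xy; have E := aends _ xy.
  have [xV yV] : x \in vertices G /\ y \in vertices G.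
    by rewrite (adj_vertex xy) (@adj_vertex _ G y x) // adj_sym.
  have ne : pos x <> pos y.
    by move=> /(pinj _ _ xV yV) e; have := adj_neq xy; rewrite e eqxx.
  have mem v : v \in [set x; y]%SET -> arc [set x; y]%SET 0 = pos v \/ arc [set x; y]%SET 1 = pos v.
    move=> vxy; have : [set pos v | v in [set` [set x; y]%SET]] (pos v) by exists v.
    by rewrite -E => -[->|->]; [left|right].
  have [ex|ex] := mem x (set21 _ _); have [ey|ey] := mem y (set22 _ _).
  - by case: ne; rewrite -ex ey.
  - by left.
  - by right.
  - by case: ne; rewrite -ex ey.
have start x y : adj G x y -> a x y 0 = pos x.
  move=> xy; rewrite /a xy; case: eqP => [<-|ne].
    by rewrite clampE // lexx ler01.
  rewrite subr0 clampE ?lexx ?ler01 //.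
  by case: (ends x y xy) => [[e _]|[_ e]].
have repr x y : adj G x y -> exists b : bool, forall t, 0 <= t <= 1 ->
    a x y t = arc [set x; y]%SET (if b then t else 1 - t).
  move=> xy; exists (arc [set x; y]%SET 0 == pos x) => t t01.
  by rewrite /a xy; case: eqP => _; rewrite clampE //; lra.
exists a; split => //.
- move=> x y; rewrite /a; case xy: (adj G x y); last exact: cont_cst.
  have ca := within_clamp (acont _ xy).
  case: (arc _ 0 == _) => //.
  by apply: (cont_comp (h := fun t => arc [set x; y]%SET (clamp t))) => //; cts.
- move=> x y t xy; have yx : adj G y x by rewrite adj_sym.
  rewrite /a xy yx (_ : [set y; x]%SET = [set x; y]%SET); last exact: finset.setUC.
   have := ends _ _ xy.
  have ne : pos x == pos y = false.
    have yV := adj_vertex yx; have xV := adj_vertex xy.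
    by apply/eqP => /(pinj _ _ xV yV) e; have := adj_neq xy; rewrite e eqxx.
  move=> [[-> _]|[-> _]]; first by rewrite eqxx ne.
  by rewrite eqxx [pos y == pos x]eq_sym ne subKr.
- move=> x y s t xy s01 t01; have [b bE] := repr x y xy.
  rewrite !bE // => /(ainj _ xy); rewrite !in_itv /=.
  by case: b {bE} => H; [apply: H; lra|have : 1 - s = 1 - t by [apply: H; lra]; lra].
- move=> x y v t xy vV t01; have [b bE] := repr x y xy.
  rewrite bE; last lra.
  by apply: avert => //; rewrite in_itv /=; case: b {bE}; lra.
- move=> x y z w s t xy zw ne s01 t01; have [b bE] := repr x y xy; have [b' bE'] := repr z w zw.
  have [s1 t1] : 0 <= s <= 1 /\ 0 <= t <= 1 by split; lra.
  rewrite bE // bE' //.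
  by apply: aarc => //; rewrite in_itv /=; [case: b {bE}|case: b' {bE'}]; lra.
Qed.

Lemma oriented_tame pos a : {in vertices G &, injective pos} -> oriented pos a ->
  exists g r th, @tame R T G pos g r th.
Proof.
move=> pinj oa; have ca := or_cont oa.
have symG x y : adj G x y -> adj G y x by rewrite adj_sym.
have end1 x y : adj G x y -> a x y 1 = pos y.
  by move=> xy; rewrite -(or_start oa (symG _ _ xy)) (or_rev oa _ xy) subr0.
have inV x y : adj G x y -> y \in vertices G by move=> /symG/adj_vertex.
have pne v w : v \in vertices G -> w \in vertices G -> v != w -> pos v <> pos w.
  by move=> vV wV /eqP vw e; apply: vw; exact: pinj.
pose N := @nrm2 R.
(* a radius isolating every vertex from what is not incident with it *)
have [r r0 [r1 r2 r3]] : exists2 r, 0 < r & [/\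
    forall x y t, adj G x y -> 1 / 3 <= t <= 1 -> r ^+ 2 < N (vsub (a x y t) (pos x)),
    forall x y v t, adj G x y -> v \in vertices G -> v != x -> v != y -> 0 <= t <= 1 ->
       r ^+ 2 < N (vsub (a x y t) (pos v)) &
    forall v w, v \in vertices G -> w \in vertices G -> v != w ->
       4 * r ^+ 2 < N (vsub (pos v) (pos w))].
  have off x y v t : adj G x y -> v \in vertices G -> v != x -> v != y -> 0 <= t <= 1 ->
      a x y t <> pos v.
    move=> xy vV vx vy t01; have [->|t0] := eqVneq t 0.
      by rewrite (or_start oa xy); apply: pne => //; [exact: adj_vertex xy|rewrite eq_sym].
    have [->|t1] := eqVneq t 1.
      by rewrite end1 //; apply: pne => //; [exact: inV xy|rewrite eq_sym].
    apply: (or_vertex oa) => //.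
    by move: t01; rewrite !le_eqVlt [0 == t]eq_sym (negPf t0) (negPf t1).
  pose P1 (q : T * T) := adj G q.1 q.2.
  have /choice[F1 F1P] : forall q : T * T, exists d, P1 q -> 0 < d /\
      forall t, 1 / 3 <= t <= 1 -> d <= N (vsub (a q.1 q.2 t) (pos q.1)).
    move=> [x y]; have [xy|_] := boolP (P1 (x, y)); last by exists 0.
    have [|t t3 e|d d0 dP] := @path_dist R (a x y) (pos x) (1 / 3) 1 (ca x y); first lra.
      have t01 : 0 <= t <= 1 by lra.
      have z01 : 0 <= (0 : R) <= 1 by lra.
      by rewrite -(or_start oa xy) in e; have := or_inj oa xy t01 z01 e; lra.
    by exists d.
  pose P2 (q : T * (T * T)) := [&& adj G q.1 q.2.1, q.2.2 \in vertices G, q.2.2 != q.1 & q.2.2 != q.2.1].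
  have /choice[F2 F2P] : forall q : T * (T * T), exists d, P2 q -> 0 < d /\
      forall t, 0 <= t <= 1 -> d <= N (vsub (a q.1 q.2.1 t) (pos q.2.2)).
    move=> [x [y v]]; have [/and4P[xy vV vx vy]|_] := boolP (P2 (x, (y, v))); last by exists 0.
    have [|t t3 e|d d0 dP] := @path_dist R (a x y) (pos v) 0 1 (ca x y); first lra.
      exact: (off x y v t).
    by exists d.
  pose P3 (q : T * T) := [&& q.1 \in vertices G, q.2 \in vertices G & q.1 != q.2].
  have [q Pq|d1 d10 D1] := @finite_lower_bound R _ P1 F1; first by case: (F1P q Pq).
  have [q Pq|d2 d20 D2] := @finite_lower_bound R _ P2 F2; first by case: (F2P q Pq).
  have [q /and3P[q1 q2 q3]|d3 d30 D3] := @finite_lower_bound R _ P3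
      (fun q => N (vsub (pos q.1) (pos q.2))).
    by rewrite lt_neqAle nrm2_ge0 andbT eq_sym nrm2_eq0; apply/eqP/pne.
  (* With [r = m / 4] and [m <= 1], both [r ^+ 2] and [4 * r ^+ 2] are below [m], hence below the
     three squared distances. *)
  pose m := Num.min (1 : R) (Num.min d1 (Num.min d2 d3)).
  have [m0 m1 m2 m3 m4] : [/\ 0 < m, m <= 1, m <= d1, m <= d2 & m <= d3].
    by rewrite /m !lt_min !ge_min ltr01 d10 d20 d30 !lexx !orbT.
  have q0 : 0 < (m / 4) ^+ 2 < m / 8 by nra.
  exists (m / 4); first lra.
  split=> [x y t xy t3|x y v t xy vV vx vy t01|v w vV wV vw].
  - have [_ /(_ t t3) /=] := F1P (x, y) xy; have := D1 (x, y) xy; lra.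
  - have Pq : P2 (x, (y, v)) by rewrite /P2 /= xy vV vx vy.
    by have [_ /(_ t t01) /=] := F2P _ Pq; have := D2 _ Pq; lra.
  - by have := D3 (v, w); rewrite /P3 /= vV wV vw => /(_ isT); lra.
have third : 0 <= (1 / 3 : R) <= 1 by lra.
have [ex exP] : exists ex : T -> T -> R, forall x y, adj G x y ->
    [/\ 0 < ex x y < 1 / 3, N (vsub (a x y (ex x y)) (pos x)) = r ^+ 2 &
     forall t, ex x y < t <= 1 -> r ^+ 2 < N (vsub (a x y t) (pos x))].
  have /choice[ex exP] : forall q : T * T, exists u, adj G q.1 q.2 ->
    [/\ 0 < u < 1 / 3, N (vsub (a q.1 q.2 u) (pos q.1)) = r ^+ 2 &
     forall t, u < t <= 1 -> r ^+ 2 < N (vsub (a q.1 q.2 t) (pos q.1))].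
    move=> [x y]; have [xy|_] := boolP (adj G x y); last by exists 0.
    have := @last_exit R (a x y) r (1 / 3) (ca x y) r0 third.
    rewrite (or_start oa xy) => /(_ (fun t => r1 x y t xy))[u uP].
    by exists u.
  by exists (fun x y => ex (x, y)) => x y; exact: exP (x, y).
have [th thP] : exists th : T -> T -> R, forall x y, - (pi / 2) <= th x y < 3 * (pi / 2) /\
    (adj G x y -> a x y (ex x y) = cpt (pos x) r (th x y)).
  have /choice[th thP] : forall q : T * T, exists u, - (pi / 2) <= u < 3 * (pi / 2) /\
    (adj G q.1 q.2 -> a q.1 q.2 (ex q.1 q.2) = cpt (pos q.1) r u).
    move=> [x y]; have [xy|_] := boolP (adj G x y); last first.
      by exists 0; have := pi_ge2 R; split => //; lra.
    have [u01 uN _] := exP _ _ xy.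
    have [|u [k k0 ku] uP] := @isarg_ex R (vsub (a x y (ex x y)) (pos x)).
      by apply: vsub_neq0; apply: (or_vertex oa) => //; [exact: adj_vertex xy|lra].
    exists u; split => // _ /=.
    have kr : k = r.
      have := uN; rewrite ku /N /nrm2 /dot /=.
      have -> : k * cos u * (k * cos u) + k * sin u * (k * sin u) = k ^+ 2 * (cos u ^+ 2 + sin u ^+ 2) by ring.
      by rewrite cos2Dsin2 mulr1 => /eqP; rewrite eqrXn2 ?ltW // => /eqP.
    move: ku; rewrite kr /vsub /cpt => -[<- <-]; case: (a x y _) => p q /=.
    by rewrite ![_ + (_ - _)]addrC !subrK.
  by exists (fun x y => th (x, y)) => x y; exact: thP (x, y).
(* Three pieces: a radius from [pos x] to the last exit, the arc between the last exits of its two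
   directions, a radius into [pos y]. Each clamped factor varies on one third only between [0] and
   [1], so the pieces are added and continuity needs no gluing. *)
pose mid x y t := ex x y + clamp (3 * t - 1) * (1 - ex y x - ex x y).
pose g x y t : R * R := if adj G x y then
  ((a x y (mid x y t)).1 + (clamp (3 * t) - 1) * ((a x y (ex x y)).1 - (pos x).1)
     + clamp (3 * t - 2) * ((pos y).1 - (a x y (1 - ex y x)).1),
   (a x y (mid x y t)).2 + (clamp (3 * t) - 1) * ((a x y (ex x y)).2 - (pos x).2)
     + clamp (3 * t - 2) * ((pos y).2 - (a x y (1 - ex y x)).2)) else (0, 0).
have gcont x y : cont (g x y).
  rewrite /g; case: (adj G x y); last exact: cont_cst.
  by rewrite /mid /clamp; have := ca x y => ?; cts.
have grev x y t : adj G x y -> g y x t = g x y (1 - t).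
  move=> xy; rewrite /g xy (symG _ _ xy) /mid !(or_rev oa _ xy).
  have -> : clamp (3 * (1 - t) - 1) = 1 - clamp (3 * t - 1) by rewrite -clampB; congr clamp; ring.
  have -> : clamp (3 * (1 - t)) = 1 - clamp (3 * t - 2) by rewrite -clampB; congr clamp; ring.
  have -> : clamp (3 * (1 - t) - 2) = 1 - clamp (3 * t) by rewrite -clampB; congr clamp; ring.
  set c1 := clamp _; set c2 := clamp _; set c3 := clamp _.
  have -> : 1 - (ex y x + c1 * (1 - ex x y - ex y x)) = ex x y + (1 - c1) * (1 - ex y x - ex x y) by ring.
  by rewrite subKr; congr (_, _); ring.
have ginit x y t : adj G x y -> 0 <= t <= 1 / 3 -> g x y t = cpt (pos x) (3 * t * r) (th x y).
  move=> xy t3; rewrite /g xy /mid.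
  have -> : clamp (3 * t - 1) = 0 by apply: clamp_ge0; lra.
  have -> : clamp (3 * t - 2) = 0 by apply: clamp_ge0; lra.
  have -> : clamp (3 * t) = 3 * t by apply: clampE; lra.
  rewrite !mul0r !addr0; have [_ /(_ xy) ->] := thP x y.
  by rewrite /cpt /=; congr (_, _); ring.
have gmid x y t : adj G x y -> 1 / 3 <= t <= 2 / 3 -> g x y t = a x y (ex x y + (3 * t - 1) * (1 - ex y x - ex x y)).
  move=> xy t3; rewrite /g xy /mid.
  have -> : clamp (3 * t - 1) = 3 * t - 1 by apply: clampE; lra.
  have -> : clamp (3 * t - 2) = 0 by apply: clamp_ge0; lra.
  have -> : clamp (3 * t) = 1 by apply: clamp_le1; lra.
  by rewrite subrr !mul0r !addr0; case: (a x y _).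
have midP x y t : adj G x y -> 1 / 3 < t < 2 / 3 ->
    ex x y < ex x y + (3 * t - 1) * (1 - ex y x - ex x y) < 1 - ex y x.
  move=> xy t3; have [e1 _ _] := exP _ _ xy; have [e2 _ _] := exP _ _ (symG _ _ xy).
  have k0 : 0 < 3 * t - 1 < 1 by lra.
  have h0 : 0 < 1 - ex y x - ex x y by lra.
  have [k00 k1] := andP k0.
  have := mulr_gt0 k00 h0; have : (3 * t - 1) * (1 - ex y x - ex x y) < 1 - ex y x - ex x y.
    by rewrite gtr_pMl.
  by set k := (3 * t - 1) * _ => ? ?; lra.
have gnear x y t : adj G x y -> 0 <= t <= 1 / 3 -> N (vsub (g x y t) (pos x)) = (3 * t * r) ^+ 2.
  by move=> xy t3; rewrite ginit // /N nrm2_cpt.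
have near_le t : 0 <= t <= 1 / 3 -> (3 * t * r) ^+ 2 <= r ^+ 2.
  by move=> t3; rewrite lerXn2r ?nnegrE ?mulr_ge0 ?(ltW r0) ?ler_piMl ?(ltW r0) //; lra.
have grev' x y t : adj G x y -> g x y t = g y x (1 - t).
  by move=> /symG; exact: grev.
have gother x y v t : adj G x y -> v \in vertices G -> v != x -> v != y -> 0 <= t <= 1 ->
    r ^+ 2 < N (vsub (g x y t) (pos v)).
  move=> xy vV vx vy t01.
  have start x' y' t' : adj G x' y' -> v != x' -> 0 <= t' <= 1 / 3 -> r ^+ 2 < N (vsub (g x' y' t') (pos v)).
    move=> xy' vx' t3; apply: (@nrm2_sep _ _ _ (pos x')); first by rewrite -/(N _) gnear // near_le.
    by apply: r3; [exact: adj_vertex xy'| |rewrite eq_sym].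
  have [t3|t3] := leP t (1 / 3); first by apply: start => //; lra.
  have [t6|t6] := leP (2 / 3) t; first by rewrite grev' //; apply: start; [exact: symG| |lra].
  have t36 : 1 / 3 < t < 2 / 3 by lra.
  have [e1 _ _] := exP _ _ xy; have [e2 _ _] := exP _ _ (symG _ _ xy).
  have mp := midP _ _ _ xy t36; rewrite gmid //; last lra.
  by apply: r2 => //; lra.
have gfar x y t : adj G x y -> 1 / 3 < t <= 1 -> r ^+ 2 < N (vsub (g x y t) (pos x)).
  move=> xy t1; have [t6|t6] := leP (2 / 3) t.
    rewrite grev' //; apply: (@nrm2_sep _ _ _ (pos y)).
      by rewrite -/(N _) gnear ?near_le //; [lra|exact: symG|lra].
    by apply: r3; [exact: inV xy|exact: adj_vertex xy|rewrite eq_sym; exact: adj_neq xy].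
  have t36 : 1 / 3 < t < 2 / 3 by lra.
  have [e1 _ far] := exP _ _ xy; have [e2 _ _] := exP _ _ (symG _ _ xy).
  by have mp := midP _ _ _ xy t36; rewrite gmid //; [apply: far|]; lra.
have r_inj s t : 0 <= s -> 0 <= t -> (3 * s * r) ^+ 2 = (3 * t * r) ^+ 2 -> s = t.
  move=> s0 t0; have [s1 t1] : 0 <= 3 * s * r /\ 0 <= 3 * t * r.
    by rewrite !mulr_ge0 // ltW.
  move=> /eqP; rewrite eqrXn2 // => /eqP /(mulIf (lt0r_neq0 r0)).
  by lra.
have gdisj0 x y z w s t : adj G x y -> adj G z w -> [set x; y]%SET != [set z; w]%SET ->
    0 < s <= 1 / 3 -> 0 <= t <= 1 -> g x y s <> g z w t.
  move=> xy zw ne s3 t01 e; have s3' : 0 <= s <= 1 / 3 by lra.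
  have := near_le _ s3'; rewrite -(gnear _ _ _ xy s3') e.
  have same w' t' : adj G x w' -> [set x; y]%SET != [set x; w']%SET -> 0 <= t' <= 1 ->
      g x y s = g x w' t' -> r ^+ 2 < N (vsub (g x w' t') (pos x)).
    move=> xw ne' t01' e'; have [t3|t3] := leP t' (1 / 3); last by apply: gfar => //; lra.
    have t3' : 0 <= t' <= 1 / 3 by lra.
    (* Two radii at [x] that meet away from the centre have the same direction, hence the same exit
       point, and there the original arcs would meet. *)
    have st : s = t'.
      by apply: r_inj; [lra|lra|rewrite -(gnear _ _ _ xy s3') -(gnear _ _ _ xw t3') e'].
    have [e1 _ _] := exP _ _ xy; have [e2 _ _] := exP _ _ xw.
    exfalso; apply: (@or_disj _ _ oa x y x w' (ex x y) (ex x w') xy xw ne'); [lra|lra|].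
    have [_ ->] := thP x y => //; have [_ ->] := thP x w' => //.
    have sr : 3 * s * r != 0 by rewrite gt_eqF // !mulr_gt0 //; lra.
    move: e'; rewrite !ginit // -st => -[/addrI /(mulfI sr) c1 /addrI /(mulfI sr) c2].
    by rewrite /cpt c1 c2.
  have [zx|zx] := eqVneq z x.
    by subst z; rewrite leNgt (same w t) // e.
  have [wx|wx] := eqVneq w x.
    subst w; rewrite grev' // leNgt (same z (1 - t)) //; [exact: symG|by rewrite [X in _ != X]finset.setUC|lra|].
    by rewrite e grev'.
  by rewrite leNgt gother // ?(adj_vertex xy) // eq_sym.
exists g, r, th; split => //.
- move=> x y z w s t xy zw ne s01 t01.
  have [s0 t0] : 0 <= s <= 1 /\ 0 <= t <= 1 by split; lra.
  have ne' : [set z; w]%SET != [set x; y]%SET by rewrite eq_sym.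
  have [s3|s3] := leP s (1 / 3).
    have s03 : 0 < s <= 1 / 3 by lra.
    exact: gdisj0 xy zw ne s03 t0.
  have [t3|t3] := leP t (1 / 3).
    have t03 : 0 < t <= 1 / 3 by lra.
    exact/nesym/(gdisj0 _ _ _ _ _ _ zw xy ne' t03 s0).
  have [s6|s6] := leP (2 / 3) s.
    have s03 : 0 < 1 - s <= 1 / 3 by lra.
    rewrite finset.setUC in ne; rewrite (grev' _ _ _ xy).
    exact: gdisj0 (symG _ _ xy) zw ne s03 t0.
  have [t6|t6] := leP (2 / 3) t.
    have t03 : 0 < 1 - t <= 1 / 3 by lra.
    rewrite finset.setUC in ne'; rewrite (grev' _ _ _ zw).
    exact/nesym/(gdisj0 _ _ _ _ _ _ (symG _ _ zw) xy ne' t03 s0).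
  have s36 : 1 / 3 < s < 2 / 3 by lra.
  have t36 : 1 / 3 < t < 2 / 3 by lra.
  have mp := midP _ _ _ xy s36; have mq := midP _ _ _ zw t36.
  have [e1 _ _] := exP _ _ xy; have [e2 _ _] := exP _ _ (symG _ _ xy).
  have [e3 _ _] := exP _ _ zw; have [e4 _ _] := exP _ _ (symG _ _ zw).
  rewrite (gmid _ _ _ xy) ?(gmid _ _ _ zw); [|lra|lra].
  by apply: (or_disj oa xy zw ne); lra.
- have inj0 x y s t : adj G x y -> 0 <= s <= 1 / 3 -> 0 <= t <= 1 -> g x y s = g x y t -> s = t.
    move=> xy s3 t01 e; have := gnear _ _ _ xy s3; rewrite e.
    have [t3|t3] := leP t (1 / 3) => eN.
      by apply: r_inj; [lra|lra|rewrite -eN gnear //; lra].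
    have := near_le _ s3; rewrite -eN leNgt gfar //; lra.
  move=> x y s t xy s01 t01 e.
  have [s3|s3] := leP s (1 / 3).
    have s03 : 0 <= s <= 1 / 3 by lra.
    exact: inj0 xy s03 t01 e.
  have [t3|t3] := leP t (1 / 3).
    have t03 : 0 <= t <= 1 / 3 by lra.
    exact/esym/(inj0 _ _ _ _ xy t03 s01)/esym.
  have yx := symG _ _ xy.
  have [s6|s6] := leP (2 / 3) s.
    have s03 : 0 <= 1 - s <= 1 / 3 by lra.
    have t1 : 0 <= 1 - t <= 1 by lra.
    have : 1 - s = 1 - t; last lra.
    by apply: (inj0 _ _ _ _ yx s03 t1); rewrite -!(grev' _ _ _ xy).
  have [t6|t6] := leP (2 / 3) t.
    have t03 : 0 <= 1 - t <= 1 / 3 by lra.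
    have s1 : 0 <= 1 - s <= 1 by lra.
    have : 1 - t = 1 - s; last lra.
    by apply: (inj0 _ _ _ _ yx t03 s1); rewrite -!(grev' _ _ _ xy).
  have s36 : 1 / 3 < s < 2 / 3 by lra.
  have t36 : 1 / 3 < t < 2 / 3 by lra.
  have mp := midP _ _ _ xy s36; have mq := midP _ _ _ xy t36.
  have [e1 _ _] := exP _ _ xy; have [e2 _ _] := exP _ _ (symG _ _ xy).
  move: e; rewrite !(gmid _ _ _ xy); [|lra|lra].
  move=> /(or_inj oa xy) H; have {}H : ex x y + (3 * s - 1) * (1 - ex y x - ex x y) =
     ex x y + (3 * t - 1) * (1 - ex y x - ex x y) by apply: H; lra.
  have h0 : 1 - ex y x - ex x y != 0 by rewrite gt_eqF //; lra.
  by move: H => /addrI /(mulIf h0); lra.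
- by move=> x y; have [] := thP x y.
Qed.

Lemma planar_has_sides : planar R G -> has_sides G.
Proof.
move=> [pos [arc dG]]; have [a oa] := drawing_oriented dG.
have [g [r [th tG]]] := oriented_tame (pos_inj dG) oa.
exact: tame_has_sides tG.
Qed.
End DrawingTame.

(** * The edge bound *)

Section Combinatorics.
Local Open Scope nat_scope.
Variables (T : finType) (G : graph T).

Lemma connect_leave (e : rel T) (S : {set T}) x y : connect e x y -> x \in S -> y \notin S ->
  exists u v, [/\ u \in S, v \notin S & e u v].
Proof.
move=> /connectP[p pp ->]; elim: p x pp => [|z p IHp] x /=; first by move=> _ ->.
move=> /andP[xz pz] xS; have [zS|zS] := boolP (z \in S); first exact: IHp.
by exists x, z.
Qed.

(** Grown one vertex at a time along an edge leaving the vertices already reached, which keeps fewer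
    edges than vertices. *)
Lemma spanning_tree x0 : x0 \in vertices G ->
  (forall x, x \in vertices G -> connect (adj G) x0 x) ->
  exists F : {set {set T}}, [/\ F \subset edges G, #|F| < #|vertices G| &
    forall x, x \in vertices G -> connect (fun a b => [set a; b]%SET \in F) x0 x].
Proof.
move=> x0V con.
suff H k : 0 < k <= #|vertices G| -> exists (S : {set T}) (F : {set {set T}}),
   [/\ S \subset vertices G, x0 \in S, #|S| = k, F \subset edges G & #|F| < k] /\
   (forall x, x \in S -> connect (fun a b => [set a; b]%SET \in F) x0 x).
  have [|S [F [[SV _ Sk FE Fk] cF]]] := H #|vertices G|.
    by rewrite leqnn andbT; apply/card_gt0P; exists x0.
  have SE : S = vertices G by apply/eqP; rewrite eqEcard SV Sk leqnn.
  by exists F; split => // x; rewrite -SE; exact: cF.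
elim: k => [//|[|k] IHk] /andP[_ kV].
  exists [set x0]%SET, finset.set0; split.
    by split; rewrite ?finset.sub1set ?inE ?cards1 ?finset.sub0set ?cards0.
  by move=> x; rewrite inE => /eqP ->; exact: connect0.
have [|S [F [[SV x0S Sk FE Fk] cF]]] := IHk; first by rewrite /= ltnW.
have /subsetPn[y yV yS] : ~~ (vertices G \subset S).
  by apply/negP => /subset_leq_card; rewrite Sk leqNgt kV.
have [u [v [uS vS uv]]] := connect_leave (con y yV) x0S yS.
have vV : v \in vertices G by rewrite (@adj_vertex _ G v u) // adj_sym.
exists (v |: S)%SET, ([set u; v] |: F)%SET; split; first split.
- by rewrite finset.subUset finset.sub1set vV.
- by rewrite !inE x0S orbT.
- by rewrite cardsU1 vS Sk.
- by rewrite finset.subUset finset.sub1set FE andbT; exact: uv.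
- by rewrite cardsU1 (leq_ltn_trans (leq_add (leq_b1 _) (leqnn _))) // add1n ltnS.
have sub : subrel (connect (fun a b => [set a; b]%SET \in F))
                  (connect (fun a b => [set a; b]%SET \in ([set u; v] |: F)%SET)).
  by apply: connect_sub => a b ab; apply: connect1; rewrite !inE ab orbT.
move=> x; rewrite !inE => /predU1P[->|xS]; last exact/sub/cF.
apply: connect_trans (sub _ _ (cF u uS)) _; apply: connect1.
by rewrite !inE eqxx.
Qed.

(** A simple path in [F] from [v] to [u] is closed by the step from [u] to [v], the only one outside
    [F]; the path has at least two edges because [[set u; v]] is not in [F]. *)
Lemma fundamental_cycle (F : {set {set T}}) u v : F \subset edges G -> adj G u v ->
  [set u; v]%SET \notin F -> connect (fun a b => [set a; b]%SET \in F) v u ->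
  exists c, [/\ cycle (adj G) c, uniq c, 2 < size c &
    forall x y, adj G x y -> [set x; y]%SET \notin F -> cedge c x y = ([set x; y]%SET == [set u; v]%SET)].
Proof.
move=> FE uv nF /connectP[p0 pp0 lu0].
case/shortenP: pp0 lu0 => p pp pu _ lu0; set c := v :: p.
have uc : u \in c by rewrite lu0 mem_last.
pose e' : rel T := fun a b => ([set a; b]%SET \in F) || (a == u) && (b == v).
have ce' : cycle e' c.
  rewrite /= rcons_path -lu0 /e' !eqxx orbT andbT.
  by apply: sub_path pp => a b ->.
have nu : next c u = v.
  by rewrite next_nth uc; change (nth v p (index u (v :: p)) = v); rewrite lu0 index_last ?nth_default.
exists c; split => //.
- apply: sub_path ce' => a b /orP[abF|/andP[/eqP -> /eqP ->] //].
  exact: (fintype.subsetP FE).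
- rewrite /c; case: p lu0 pp {pu ce' uc nu c} => [|w [|]] //= lu0.
    by move: (adj_neq uv); rewrite lu0 eqxx.
  by rewrite andbT -lu0 finset.setUC (negPf nF).
move=> x y xy nxy; apply/idP/eqP => [|/setP e].
  move=> /orP[]/andP[xc /eqP xE]; have := next_cycle ce' xc; rewrite xE /e'.
    by rewrite (negPf nxy) /= => /andP[/eqP -> /eqP ->].
  by rewrite finset.setUC (negPf nxy) /= => /andP[/eqP -> /eqP ->]; rewrite finset.setUC.
have xn := adj_neq xy.
have := e x; have := e y; rewrite !inE !eqxx ?orbT /= => /esym /orP[]/eqP ey /esym /orP[]/eqP ex.
- by rewrite ex ey eqxx in xn.
- by rewrite /cedge ex ey nu uc eqxx orbT.
- by rewrite /cedge ex ey nu uc eqxx.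
- by rewrite ex ey eqxx in xn.
Qed.

Lemma next_closed (s : seq T) (P : pred T) y : uniq s -> y \in s -> P y ->
  (forall z, z \in s -> P z -> P (next s z)) -> forall z, z \in s -> P z.
Proof.
move=> us ys Py cl; have := cycle_next us.
have [i p e] := rot_to ys; rewrite -(rot_cycle i) e /= => pp z.
rewrite -(mem_rot i) e.
have sub : {subset rcons p y <= s} by move=> w; rewrite mem_rcons -e mem_rot.
have : all P (rcons p y).
  move: pp ys Py sub; move: (rcons p y) => q.
  elim: q y {e} => [//|w q IHq] y /= /andP[/eqP <- pq] ys Py sub.
  have Pn : P (next s y) by exact: cl.
  rewrite Pn; apply: (IHq (next s y)) => // [|w' w'q]; first by rewrite mem_next.
  by apply: sub; rewrite inE w'q orbT.
by move=> /allP H zp; apply: H; rewrite mem_rcons.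
Qed.

Definition triangle_free := forall x y z, adj G x y -> adj G y z -> adj G z x -> False.

(** The edge [uv] extends at both ends to a walk [x, w, v, u, y]. Without triangles [x != u] and
    [y != w], so its four edges are distinct, even when [x = y]. *)
Lemma even_subgraph (q : rel T) u v : triangle_free -> symmetric q -> subrel q (adj G) ->
  (forall x y, q x y -> exists2 z, z != y & q x z) -> q u v ->
  exists s : seq (T * T), [/\ size s = 4, uniq [seq [set d.1; d.2]%SET | d <- s] &
     forall d, d \in s -> q d.1 d.2].
Proof.
move=> tf sq qG ev uv.
have [w wu vw] := ev v u (etrans (sq v u) uv).
have [x xv wx] := ev w v (etrans (sq w v) vw).
have [y yv uy] := ev u v uv.
have xu : x != u.
  by apply/eqP => xu; subst x; exact: (tf u v w (qG _ _ uv) (qG _ _ vw) (qG _ _ wx)).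
have yw : y != w.
  by apply/eqP => yw; subst y; apply: (tf u v w) (qG _ _ uv) (qG _ _ vw) _; rewrite adj_sym qG.
have nuv := adj_neq (qG _ _ uv); have nvw := adj_neq (qG _ _ vw).
have nwx := adj_neq (qG _ _ wx); have nuy := adj_neq (qG _ _ uy).
exists [:: (u, v); (v, w); (w, x); (u, y)]; split => //; last first.
  by move=> d; rewrite !inE => /or4P[]/eqP->.
have sep (A B : {set T}) z : z \in A -> z \notin B -> A != B.
  by move=> zA zB; apply: contraNneq zB => <-.
rewrite /= !inE !negb_or; apply/and4P; split=> //; first (apply/and3P; split); try (apply/andP; split).
- by apply: (sep _ _ u); rewrite !inE ?eqxx // negb_or nuv eq_sym wu.
- by apply: (sep _ _ u); rewrite !inE ?eqxx // negb_or !(eq_sym u) wu xu.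
- by apply: (sep _ _ v); rewrite !inE ?eqxx ?orbT // negb_or !(eq_sym v) nuv yv.
- by apply: (sep _ _ v); rewrite !inE ?eqxx ?orbT // negb_or nvw eq_sym xv.
- by apply: (sep _ _ v); rewrite !inE ?eqxx ?orbT // negb_or !(eq_sym v) nuv yv.
- by apply: (sep _ _ w); rewrite !inE ?eqxx ?orbT // negb_or wu eq_sym yw.
Qed.
End Combinatorics.

(** * The edge bound for connected graphs *)

Section EdgeBound.
Local Open Scope nat_scope.
Variables (T : finType) (G : graph T).

Lemma connected_bound : has_sides G -> triangle_free G -> 2 < #|vertices G| ->
  (forall x y, x \in vertices G -> y \in vertices G -> connect (adj G) x y) ->
  #|edges G| + 4 <= #|vertices G|.*2.
Proof.
move=> [nb [nbu nbE sides]] tf V3 con.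
have [x0 x0V] : exists x0, x0 \in vertices G by apply/card_gt0P; exact: leq_trans V3.
have [F [FE Fk Fcon]] := spanning_tree x0V (fun x => con x0 x x0V).
pose M := edges G :\: F.
have EM : #|edges G| = #|M| + #|F| by rewrite cardsD (finset.setIidPr FE) subnK ?subset_leq_card.
have symF : connect_sym (fun a b => [set a; b]%SET \in F).
  by apply: sym_connect_sym => a b; rewrite finset.setUC.
have /choice[H HP] : forall e : {set T}, exists h : T -> T -> bool, e \in M ->
    (forall x y, adj G x y -> [set x; y]%SET \in M -> h x y (+) h y x = ([set x; y]%SET == e)) /\
    (forall x y, adj G x y -> h x y = h (next (nb x) y) x).
  move=> e; have [|_] := boolP (e \in M); last by exists (fun _ _ => false).
  rewrite inE => /andP[eF eE]; have /andP[_ /cards2P[u [v [uv ee]]]] := edgesP eE; subst e.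
  have [|c [cyc uc c3 cP]] := @fundamental_cycle _ G F u v FE eE eF.
    have vV : v \in vertices G by rewrite (@adj_vertex _ G v u) // adj_sym.
    have uV := adj_vertex eE.
    by apply: (connect_trans (y := x0)); [rewrite symF; exact: Fcon|exact: Fcon].
  have [h [h1 h2]] := sides c cyc uc c3; exists h => _; split => // x y xy.
  by rewrite inE => /andP[xyF _]; rewrite h1 // cP.
(* The left side of the dart [(x, y)] relative to all fundamental cycles at once; equality of these
   vectors is the equivalence of sides. Outside [M], where [H] is arbitrary, the bits are set to
   [false]. *)
pose vec x y : {ffun {set T} -> bool} := [ffun e => (e \in M) && H e x y].
have vec_next x y : adj G x y -> vec x y = vec (next (nb x) y) x.
  move=> xy; apply/ffunP => e; rewrite !ffunE; case: (boolP (e \in M)) => //= eM.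
  exact: (HP e eM).2.
pose D := [set d : T * T | adj G d.1 d.2]%SET.
pose W := [set vec d.1 d.2 | d in D]%SET.
have vecW x y : adj G x y -> vec x y \in W.
  by move=> xy; apply/imsetP; exists (x, y); rewrite ?inE.
have symG x y : adj G x y -> adj G y x by rewrite adj_sym.
have DE : #|D| <= #|edges G|.*2.
  pose f (d : T * T) := ([set d.1; d.2]%SET, enum_rank d.1 < enum_rank d.2).
  have <- : #|finset.setX (edges G) [set: bool]| = #|edges G|.*2.
    by rewrite cardsX cardsT card_bool muln2.
  rewrite -(@card_in_imset _ _ f D).
    apply: subset_leq_card; apply/fintype.subsetP => _ /imsetP[[x y] xy ->].
    by rewrite !inE andbT; move: xy; rewrite inE.
  move=> [x y] [z w]; rewrite !inE /= => xy zw [/setP e r].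
  have := e x; have := e y; rewrite !inE !eqxx ?orbT /= => /esym /orP[]/eqP ey /esym /orP[]/eqP ex.
  - by have := adj_neq xy; rewrite ex ey eqxx.
  - subst z w; case: (ltngtP (enum_rank x) (enum_rank y)) r => // er _.
    by have := adj_neq xy; rewrite (enum_rank_inj (val_inj er)) eqxx.
  - by rewrite ex ey.
  - by have := adj_neq xy; rewrite ex ey eqxx.
have [E0|E0] := leqP #|edges G| 0; first by rewrite leqn0 in E0; rewrite (eqP E0); lia.
have [[x1 y1] xy1] : exists d, d \in D.
  have /card_gt0P[e eE] := E0; have /andP[_ /cards2P[u [v [uv ee]]]] := edgesP eE; subst e.
  by exists (u, v); rewrite inE.
rewrite inE /= in xy1.
(* A constant bit plus the sum of the coordinates in a set [U] of edges of [M] gives pairwise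
   distinct functions on [W]: by [diff], such a sum changes across an edge of [M] exactly when the
   edge is in [U]. Hence [2 ^ #|M|.+1 <= 2 ^ #|W|]. *)
have MW : #|M|.+1 <= #|W|.
  pose f (p : {set {set T}} * bool) : {set {ffun {set T} -> bool}} :=
    [set w in W | p.2 (+) \big[addb/false]_(e in p.1) w e]%SET.
  have card_dom : #|finset.setX (finset.powerset M) [set: bool]| = 2 ^ #|M|.+1.
    by rewrite cardsX card_powerset cardsT card_bool expnSr.
  rewrite -(@leq_exp2l 2) // -card_dom -card_powerset -(@card_in_imset _ _ f).
    apply: subset_leq_card; apply/fintype.subsetP => _ /imsetP[p _ ->].
    by rewrite powersetE; apply/fintype.subsetP => w; rewrite inE => /andP[].
  move=> [U b] [U' b']; rewrite !inE /= !andbT => UM UM' /setP e.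
  have ew w : w \in W -> b (+) \big[addb/false]_(e in U) w e = b' (+) \big[addb/false]_(e in U') w e.
    by move=> wW; have := e w; rewrite !inE wW.
  have diff (B : {set {set T}}) x y : B \subset M -> adj G x y -> [set x; y]%SET \in M ->
      (\big[addb/false]_(e in B) vec x y e) (+) (\big[addb/false]_(e in B) vec y x e) = ([set x; y]%SET \in B).
    move=> BM xy xyM; rewrite -big_split /=.
    under eq_bigr => e' e'B.
      rewrite !ffunE (fintype.subsetP BM _ e'B) /= (HP e' (fintype.subsetP BM _ e'B)).1 //.
      over.
    have [xyB|xyB] := boolP ([set x; y]%SET \in B).
      rewrite (bigD1 _ xyB) /= eqxx big1 // => e' /andP[_].
      by rewrite eq_sym => /negPf.
    by rewrite big1 // => e' e'B; apply/negbTE; apply: contraNneq xyB => ->.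
  have UU : U = U'.
    apply/setP => e'; have [e'M|e'M] := boolP (e' \in M); last first.
      by rewrite (contraNF (fintype.subsetP UM e') e'M) (contraNF (fintype.subsetP UM' e') e'M).
    have := e'M; rewrite inE => /andP[_ eE].
    have /andP[_ /cards2P[x [y [xy ee]]]] := edgesP eE; subst e'.
    rewrite -(diff U x y) // -(diff U' x y) //.
    have := ew _ (vecW x y eE); have := ew _ (vecW y x (symG _ _ eE)).
    by do 4 case: (\big[_/_]_(_ in _) _); case: b {e ew}; case: b'.
  subst U'; have := ew _ (vecW _ _ xy1).
  by case: (\big[_/_]_(_ in _) _); case: b {e ew}; case: b'.
pose q (w : {ffun {set T} -> bool}) x y := adj G x y && ((vec x y == w) (+) (vec y x == w)).
have q_even w x y : q w x y -> exists2 z, z != y & q w x z.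
  move=> qxy; have xy : adj G x y by case/andP: qxy.
  have ynb : y \in nb x by rewrite nbE.
  (* Around [x], the left side at one neighbour is the right side at the next, so each class is
     counted twice: every vertex has even degree in [q w]. *)
  have S0 : \big[addb/false]_(z <- nb x) ((vec x z == w) (+) (vec z x == w)) = false.
    rewrite big_split /=.
    have -> : \big[addb/false]_(z <- nb x) (vec x z == w) = \big[addb/false]_(z <- nb x) (vec z x == w).
      rewrite big_seq; under eq_bigr => z znb do rewrite vec_next -?nbE //.
      rewrite -big_seq !(big_uniq _ (nbu x)) /=.
      rewrite [RHS](reindex_inj (can_inj (prev_next (nbu x)))) /=.
      by apply: eq_bigl => z; rewrite mem_next.
    exact: addbb.
  apply/exists_inP; apply: contraT => /exists_inPn none.
  move: S0; rewrite (bigD1_seq y) //= big_seq_cond big1 => [|z /andP[znb zy]].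
    by rewrite addbF; case/andP: qxy => _ ->.
  by have := none z zy; rewrite /q -nbE znb /= => /negbTE.
have q_sym w : symmetric (q w) by move=> x y; rewrite /q adj_sym addbC.
have q_adj w : subrel (q w) (adj G) by move=> x y /andP[].
have class4 w x y : q w x y -> 4 <= #|[set d in D | vec d.1 d.2 == w]%SET|.
  move=> qxy; have [s [s4 us qs]] := even_subgraph tf (q_sym w) (q_adj w) (q_even w) qxy.
  pose dart (d : T * T) := if vec d.1 d.2 == w then d else (d.2, d.1).
  have <- : size (map dart s) = 4 by rewrite size_map.
  have du : uniq (map dart s).
    apply: (@map_uniq _ _ (fun d : T * T => [set d.1; d.2]%SET)); rewrite -map_comp.
    rewrite (_ : map _ s = [seq [set d.1; d.2]%SET | d <- s]) //.
    by apply: eq_map => d; rewrite /= /dart; case: ifP => // _; rewrite finset.setUC.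
  rewrite cardE; apply: uniq_leq_size => // _ /mapP[[a b] /qs /andP[/= ab qab] ->].
  rewrite mem_enum !inE /dart /=; move: qab; case: ifP => /= [-> _|_ /eqP ->].
    by rewrite ab.
  by rewrite symG ?eqxx.
(* A class without boundary edges spreads around every vertex and along every edge, so by
   connectivity it is the only one. Then [M] is empty and there are fewer edges than vertices. *)
have [/existsP[w /andP[wW no]]|] := boolP [exists w, (w \in W) && [forall x, forall y, ~~ q w x y]].
  have flip x y : adj G x y -> vec x y == w -> vec y x == w.
    move=> xy vw; have := forallP (forallP no x) y; rewrite /q xy vw /=.
    by case: (vec y x == w).
  have all_at x y : adj G x y -> vec x y == w -> forall z, adj G x z -> vec x z == w.
    move=> xy vw z; rewrite -nbE; apply: (@next_closed _ _ (fun z => vec x z == w) y) => //.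
      by rewrite nbE.
    move=> {}z; rewrite nbE => xz vz; apply: flip; first by rewrite symG // -nbE mem_next nbE.
    by rewrite -vec_next.
  have [[x2 y2] /= xy2 vw2] : exists2 d : T * T, adj G d.1 d.2 & vec d.1 d.2 == w.
    by have /imsetP[d dD ->] := wW; exists d; rewrite ?eqxx //; move: dD; rewrite inE.
  have all_vec x y : adj G x y -> vec x y == w.
    move=> xy; have := con x2 x (adj_vertex xy2) (adj_vertex xy).
    move=> /connectP[p pp xl]; move: xy; rewrite xl {x xl}.
    elim: p x2 y2 xy2 vw2 pp => [|z p IHp] x2 y2 xy2 vw2 /=; first by move=> _; exact: all_at vw2 _.
    move=> /andP[xz pz]; apply: (IHp z x2) => //; first exact: symG.
    by apply: flip => //; exact: all_at vw2 _ xz.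
  have W1 : #|W| <= 1.
    rewrite -(cards1 w); apply: subset_leq_card; apply/fintype.subsetP => _ /imsetP[d dD ->].
    by rewrite inE all_vec //; move: dD; rewrite inE.
  by rewrite EM; move: Fk MW W1 V3; lia.
rewrite negb_exists => /forallP hasq.
have W4 : 4 * #|W| <= #|D|.
  rewrite -[#|D|]sum1_card (partition_big (fun d : T * T => vec d.1 d.2) (mem W)) /=; last first.
    by move=> d dD; apply/imsetP; exists d.
  rewrite mulnC -sum_nat_const; apply: leq_sum => w wW.
  have := hasq w; rewrite wW /= => /forallPn[x /forallPn[y]]; rewrite negbK => qxy.
  apply: leq_trans (class4 _ _ _ qxy) _; rewrite -sum1_card.
  by apply/eq_leq/eq_bigl => d; rewrite inE.
(* From [4 * (#|M| + 1) <= 2 * (#|M| + #|F|)] follows [#|M| + 2 <= #|F|], where [#|F|] is less than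
   the number of vertices. *)
by rewrite EM in DE *; move: Fk MW W4 DE; lia.
Qed.
End EdgeBound.

(** * The edge bound for all planar triangle-free graphs *)

Section PlanarBound.
Variables (R : realType) (T : finType).

Lemma planar_subgraph (H G : graph T) : subgraph H G -> planar R G -> planar R H.
Proof.
move=> [/fintype.subsetP sV /fintype.subsetP sE] [pos [arc [d1 d2 d3 d4 d5 d6]]].
exists pos, arc; split.
- by move=> x y /sV xG /sV yG; exact: d1.
- by move=> e /sE; exact: d2.
- by move=> e /sE; exact: d3.
- by move=> e /sE; exact: d4.
- by move=> e v t /sE eG /sV vG; exact: d5.
- by move=> e e' s t /sE eG /sE eG'; exact: d6.
Qed.

Lemma induced_edgesP (G : graph T) (S e : {set T}) :
  e \in [set e in edges G | e \subset S]%SET -> (e \subset vertices G :&: S)%SET && (#|e| == 2%N).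
Proof. by rewrite inE => /andP[/edgesP/andP[eV ->] eS]; rewrite finset.subsetI eV eS. Qed.

Definition induced (G : graph T) (S : {set T}) : graph T := Graph (@induced_edgesP G S).

Lemma induced_subgraph (G : graph T) (S : {set T}) : subgraph (induced G S) G.
Proof.
split; first exact: finset.subsetIl.
by apply/fintype.subsetP => e; rewrite inE => /andP[].
Qed.

Lemma triangle_free_subgraph (H G : graph T) : subgraph H G -> triangle_free G -> triangle_free H.
Proof.
move=> [_ /fintype.subsetP sE] tf x y z xy yz zx.
exact: (tf x y z (sE _ xy) (sE _ yz) (sE _ zx)).
Qed.

Local Open Scope nat_scope.

(** One and two vertices account for the maximum. The bound is superadditive, so a disconnected
    graph is split into a component and the rest. *)
Lemma planar_bound (G : graph T) : planar R G -> triangle_free G -> 0 < #|vertices G| ->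
  #|edges G| <= maxn #|vertices G|.-1 (#|vertices G|.*2 - 4).
Proof.
have [n] := ubnP #|vertices G|; elim: n G => // n IHn G Vn pG tf V0.
have [V2|V3] := leqP #|vertices G| 2.
  suff : #|edges G| <= 'C(#|vertices G|, 2).
    by case: #|vertices G| V0 V2 => [|[|[|k]]] //= _ _; rewrite ?bin_small ?binn; lia.
  rewrite -cards_draws; apply: subset_leq_card; apply/fintype.subsetP => e.
  by rewrite inE => /edgesP.
have [con|] := boolP [forall x in vertices G, forall y in vertices G, connect (adj G) x y].
  have := connected_bound (planar_has_sides pG) tf V3 _; rewrite leq_max => H.
  apply/orP; right; rewrite -(leq_add2r 4) subnK; last by rewrite -muln2; lia.
  by apply: H => x y xV yV; exact: (forall_inP (forall_inP con x xV) y yV).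
move=> /forall_inPn[x xV /forall_inPn[y yV nxy]].
pose S := [set z | connect (adj G) x z]%SET.
have sG1 := induced_subgraph G S; have sG2 := induced_subgraph G (~: S)%SET.
pose G1 := induced G S; pose G2 := induced G (~: S)%SET.
have VE : #|vertices G| = #|vertices G1| + #|vertices G2|.
  by rewrite -(cardsID S) /= finset.setDE.
have V1 : 0 < #|vertices G1|.
  by apply/card_gt0P; exists x; rewrite !inE xV connect0.
have V2 : 0 < #|vertices G2|.
  by apply/card_gt0P; exists y; rewrite !inE yV nxy.
have EE : #|edges G| <= #|edges G1| + #|edges G2|.
  apply: leq_trans (leq_card_setU _ _); apply: subset_leq_card; apply/fintype.subsetP => e eG.
  have /andP[_ /cards2P[u [v [uv ee]]]] := edgesP eG; subst e.
  rewrite !inE eG /= !finset.subUset !finset.sub1set !inE.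
  have -> : connect (adj G) x v = connect (adj G) x u.
    apply: (same_connect_r (sym_connect_sym (@adj_sym _ G))).
    by apply: connect1; rewrite adj_sym.
  by case: (connect _ x u).
have B1 := IHn G1 _ (planar_subgraph sG1 pG) (triangle_free_subgraph sG1 tf) V1.
have B2 := IHn G2 _ (planar_subgraph sG2 pG) (triangle_free_subgraph sG2 tf) V2.
have {}B1 := B1 ltac:(lia); have {}B2 := B2 ltac:(lia).
apply: leq_trans EE _; move: B1 B2 V1 V2; rewrite VE.
by rewrite -!muln2; lia.
Qed.

Lemma girth_triangle_free (G : graph T) : (4%:R%:E <= girth R G)%E -> triangle_free G.
Proof.
move=> g4 x y z xy yz zx.
have cyc : is_cycle G [:: x; y; z].
  have zxn := adj_neq zx; rewrite eq_sym in zxn.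
  split => //; rewrite /ucycle /= xy yz zx /= !inE negb_or.
  by rewrite (adj_neq xy) (adj_neq yz) zxn.
have : (girth R G <= 3%:R%:E)%E by apply: ereal_inf_lbound; exists [:: x; y; z].
by move=> /(le_trans g4); rewrite lee_fin ler_nat.
Qed.

End PlanarBound.

(** * Explicit decompositions *)

Section Book.
Local Open Scope nat_scope.

(* A drawing with the vertices on a line, in the order given by [pos], and the
   edges in two pages [e] and [f], each pair written in increasing order. *)
Record book (n : nat) (pos : nat -> nat) (e f : rel nat) : Prop := Book {
  book_inj : forall a b, a < n -> b < n -> pos a = pos b -> a = b;
  book_lt : forall a b, a < n -> b < n -> e a b || f a b -> pos a < pos b;
  book_top : forall a b c d, a < n -> b < n -> c < n -> d < n -> e a b -> e c d ->
    ~~ [&& pos a < pos c, pos c < pos b & pos b < pos d];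
  book_bot : forall a b c d, a < n -> b < n -> c < n -> d < n -> f a b -> f c d ->
    ~~ [&& pos a < pos c, pos c < pos b & pos b < pos d] }.

Definition book_adj (e f : rel nat) : rel nat := fun a b => (e a b || f a b) || (e b a || f b a).

Variables (R : realType) (n : nat) (pos : nat -> nat) (e f : rel nat).
Hypothesis bk : book n pos e f.

Lemma book_edgesP (s : {set 'I_n}) :
  s \in [set [set p.1; p.2]%SET | p in [set p : 'I_n * 'I_n | e p.1 p.2 || f p.1 p.2]%SET]%SET ->
  (s \subset [set: 'I_n]%SET) && (#|s| == 2).
Proof.
move=> /imsetP[[x y]]; rewrite inE /= => exy ->; rewrite finset.subsetT cards2.
have := book_lt bk (ltn_ord x) (ltn_ord y) exy.
by case: (eqVneq x y) => // ->; rewrite ltnn.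
Qed.

Definition book_graph : graph 'I_n := Graph book_edgesP.

Lemma book_graph_adj (x y : 'I_n) : adj book_graph x y = book_adj e f x y.
Proof.
apply/imsetP/idP => [[[u v]]|].
  rewrite inE /= /book_adj => uv /setP E.
  have neq : u != v.
    by apply: contraTneq (book_lt bk (ltn_ord u) (ltn_ord v) uv) => ->; rewrite ltnn.
  have := E u; have := E v; rewrite !inE !eqxx orbT /= => /orP[]/eqP ev /orP[]/eqP eu; subst.
  - by rewrite eqxx in neq.
  - by rewrite uv orbT.
  - by rewrite uv.
  - by rewrite eqxx in neq.
move=> /orP[xy|yx]; first by exists (x, y); rewrite ?inE.
by exists (y, x); rewrite ?inE //= finset.setUC.
Qed.

Lemma book_planar : planar R book_graph.
Proof.
pose P (v : 'I_n) : R * R := ((pos v)%:R, 0%R).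
pose pk (s : {set 'I_n}) := [pick p : 'I_n * 'I_n | (s == [set p.1; p.2]%SET) && (e p.1 p.2 || f p.1 p.2)].
have pkP s : s \in edges book_graph -> exists x y,
    [/\ pk s = Some (x, y), s = [set x; y]%SET, e x y || f x y & pos x < pos y].
  move=> /imsetP[p]; rewrite inE => ep ->; rewrite /pk; case: pickP => [[x y] /= /andP[/eqP es exy]|/(_ p)].
    by exists x, y; split => //; exact: (book_lt bk (ltn_ord x) (ltn_ord y) exy).
  by rewrite eqxx ep.
pose sg (x y : 'I_n) : R := if e x y then 1%R else (-1)%R.
pose arc (s : {set 'I_n}) (t : R) : R * R := if pk s is Some (x, y) then
  let a := (pos x)%:R in let b := (pos y)%:R in
  ((a + (b - a) * t)%R, (sg x y * ((b - a) ^+ 2 * (t * (1 - t))))%R) else (0%R, 0%R).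
exists P, arc; split.
- by move=> x y _ _ [] /eqP; rewrite eqr_nat => /eqP /(book_inj bk (ltn_ord x) (ltn_ord y)) /val_inj.
- move=> s /pkP[x [y [sxy _ _ _]]]; apply: continuous_subspaceT; rewrite /arc sxy.
  suff : cont (fun t : R => (((pos x)%:R + ((pos y)%:R - (pos x)%:R) * t)%R,
    (sg x y * (((pos y)%:R - (pos x)%:R) ^+ 2 * (t * (1 - t))))%R)) by [].
  by cts.
- move=> s /pkP[x [y [sxy _ _ lt]]] t u _ _; rewrite /arc sxy => -[/addrI /mulfI H _].
  by apply: H; rewrite subr_eq0 eqr_nat gtn_eqF.
- move=> s /pkP[x [y [sxy se _ lt]]]; rewrite /arc sxy.
  rewrite !mulr0 mul0r !mulr0 addr0 mulr1 subrr !mulr0 addrC subrK.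
  apply/seteqP; split => [p /= [->|->]|p [v /=]].
  - by exists x => //=; rewrite se !inE eqxx.
  - by exists y => //=; rewrite se !inE eqxx orbT.
  - by rewrite se !inE => /orP[]/eqP -> <-; [left|right].
- move=> s v t /pkP[x [y [sxy se _ lt]]] _; rewrite in_itv /= => /andP[t0 t1].
  rewrite /arc sxy => -[_] /eqP; apply/negP; rewrite !mulf_neq0 //.
  + by rewrite /sg; case: ifP; rewrite ?oppr_eq0 oner_eq0.
  + by rewrite subr_eq0 eqr_nat gtn_eqF.
  + by rewrite subr_eq0 eqr_nat gtn_eqF.
  + by rewrite gt_eqF.
  + by rewrite subr_eq0 gt_eqF.
move=> s s' t u /pkP[x [y [sxy se exy lt]]] /pkP[z [w [szw se' ezw lt']]] ne.
rewrite !in_itv /= => /andP[t0 t1] /andP[u0 u1]; rewrite /arc sxy szw => -[ex ey].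
have [xn yn zn wn] : [/\ x < n, y < n, z < n & w < n] by split; exact: ltn_ord.
(* Inside an arc the second coordinate is nonzero, with the sign of its page, so two arcs that meet
   are in the same page. *)
have page : ~~ [&& pos x < pos z, pos z < pos y & pos y < pos w] /\
            ~~ [&& pos z < pos x, pos x < pos w & pos w < pos y].
  have h1 : (0 < ((pos y)%:R - (pos x)%:R) ^+ 2 * (t * (1 - t)) :> R)%R.
    by rewrite !mulr_gt0 ?exprn_gt0 ?subr_gt0 ?ltr_nat.
  have h2 : (0 < ((pos w)%:R - (pos z)%:R) ^+ 2 * (u * (1 - u)) :> R)%R.
    by rewrite !mulr_gt0 ?exprn_gt0 ?subr_gt0 ?ltr_nat.
  move: ey exy ezw; rewrite /sg; case: ifP => xe; case: ifP => ze /=.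
  - by move=> _ _ _; split; exact: (book_top bk).
  - by move=> e12; suff : (1 < 0 :> R)%R by [rewrite ltr10]; lra.
  - by move=> e12; suff : (1 < 0 :> R)%R by [rewrite ltr10]; lra.
  - by move=> _ xf zf; split; exact: (book_bot bk).
have eyy : ((((pos y)%:R - (pos x)%:R) ^+ 2 * (t * (1 - t))) = (((pos w)%:R - (pos z)%:R) ^+ 2 * (u * (1 - u))) :> R)%R.
  have h1 : (0 < ((pos y)%:R - (pos x)%:R) ^+ 2 * (t * (1 - t)) :> R)%R.
    by rewrite !mulr_gt0 ?exprn_gt0 ?subr_gt0 ?ltr_nat.
  have h2 : (0 < ((pos w)%:R - (pos z)%:R) ^+ 2 * (u * (1 - u)) :> R)%R.
    by rewrite !mulr_gt0 ?exprn_gt0 ?subr_gt0 ?ltr_nat.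
  by move: ey; rewrite /sg; case: ifP => _; case: ifP => _; lra.
pose a : R := (pos x)%:R%R; pose b : R := (pos y)%:R%R; pose c : R := (pos z)%:R%R; pose d : R := (pos w)%:R%R.
pose X : R := (a + (b - a) * t)%R.
have ab : (a < b)%R by rewrite ltr_nat.
have cd : (c < d)%R by rewrite ltr_nat.
have aX : (0 < X - a)%R by rewrite /X addrAC subrr add0r mulr_gt0 // subr_gt0.
have bX : (0 < b - X)%R.
  by rewrite (_ : b - X = (b - a) * (1 - t))%R ?mulr_gt0 ?subr_gt0 // /X; ring.
have cX : (0 < X - c)%R by rewrite /X ex addrAC subrr add0r mulr_gt0 // subr_gt0.
have dX : (0 < d - X)%R.
  by rewrite (_ : d - X = (d - c) * (1 - u))%R ?mulr_gt0 ?subr_gt0 // /X ex -/c -/d; ring.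
have prod : ((X - a) * (b - X) = (X - c) * (d - X))%R.
  transitivity ((b - a) ^+ 2 * (t * (1 - t)))%R; first by rewrite /X; ring.
  by rewrite eyy -/c -/d /X ex -/c -/d; ring.
have strict (p q p' q' : R) :
    (0 < p' -> p' <= p -> 0 < q' -> q' <= q -> p * q = p' * q' -> p = p' /\ q = q')%R.
  move=> p0 pp q0 qq E; have h : (p' * q' <= p * q')%R by rewrite ler_pM2r.
  have h' : (p * q' <= p * q)%R by rewrite ler_pM2l // (lt_le_trans p0).
  have E1 : (p * q' = p' * q')%R by lra.
  have E2 : (p * q = p * q')%R by lra.
  split; first by apply: (mulIf (lt0r_neq0 q0)).
  by apply: (mulfI (lt0r_neq0 (lt_le_trans p0 pp))).
(* Both intervals contain [X], so they cross, which [page] excludes, or they are nested. The product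
   of the distances from [X] to the ends grows strictly with the interval, so equal products force
   equal intervals. *)
have same : (a = c)%R /\ (b = d)%R.
  have [ac|ac] := leP a c; have [bd|bd] := leP d b.
  - have h1 : (X - c <= X - a)%R by lra.
    have h2 : (d - X <= b - X)%R by lra.
    by have [e1 e2] := strict _ _ _ _ cX h1 dX h2 prod; split; lra.
  - have [ac'|ac'] := eqVneq a c.
      have h1 : (X - a <= X - c)%R by lra.
      have h2 : (b - X <= d - X)%R by lra.
      by have [e1 e2] := strict _ _ _ _ aX h1 bX h2 (esym prod); split; lra.
    have [+ _] := page; rewrite -!(ltr_nat R) -/a -/b -/c -/d bd lt_neqAle ac' ac /= => /negP[].
    by rewrite andbT; lra.
  - have [bd'|bd'] := eqVneq b d.
      have h1 : (X - a <= X - c)%R by lra.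
      have h2 : (b - X <= d - X)%R by lra.
      by have [e1 e2] := strict _ _ _ _ aX h1 bX h2 (esym prod); split; lra.
    have [_ +] := page; rewrite -!(ltr_nat R) -/a -/b -/c -/d ac /= => /negP[].
    by apply/andP; split; [lra|rewrite lt_neqAle eq_sym bd' bd].
  - have h1 : (X - a <= X - c)%R by lra.
    have h2 : (b - X <= d - X)%R by lra.
    by have [e1 e2] := strict _ _ _ _ aX h1 bX h2 (esym prod); split; lra.
have [/eqP ac /eqP bd] := same; move: ac bd; rewrite !eqr_nat => /eqP ac /eqP bd.
have xz : x = z by apply/val_inj/(book_inj bk).
have yw : y = w by apply/val_inj/(book_inj bk).
by move: ne; rewrite se se' xz yw eqxx.
Qed.
End Book.

(** * Covers of complete graphs by triangle-free books *)

Section BookCover.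
Local Open Scope nat_scope.

Definition no_triangle (n : nat) (r : rel nat) := forall a b c, a < n -> b < n -> c < n ->
  r a b -> r b c -> r c a -> False.

Definition book_cover (n k : nat) := exists (pos : nat -> nat -> nat) (e f : nat -> rel nat),
  (forall i, i < k -> book n (pos i) (e i) (f i) /\ no_triangle n (book_adj (e i) (f i))) /\
  (forall a b, a < b < n -> exists2 i, i < k & book_adj (e i) (f i) a b).

Lemma book_cover_le m n k : m <= n -> book_cover n k -> book_cover m k.
Proof.
move=> mn [pos [e [f [bk cov]]]]; have lt a : a < m -> a < n by move=> ?; exact: leq_trans mn.
exists pos, e, f; split => [i ik|a b /andP[ab bm]]; last by apply: cov; rewrite ab lt.
have [[b1 b2 b3 b4] nt] := bk i ik; split.
  split.
  - by move=> a b /lt an /lt; exact: b1.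
  - by move=> a b /lt an /lt; exact: b2.
  - by move=> a b c d /lt an /lt bn /lt cn /lt; exact: b3.
  - by move=> a b c d /lt an /lt bn /lt cn /lt; exact: b4.
by move=> a b c /lt an /lt bn /lt; exact: nt.
Qed.

Lemma book_cover_decomposable (R : realType) n k : 0 < k -> book_cover n k ->
  girth_decomposable R 4 (complete n) k.
Proof.
move=> k0 [pos [e [f [bk cov]]]].
pose H (i : 'I_k) := book_graph (bk i (ltn_ord i)).1.
exists H; split => [i||].
- split; [split|exact: book_planar|].
  + exact: finset.subsetT.
  + by apply/fintype.subsetP => s /edgesP/andP[_ s2]; rewrite inE.
  rewrite /girth; apply/ereal_infP => _ [c [cyc c3] <-].
  rewrite lee_fin ler_nat; move: cyc c3; case: c => [|x [|y [|z [|w c]]]] //= /andP[/=].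
  rewrite !book_graph_adj => /and4P[xy yz zx _] _ _; exfalso.
  exact: ((bk i (ltn_ord i)).2 x y z (ltn_ord _) (ltn_ord _) (ltn_ord _) xy yz zx).
- apply/setP => x; rewrite inE; apply/finset.bigcupP; exists (Ordinal k0) => //.
  by rewrite inE.
- apply/setP => s; apply/finset.bigcupP/idP => [[i _] /edgesP/andP[_ s2]|]; first by rewrite inE.
  rewrite inE => /cards2P[x [y [xy ->]]].
  wlog lt : x y xy / x < y => [W|].
    have [/W|yx|/val_inj e'] := ltngtP x y; [exact| |by rewrite e' eqxx in xy].
    by rewrite finset.setUC; apply: W; rewrite // eq_sym.
  have [|i ik exy] := cov x y; first by rewrite lt ltn_ord.
  by exists (Ordinal ik) => //; have := book_graph_adj (bk i (ltn_ord (Ordinal ik))).1 x y; rewrite /adj => ->.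
Qed.

(* Two vertices are ordered by their kinds, and by their numbers inside a kind;
   the edges of the two pages [te] and [tf] only depend on the kinds of their
   ends, and each of the kinds in [single] contains at most one vertex. *)
Definition kind_lt (single : seq nat) k l := if k == l then k \notin single else k < l.

(** A kind with several vertices may precede itself in [kind_lt], so the test excludes crossings
    whatever the order inside the kinds. *)
Definition kind_page (single : seq nat) (t : seq (nat * nat)) :=
  all (fun p => all (fun q => ~~ [&& kind_lt single p.1 q.1, kind_lt single q.1 p.2 &
                                     kind_lt single p.2 q.2]) t) t.

(** Edges go up in kind, so a triangle, sorted by kind, consists of [(k, l)], [(l, m)] and
    [(k, m)]. *)
Definition kind_free (t : seq (nat * nat)) :=
  all (fun p => (p.1 < p.2) && all (fun q => (p.2 == q.1) ==> ((p.1, q.2) \notin t)) t) t.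

Lemma kind_freeP t : kind_free t -> forall k l, (k, l) \in t -> k < l /\
  forall m, (l, m) \in t -> (k, m) \notin t.
Proof.
move=> /allP tf k l /tf /= /andP[kl /allP H]; split => // m /H /=.
by rewrite eqxx.
Qed.

Lemma kind_book n kind single te tf :
  (forall u v, u < n -> v < n -> kind u = kind v -> kind u \in single -> u = v) ->
  kind_page single te -> kind_page single tf -> kind_free (te ++ tf) ->
  let e u v := (kind u, kind v) \in te in let f u v := (kind u, kind v) \in tf in
  book n (fun v => kind v * n + v) e f /\ no_triangle n (book_adj e f).
Proof.
move=> kinj pe pf /kind_freeP tfree e f; pose pos v := kind v * n + v.
have posP u v : u < n -> v < n -> pos u < pos v -> kind_lt single (kind u) (kind v).
  move=> un vn; rewrite /pos /kind_lt; case: eqP => [E lt|E lt].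
    apply/negP => ks; have := kinj _ _ un vn E ks => uv; by rewrite uv ltnn in lt.
  rewrite ltn_neqAle; apply/andP; split; first exact/eqP.
  rewrite leqNgt; apply/negP => kk; suff : kind v * n + v < kind u * n + u by lia.
  by nia.
have page t a b c d : kind_page single t -> a < n -> b < n -> c < n -> d < n ->
    (kind a, kind b) \in t -> (kind c, kind d) \in t ->
    ~~ [&& pos a < pos c, pos c < pos b & pos b < pos d].
  move=> /allP pt an bn cn dn /pt /allP H /H; apply: contra => /and3P[h1 h2 h3].
  by rewrite !posP.
split; first split.
- move=> a b an bn E; have := congr1 (modn^~ n) E.
  by rewrite !modnMDl !modn_small.
- move=> a b an bn ab; have /tfree[] : (kind a, kind b) \in te ++ tf by rewrite mem_cat.
  by rewrite /pos; nia.
- by move=> a b c d an bn cn dn; exact: page.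
- by move=> a b c d an bn cn dn; exact: page.
have adjE a b : book_adj e f a b ->
    (kind a, kind b) \in te ++ tf \/ (kind b, kind a) \in te ++ tf.
  by rewrite /book_adj /e /f -!mem_cat => /orP.
move=> a b c _ _ _ /adjE + /adjE + /adjE.
move: (kind a) (kind b) (kind c) => k l m.
case=> h1; case=> h2; case=> h3; have [l1 t1] := tfree _ _ h1; have [l2 t2] := tfree _ _ h2;
  have [l3 t3] := tfree _ _ h3;
  first [by lia | by have := t1 _ h2; rewrite h3 | by have := t1 _ h3; rewrite h2
        | by have := t2 _ h1; rewrite h3 | by have := t2 _ h3; rewrite h1
        | by have := t3 _ h1; rewrite h2 | by have := t3 _ h2; rewrite h1].
Qed.
End BookCover.

(** * Tables for small complete graphs, and an infinite family *)

Section Families.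
Local Open Scope nat_scope.

Definition kind_adj (kind : nat -> nat) (te tf : seq (nat * nat)) :=
  book_adj (fun u v => (kind u, kind v) \in te) (fun u v => (kind u, kind v) \in tf).

(** In a table every kind holds a single vertex, so the kinds are simply the positions on the
    line. *)
Definition table_check n (x : seq nat * (seq (nat * nat) * seq (nat * nat))) :=
  let: (p, (te, tf)) := x in
  [&& size p == n, uniq p, kind_page p te, kind_page p tf & kind_free (te ++ tf)].

Lemma table_cover n (L : seq (seq nat * (seq (nat * nat) * seq (nat * nat)))) :
  all (table_check n) L ->
  all (fun b => all (fun a => has (fun x => kind_adj (nth 0 x.1) x.2.1 x.2.2 a b) L) (iota 0 b)) (iota 0 n) ->
  book_cover n (size L).
Proof.
move=> chk cov; pose x0 : seq nat * (seq (nat * nat) * seq (nat * nat)) := ([::], ([::], [::])).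
exists (fun i v => nth 0 (nth x0 L i).1 v * n + v),
  (fun i u v => (nth 0 (nth x0 L i).1 u, nth 0 (nth x0 L i).1 v) \in (nth x0 L i).2.1),
  (fun i u v => (nth 0 (nth x0 L i).1 u, nth 0 (nth x0 L i).1 v) \in (nth x0 L i).2.2).
split=> [i iL|a b /andP[ab bn]].
  have := allP chk _ (mem_nth x0 iL); case: (nth x0 L i) => [p [te tf]].
  move=> /and5P[/eqP sp up pe pf tfree]; apply: (@kind_book n (nth 0 p) p) => //.
  by move=> u v un vn /eqP; rewrite nth_uniq ?sp // => /eqP.
have bI : b \in iota 0 n by rewrite mem_iota.
have aI : a \in iota 0 b by rewrite mem_iota.
have /hasP[x xL xab] := allP (allP cov b bI) a aI.
by exists (index x L); rewrite ?index_mem // nth_index.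
Qed.

Lemma book_cover2 : book_cover 2 1.
Proof. by apply: (@table_cover 2 [:: ([:: 0; 1], ([:: (0, 1)], [::]))]); vm_compute. Qed.

Lemma book_cover5 : book_cover 5 2.
Proof.
pose C5 := [:: (0, 1); (1, 2); (2, 3); (3, 4); (0, 4)].
by apply: (@table_cover 5 [:: ([:: 0; 1; 2; 3; 4], (C5, [::])); ([:: 0; 3; 1; 4; 2], (C5, [::]))]);
  vm_compute.
Qed.

(* Found by a computer search. *)
Lemma book_cover10 : book_cover 10 3.
Proof.
by apply: (@table_cover 10
 [:: ([:: 8; 7; 1; 2; 5; 4; 9; 3; 6; 0],
   ([:: (0, 8); (1, 7); (1, 8); (3, 5); (3, 7)],
    [:: (0, 5); (1, 4); (1, 5); (2, 3); (2, 4); (5, 6); (6, 9); (7, 9); (8, 9)]));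
  ([:: 4; 7; 1; 3; 5; 8; 2; 0; 6; 9],
   ([:: (0, 8); (1, 3); (3, 7); (4, 5); (4, 6); (7, 8); (8, 9)],
    [:: (0, 1); (1, 9); (2, 3); (2, 5); (2, 9); (3, 4); (6, 7); (6, 9)]));
  ([:: 9; 0; 4; 2; 8; 7; 6; 5; 3; 1],
   ([:: (0, 8); (1, 2); (2, 3); (2, 8); (3, 7); (4, 6); (6, 7); (7, 8)],
    [:: (0, 1); (0, 9); (1, 5); (3, 4); (3, 5); (5, 6); (5, 9); (7, 9)]))]); vm_compute.
Qed.

Variable p : nat.
Hypothesis p3 : 2 < p.

(* The vertices of [K_(4p+2)] are [a = 4p], [b = 4p+1] and, for [j < p], the group
   [4j, 4j+1, 4j+2, 4j+3]; write [O_j = {4j, 4j+2}] and [E_j = {4j+1, 4j+3}].  For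
   the tournament [arrow] below, in which every [i] points to its cyclic
   successor [nxt i], the graph [i < p] joins [O_i] to [E_i], to [O_j] if [i -> j]
   and to [E_j] if [j -> i] (kind 7), and it joins [E_i] to [E_j] if [i -> j] and to
   [O_j] if [j -> i] (kinds 1, 2, 3, where 1 and 3 are [4 nxt i + 3] and
   [4 nxt i + 1]).  It also has the edges from [a] to [4 nxt i + 3] and [4i + 2]
   and those from [b] to [4 nxt i + 1] and [4i]. *)

Definition arrow i j := (i == p.-1) && (j == 0) || (i < j) && ~~ ((i == 0) && (j == p.-1)).

Definition nxt i := if i.+1 == p then 0 else i.+1.

Lemma arrow_total i j : i < p -> j < p -> i != j -> arrow j i = ~~ arrow i j.
Proof. by rewrite /arrow; lia. Qed.

(** This needs [2 < p]: for two indices, each is the successor of the other and both arrows would be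
    required. *)
Lemma arrow_nxt i : i < p -> arrow i (nxt i).
Proof. by move: p3; rewrite /arrow /nxt; case: (i.+1 =P p); lia. Qed.

Lemma nxt_neq i : i < p -> nxt i != i.
Proof. by move: p3; rewrite /nxt; case: (i.+1 =P p); lia. Qed.

Lemma nxt_lt i : i < p -> nxt i < p.
Proof. by move: p3; rewrite /nxt; case: (i.+1 =P p); lia. Qed.

Lemma nxt_onto j : j < p -> exists2 i, i < p & nxt i = j.
Proof.
move=> jp; exists (if j == 0 then p.-1 else j.-1); rewrite /nxt; move: p3.
  by case: (j =P 0); lia.
by case: (j =P 0) => j0; case: eqP; lia.
Qed.

(** Kinds 1 to 3 form a block joined to both vertices of [E_i]; its extreme vertices are those
    wanted by [a], placed just before the block, and by [b], placed just after. Kind 7 is joined to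
    [O_i], kinds 5 and 9, and lies between the vertices 6 and 8 of [E_i]. *)
Definition kind i v := if v == 4 * p then 0 else if v == 4 * p + 1 then 4 else
  let j := v %/ 4 in let s := v %% 4 in
  if j == i then nth 0 [:: 5; 6; 9; 8] s
  else if odd s (+) arrow i j then 7
  else if j == nxt i then (if s == 3 then 1 else 3) else 2.

Definition kind_top :=
  [:: (0, 1); (0, 9); (1, 8); (2, 8); (3, 8); (3, 4); (4, 5); (5, 6); (5, 7); (5, 8)].
Definition kind_bot := [:: (1, 6); (2, 6); (3, 6); (6, 9); (7, 9); (8, 9)].
(** The only vertex of each single kind; the entries for kinds 2 and 7 are dummies. *)
Definition kind_val i k := nth 0 [:: 4 * p; 4 * nxt i + 3; 0; 4 * nxt i + 1; 4 * p + 1; 4 * i;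
  4 * i + 1; 0; 4 * i + 3; 4 * i + 2] k.
Definition kind_single := [:: 0; 1; 3; 4; 5; 6; 8; 9].

Lemma kind_valP i v : i < p -> v < 4 * p + 2 -> kind i v \in kind_single -> v = kind_val i (kind i v).
Proof.
move=> ip vn; rewrite /kind; have ar := arrow_nxt ip.
case: eqP => [-> //|v0]; case: eqP => [-> //|v1] /=.
have s4 : v %% 4 < 4 by rewrite ltn_mod.
have vE := divn_eq v 4; set j := v %/ 4 in vE *; set s := v %% 4 in s4 vE *.
case: eqP => [ji|ji].
  by case: s s4 vE => [|[|[|[|s]]]] //= _ -> _; rewrite /kind_val /= ji; lia.
case: ifP => // os; case: eqP => [jn|//].
move: os; rewrite jn ar; case: s s4 vE => [|[|[|[|s]]]] //= _ -> _ _; rewrite /kind_val /= jn; lia.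
Qed.

Lemma kind_inj i u v : i < p -> u < 4 * p + 2 -> v < 4 * p + 2 -> kind i u = kind i v ->
  kind i u \in kind_single -> u = v.
Proof.
move=> ip un vn E ks; rewrite (kind_valP ip un ks) E; symmetry.
by apply: kind_valP; rewrite -?E.
Qed.

Lemma kind_own i s : i < p -> s < 4 -> kind i (4 * i + s) = nth 0 [:: 5; 6; 9; 8] s.
Proof.
move=> ip s4; rewrite /kind ifN; last by lia.
rewrite ifN; last by lia.
have -> : (4 * i + s) %/ 4 = i by lia.
have -> : (4 * i + s) %% 4 = s by lia.
by rewrite eqxx.
Qed.

Lemma kind_in i j s : i < p -> j < p -> j != i -> s < 4 -> odd s (+) arrow i j -> kind i (4 * j + s) = 7.
Proof.
move=> ip jp ji s4 os; rewrite /kind ifN; last by lia.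
rewrite ifN; last by lia.
have -> : (4 * j + s) %/ 4 = j by lia.
have -> : (4 * j + s) %% 4 = s by lia.
by rewrite (negPf ji) os.
Qed.

Lemma kind_out i j s : i < p -> j < p -> j != i -> s < 4 -> ~~ (odd s (+) arrow i j) ->
  kind i (4 * j + s) \in [:: 1; 2; 3].
Proof.
move=> ip jp ji s4 os; rewrite /kind ifN; last by lia.
rewrite ifN; last by lia.
have -> : (4 * j + s) %/ 4 = j by lia.
have -> : (4 * j + s) %% 4 = s by lia.
by rewrite (negPf ji) (negPf os); case: ifP => // _; case: ifP.
Qed.

Lemma kind_nxt i : i < p -> kind i (4 * nxt i + 1) = 3 /\ kind i (4 * nxt i + 3) = 1.
Proof.
move=> ip; have np := nxt_lt ip; have ne := nxt_neq ip; have ar := arrow_nxt ip.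
split; (rewrite /kind ifN; last by lia); (rewrite ifN; last by lia).
  have -> : (4 * nxt i + 1) %/ 4 = nxt i by lia.
  have -> : (4 * nxt i + 1) %% 4 = 1 by lia.
  by rewrite (negPf ne) ar eqxx.
have -> : (4 * nxt i + 3) %/ 4 = nxt i by lia.
have -> : (4 * nxt i + 3) %% 4 = 3 by lia.
by rewrite (negPf ne) ar eqxx.
Qed.

Let n := 4 * p + 2.

(* The last graph: the edge [ab], the remaining matching edges between a vertex
   [x] with [x %% 4 < 2] and [x + 2], and the edges from [a] to the former and
   from [b] to the latter. *)
Definition last_pos v := if v == 4 * p then 0 else if v == 4 * p + 1 then 16 * p + 10
  else if v %% 4 < 2 then 1 + v else 8 * p + 10 - v.
Definition last_top u v := (u == 4 * p) && (v == 4 * p + 1) ||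
  [&& u < 4 * p, u %% 4 < 2 & v == u + 2].
Definition last_bot u v := [&& u == 4 * p, v < 4 * p & v %% 4 < 2] ||
  [&& u < 4 * p, 2 <= u %% 4 & v == 4 * p + 1].

(** The vertices [v] with [2 <= v %% 4] come in decreasing order, which nests the matching edges;
    [a] and [b] are at the two extremes. *)
Lemma last_posE v : v < n -> [\/ v = 4 * p /\ last_pos v = 0,
  v = 4 * p + 1 /\ last_pos v = 16 * p + 10, [/\ v < 4 * p, v %% 4 < 2 & last_pos v = 1 + v] |
  [/\ v < 4 * p, 2 <= v %% 4 & last_pos v = 8 * p + 10 - v]].
Proof.
rewrite /n => vn; rewrite /last_pos; case: (v =P 4 * p) => [->|v0]; first by constructor 1.
case: (v =P 4 * p + 1) => [->|v1]; first by constructor 2.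
by case: ltnP => h; [constructor 3|constructor 4]; split; lia.
Qed.

Lemma last_book : book n last_pos last_top last_bot /\ no_triangle n (book_adj last_top last_bot).
Proof.
have m4 u : (u + 2) %% 4 = if u %% 4 < 2 then u %% 4 + 2 else u %% 4 - 2.
  by case: ltnP; lia.
split; first split.
- by move=> a b /last_posE A /last_posE B; case: A => -[]; case: B => -[]; lia.
- move=> a b /last_posE A /last_posE B; rewrite /last_top /last_bot.
  by case: A => -[]; case: B => -[]; lia.
- move=> a b c d /last_posE A /last_posE B /last_posE C /last_posE D /orP[h1|h1] /orP[h2|h2].
  + by case: A => -[]; case: B => -[]; case: C => -[]; case: D => -[]; lia.
  + by case: A => -[]; case: B => -[]; case: C => -[]; case: D => -[]; lia.
  + by case: A => -[]; case: B => -[]; case: C => -[]; case: D => -[]; lia.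
  + by case: A => -[]; case: B => -[]; case: C => -[]; case: D => -[]; lia.
- move=> a b c d /last_posE A /last_posE B /last_posE C /last_posE D /orP[h1|h1] /orP[h2|h2].
  + by case: A => -[]; case: B => -[]; case: C => -[]; case: D => -[]; lia.
  + by case: A => -[]; case: B => -[]; case: C => -[]; case: D => -[]; lia.
  + by case: A => -[]; case: B => -[]; case: C => -[]; case: D => -[]; lia.
  + by case: A => -[]; case: B => -[]; case: C => -[]; case: D => -[]; lia.
(* The last graph is bipartite, with [b] on the side of the vertices with [v %% 4 < 2], and [a] on
   the other side. *)
pose col v := (v == 4 * p + 1) || (v < 4 * p) && (v %% 4 < 2).
have cadj a b : book_adj last_top last_bot a b -> col a != col b.
  rewrite /book_adj /last_top /last_bot /col => H; have := m4 a; have := m4 b.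
  by do 2 (case: ltnP => ?); lia.
move=> a b c _ _ _ /cadj + /cadj + /cadj.
by case: (col a); case: (col b); case: (col c).
Qed.
End Families.

Section Family.
Local Open Scope nat_scope.

(** Each graph [i < p] has [8 p] edges, which is [2 n - 4] for [n = 4 p + 2], and the last one has
    [6 p + 1]: the total is the number of edges of [K_n], so no edge is covered twice. *)
Lemma book_cover_family p : 2 < p -> book_cover (4 * p + 2) p.+1.
Proof.
move=> p3; pose n := 4 * p + 2.
pose K := kind p.
pose pos i v := if i < p then K i v * n + v else last_pos p v.
pose e i u v := if i < p then (K i u, K i v) \in kind_top else last_top p u v.
pose f i u v := if i < p then (K i u, K i v) \in kind_bot else last_bot p u v.
exists pos, e, f; split=> [i ip|].
  have [lt|ge] := ltnP i p.
    rewrite /pos /e /f lt; apply: (@kind_book n (K i) kind_single) => //.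
    by move=> u v un vn; exact: kind_inj.
  by rewrite /pos /e /f ltnNge ge /=; exact: last_book.
have inner i u v : i < p ->
    ((K i u, K i v) \in kind_top ++ kind_bot) || ((K i v, K i u) \in kind_top ++ kind_bot) ->
    exists2 i, i < p.+1 & book_adj (e i) (f i) u v.
  by move=> ip uv; exists i; [exact: ltnW|rewrite /book_adj /e /f ip -!mem_cat].
have outer u v : last_top p u v || last_bot p u v || (last_top p v u || last_bot p v u) ->
    exists2 i, i < p.+1 & book_adj (e i) (f i) u v.
  by move=> uv; exists p; rewrite // /book_adj /e /f ltnn.
have swap u v : (exists2 i, i < p.+1 & book_adj (e i) (f i) v u) ->
    exists2 i, i < p.+1 & book_adj (e i) (f i) u v.
  by move=> [i ip uv]; exists i => //; rewrite /book_adj orbC.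
have Ka i : K i (4 * p) = 0 by rewrite /K /kind eqxx.
have Kb i : K i (4 * p + 1) = 4 by rewrite /K /kind eqxx ifN //; lia.
have own i s : i < p -> s < 4 -> K i (4 * i + s) = nth 0 [:: 5; 6; 9; 8] s by exact: kind_own.
(* The last graph covers [s < 2]; the vertex [4 i + 2] is left to graph [i], and [4 i + 3] to the
   graph whose successor is [i]. *)
have to_a i s : i < p -> s < 4 -> exists2 k, k < p.+1 & book_adj (e k) (f k) (4 * i + s) (4 * p).
  move=> ip s4; have [h2|h2] := ltnP s 2.
    apply: outer; rewrite /last_bot /last_top; have -> : (4 * i + s) %% 4 = s by lia.
    by lia.
  case: s s4 h2 => [|[|[|[|s]]]] // _ _.
    by apply: (inner i) => //; rewrite Ka own.
  have [k kp <-] := nxt_onto p3 ip; apply: (inner k) => //.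
  by rewrite Ka /K (kind_nxt p3 kp).2.
have to_b i s : i < p -> s < 4 -> exists2 k, k < p.+1 & book_adj (e k) (f k) (4 * i + s) (4 * p + 1).
  move=> ip s4; have [h2|h2] := ltnP 1 s.
    apply: outer; rewrite /last_bot /last_top; have -> : (4 * i + s) %% 4 = s by lia.
    by lia.
  case: s s4 h2 => [|[|s]] // _ _.
    by apply: (inner i) => //; rewrite Kb own.
  have [k kp <-] := nxt_onto p3 ip; apply: (inner k) => //.
  by rewrite Kb /K (kind_nxt p3 kp).1.
(* If [i] points to [j], graph [i] covers the pairs with [s] and [t] of equal parity, and graph [j]
   those of opposite parity. *)
have cross i j s t : i < p -> j < p -> s < 4 -> t < 4 -> arrow p i j -> i != j ->
    exists2 k, k < p.+1 & book_adj (e k) (f k) (4 * i + s) (4 * j + t).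
  move=> ip jp s4 t4 ij ne.
  have ji : arrow p j i = false by rewrite (arrow_total p3) // ij.
  have ne' : j != i by rewrite eq_sym.
  have [os|os] := eqVneq (odd s) (odd t).
    apply: (inner i) => //; rewrite own //.
    have [ot|ot] := boolP (odd t).
      have no : ~~ (odd t (+) arrow p i j) by rewrite ij ot.
      have := kind_out p3 ip jp ne' t4 no; rewrite -/(K i).
      move: (K i (4 * j + t)) => k; rewrite !inE; rewrite ot in os.
      by move=> /or3P[]/eqP->; case: s s4 os => [|[|[|[|s]]]].
    have yes : odd t (+) arrow p i j by rewrite ij (negPf ot).
    rewrite /K (kind_in p3 ip jp ne' t4 yes).
    by rewrite (negPf ot) in os; case: s s4 os => [|[|[|[|s]]]].
  apply: (inner j) => //; rewrite own //.
  have [os'|os'] := boolP (odd s).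
    have yes : odd s (+) arrow p j i by rewrite ji os'.
    rewrite /K (kind_in p3 jp ip ne s4 yes).
    by move: os; rewrite os'; case: t t4 => [|[|[|[|t]]]].
  have no : ~~ (odd s (+) arrow p j i) by rewrite ji (negPf os').
  have := kind_out p3 jp ip ne s4 no; rewrite -/(K j).
  move: (K j (4 * i + s)) => k; rewrite !inE; rewrite (negPf os') in os.
  by move=> /or3P[]/eqP->; case: t t4 os => [|[|[|[|t]]]].
have dec v : v < 4 * p -> exists i s, [/\ i < p, s < 4 & v = 4 * i + s].
  by move=> vp; exists (v %/ 4), (v %% 4); split; lia.
move=> a b /andP[ab bn].
have [b4|b4] := ltnP b (4 * p); last first.
  have [bE|bE] : b = 4 * p \/ b = 4 * p + 1 by lia.
    have a4 : a < 4 * p by lia.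
    have [i [s [ip s4 ->]]] := dec a a4; rewrite bE; exact: to_a.
  rewrite bE.
  have [a4|a4] := ltnP a (4 * p).
    have [i [s [ip s4 ->]]] := dec a a4; exact: to_b.
  have -> : a = 4 * p by lia.
  by apply: outer; rewrite /last_top !eqxx.
have [i [s [ip s4 aE]]] := dec a (ltn_trans ab b4).
have [j [t [jp t4 bE]]] := dec b b4.
rewrite aE bE; have [ij|ij] := eqVneq i j; last first.
  have [ar|ar] := boolP (arrow p i j); first exact: cross.
  by apply/swap/cross => //; rewrite 1?eq_sym // (arrow_total p3) // eq_sym.
subst j; have st : s < t by lia.
have [in4|out] := boolP ((s, t) \in [:: (0, 1); (0, 3); (1, 2); (2, 3)]).
  apply: (inner i) => //; rewrite !own //.
  by move: in4; rewrite !inE => /or4P[]/eqP[-> ->].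
have st2 : t = s + 2 /\ s < 2.
  by move: out; case: s s4 st {aE} => [|[|[|[|s]]]] //; case: t t4 {bE} => [|[|[|[|t]]]].
apply: outer; rewrite /last_top; have -> : (4 * i + s) %% 4 = s by lia.
by lia.
Qed.

(** [(n + 5) %/ 4] is the ceiling of [(n + 2) / 4], constant on blocks of four that end at
    [4 p + 2]; covers restrict to fewer vertices. The block ending at 6 is covered only up to 5, by
    the pentagons. *)
Lemma book_cover_all n : n <> 6 -> 0 < n -> book_cover n ((n + 5) %/ 4).
Proof.
move=> n6 n0; pose p := (n + 1) %/ 4.
have [n2|n2] := leqP n 2.
  have -> : (n + 5) %/ 4 = 1 by lia.
  exact: book_cover_le n2 book_cover2.
have [n5|n5] := leqP n 5.
  have -> : (n + 5) %/ 4 = 2 by lia.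
  exact: book_cover_le n5 book_cover5.
have [n10|n10] := leqP n 10.
  have -> : (n + 5) %/ 4 = 3 by lia.
  exact: book_cover_le n10 book_cover10.
have -> : (n + 5) %/ 4 = p.+1 by rewrite /p; lia.
by apply: book_cover_le (book_cover_family _); rewrite /p; lia.
Qed.
End Family.

(** * Lower bounds, and the value of the thickness *)

Section Thickness.
Local Open Scope nat_scope.
Variable R : realType.

Lemma thicknessP g (T : finType) (G : graph T) k :
  girth_decomposable R g G k ->
  (forall j, girth_decomposable R g G j -> k <= j) -> girth_thickness R g G = k.
Proof.
move=> dk kmin; rewrite /girth_thickness; case: ex_minnP => m /asboolP dm mmin.
by apply/eqP; rewrite eqn_leq kmin // mmin //; apply/asboolP.
Qed.

Lemma card_bigcup_leq (I T : finType) (F : I -> {set T}) b : (forall i, #|F i| <= b) ->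
  #|(\bigcup_i F i)%SET| <= #|I| * b.
Proof.
move=> Fb; rewrite -sum_nat_const.
apply: (@leq_trans (\sum_(i : I) #|F i|)); last exact: leq_sum.
elim/big_ind2: _ => [|A a B c Aa Bc|i _]; [by rewrite cards0| |by []].
by apply: leq_trans (leq_card_setU _ _) _; exact: leq_add.
Qed.

Lemma decomposable_lower n j : 0 < n -> girth_decomposable R 4 (complete n) j -> n + 2 <= 4 * j.
Proof.
move=> n0 [H [Hi HV HE]].
have j0 : 0 < j.
  rewrite lt0n; apply/eqP => j0; subst j.
  have : Ordinal n0 \in vertices (complete n) by rewrite inE.
  by rewrite -HV => /finset.bigcupP[[]].
have [n2|n3] := leqP n 2; first by lia.
have bound i : #|edges (H i)| <= n.*2 - 4.
  have [_ pl /girth_triangle_free tf] := Hi i.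
  have Vn : #|vertices (H i)| <= n by rewrite -[X in _ <= X]card_ord max_card.
  have [V0|V0] := posnP #|vertices (H i)|.
    rewrite (_ : edges (H i) = finset.set0) ?cards0 //; apply/setP => e; rewrite inE.
    apply/negP => /edgesP/andP[/subset_leq_card + /eqP e2].
    by rewrite V0 e2.
  by have := planar_bound pl tf V0; move: Vn; rewrite -!muln2; lia.
have := card_bigcup_leq bound; rewrite card_ord HE.
rewrite [#|edges _|](_ : _ = 'C(n, 2)); last first.
  rewrite -[in RHS](card_ord n) -cardsT -cards_draws; congr #|pred_of_set _|.
  by apply/setP => e; rewrite !inE finset.subsetT.
move=> E; have : n * (n - 1) <= j * (n.*2 - 4) * 2.
  have := bin2odd; have := leq_mul2r 2 'C(n, 2) (j * (n.*2 - 4)); rewrite E => _ _.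
  apply: leq_trans (leq_mul E (leqnn 2)).
  by rewrite bin2 subn1 muln2 -[X in X <= _]odd_double_half oddM; case: (n) n0 => // m _ /=; rewrite andNb.
(* As [n (n - 1) = (n + 1) (n - 2) + 2], the inequality gives [n + 1 < 4 j], and integrality yields
   the bound. *)
rewrite -muln2; nia.
Qed.

Lemma ramsey6 (T : finType) (G0 G1 : graph T) : 5 < #|T| ->
  (forall x y, x != y -> adj G0 x y || adj G1 x y) ->
  triangle_free G0 -> triangle_free G1 -> False.
Proof.
move=> T6 cov tf0 tf1.
have /card_gt0P[x _] : 0 < #|T| by exact: leq_trans T6.
have half (A B : graph T) : (forall x y, x != y -> adj A x y || adj B x y) -> triangle_free A ->
    triangle_free B -> 2 < #|[set y | adj A x y]%SET| -> False.
  move=> cv tA tB /card_gt2P[a [b [c [[]]]]]; rewrite !inE => xa xb xc [ab bc ca].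
  have side u v : adj A x u -> adj A x v -> u != v -> adj B u v.
    move=> xu xv uv; have /orP[uvA|//] := cv u v uv.
    by exfalso; apply: (tA x u v) => //; rewrite adj_sym.
  by apply: (tB a b c); apply: side.
have [|h0] := ltnP 2 #|[set y | adj G0 x y]%SET|; first exact: (half G0 G1).
have [|h1] := ltnP 2 #|[set y | adj G1 x y]%SET|.
  by apply: (half G1 G0) => // u v uv; rewrite orbC; exact: cov.
(* At least five other vertices, but at most two neighbours of [x] in each graph. *)
have : #|[set~ x]%SET| <= 4.
  apply: leq_trans (leq_add h0 h1); apply: leq_trans (leq_card_setU _ _).
  apply: subset_leq_card; apply/fintype.subsetP => y; rewrite !inE => yx.
  by rewrite cov // eq_sym.
by rewrite cardsC1; move: T6; case: #|T| => // m; lia.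
Qed.

Lemma decomposable6_lower j : girth_decomposable R 4 (complete 6) j -> 3 <= j.
Proof.
move=> dj; have := @decomposable_lower 6 j isT dj.
case: j dj => [|[|[|j]]] // [H [Hi _ HE]] _; exfalso.
pose i0 : 'I_2 := ord0; pose i1 : 'I_2 := lift ord0 ord0.
have tf i : triangle_free (H i) by have [_ _ /girth_triangle_free] := Hi i.
apply: (@ramsey6 _ (H i0) (H i1)) (tf i0) (tf i1); first by rewrite card_ord.
move=> x y xy; have : [set x; y]%SET \in edges (complete 6) by rewrite inE cards2 xy.
rewrite -HE => /finset.bigcupP[i _]; case: (unliftP ord0 i) => [k ->|->].
  by rewrite (ord1 k) /adj => ->; rewrite orbT.
by rewrite /adj => ->.
Qed.
End Thickness.

Theorem theorem2 (R : realType) :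
  (forall n : nat, (1 <= n)%N -> n <> 6%N ->
     (girth_thickness R 4 (complete n))%:Z = Num.ceil ((n + 2)%N%:Q / 4)) /\
  girth_thickness R 4 (complete 6) = 3%N.
Proof.
split=> [n n1 n6|]; last first.
  apply: thicknessP; last exact: decomposable6_lower.
  by apply: book_cover_decomposable => //; apply: (book_cover_le _ book_cover10).
have k0 : (0 < (n + 5) %/ 4)%N by lia.
rewrite (@thicknessP R 4 _ (complete n) ((n + 5) %/ 4)%N).
- apply/esym/ceil_def; rewrite ltr_pdivlMr // ler_pdivrMr //.
  rewrite -[4%R]/(4%:Z%:~R) -!intrM ltr_int ler_int; lia.
- exact: book_cover_decomposable (book_cover_all n6 n1).
- by move=> j /(decomposable_lower n1); lia.
Qed.
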